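(* Suppose $X$ is a metric space. If $X=\bigcup_{i\in I}T_i$, where $\{T_i\}_{i\in I}$ is a finite collection of quasiconformal trees (each $T_i\subset X$ carrying the restricted metric), then $\dim_L(X)=1$.
   Context: A metric space $T$ is a tree if it is compact, connected, locally connected, and every pair of distinct points of $T$ forms the endpoints of a unique Jordan arc (homeomorphic image of $[0,1]$) in $T$. A metric space is $C$-bounded turning ($C\ge1$) if any two points $u,v$ lie in a compact connected set $E$ with $\mathrm{diam}(E)\le C\,d(u,v)$. It is $D$-doubling if every ball of radius $r$ can be covered by at most $D$ balls of radius $r/2$. A quasiconformal (QC) tree is a tree that is $C$-bounded turning and $D$-doubling for some $C,D$. For $\delta>0$, a $\delta$-chain is a finite sequence $x_0,\dots,x_m$ of points with $d(x_i,x_{i+1})\le\delta$ for all $i<m$. A set $U$ is $\delta$-connected if every pair of points of $U$ is contained in a $\delta$-chain in $U$; a $\delta$-component of a metric space is a maximal $\delta$-connected subset. A map $f:X\to Y$ between metric spaces is Lipschitz light if there are $L,Q>0$ such that $f$ is $L$-Lipschitz and, for every $r>0$ and every $E\subset Y$ with $\mathrm{diam}(E)\le r$, the $r$-components of $f^{-1}(E)$ have diameter at most $Qr$. A metric space $X$ has Lipschitz dimension at most $n$ if there exists a Lipschitz light map $X\to\mathbb{R}^n$; the Lipschitz dimension $\dim_L(X)$ is the infimum of such $n$.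
   Formalization: The formal theorem also assumes that at least one of the trees contains two distinct points; if every tree is empty or a single point (or there are no trees), X is finite and its Lipschitz dimension is 0, so the claim fails. *)

(* Defs.v *)
From HB Require Import structures.
From mathcomp Require Import all_boot all_order all_algebra.
From mathcomp Require Import all_classical all_reals all_analysis.
From mathcomp Require Import ring.

Set Implicit Arguments.
Unset Strict Implicit.
Unset Printing Implicit Defensive.

Import Order.TTheory GRing.Theory Num.Theory.
Import numFieldNormedType.Exports.

Local Open Scope classical_set_scope.
Local Open Scope ring_scope.

(* A subset [A] of a metric space, as a metric space for the restricted metric. *)
Definition restricted (R : realType) (X : metricType R) (A : set X) : Type :=
  {x : X | x \in A}.

Section restricted_metric.
Variables (R : realType) (X : metricType R) (A : set X).

HB.instance Definition _ := Choice.on (restricted A).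

Definition restricted_dist (x y : restricted A) : R :=
  mdist (sval x) (sval y).

Lemma restricted_distxx x : restricted_dist x x = 0.
Proof. exact: mdistxx. Qed.

Lemma restricted_dist_positivity x y : restricted_dist x y = 0 -> x = y.
Proof. by move/mdist_positivity/val_inj. Qed.

Lemma restricted_dist_sym x y : restricted_dist x y = restricted_dist y x.
Proof. exact: metric_sym. Qed.

Lemma restricted_dist_triangle y x z :
  restricted_dist x z <= restricted_dist x y + restricted_dist y z.
Proof. exact: metric_triangle. Qed.

HB.instance Definition _ := @isMetric.Build R (restricted A) restricted_dist
  restricted_distxx restricted_dist_positivity restricted_dist_sym
  restricted_dist_triangle.

End restricted_metric.

(* R^n with the Euclidean metric; ['rV[R]_n] itself carries the sup norm in the
   library, hence the alias. *)
Definition euclidean (R : realType) (n : nat) : Type := 'rV[R]_n.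

Section euclidean_metric.
Variables (R : realType) (n : nat).

HB.instance Definition _ := Choice.copy (euclidean R n) 'rV[R]_n.

Definition euclidean_dist (x y : euclidean R n) : R :=
  Num.sqrt (\sum_(i < n) ((x : 'rV[R]_n) 0 i - (y : 'rV[R]_n) 0 i) ^+ 2).

Lemma euclidean_distxx x : euclidean_dist x x = 0.
Proof.
by rewrite /euclidean_dist big1 ?sqrtr0// => i _; rewrite subrr expr0n.
Qed.

Lemma euclidean_dist_positivity x y : euclidean_dist x y = 0 -> x = y.
Proof.
have sge0 (i : 'I_n) : true ->
    0 <= ((x : 'rV[R]_n) 0 i - (y : 'rV[R]_n) 0 i) ^+ 2.
  by move=> _; exact: sqr_ge0.
move/eqP; rewrite sqrtr_eq0 => sle0.
have /eqP : \sum_(i < n) ((x : 'rV[R]_n) 0 i - (y : 'rV[R]_n) 0 i) ^+ 2 = 0.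
  by apply/eqP; rewrite eq_le sle0 sumr_ge0.
rewrite psumr_eq0// => /allP xy; apply/rowP => i.
by have := xy i (mem_index_enum i); rewrite sqrf_eq0 subr_eq0 => /eqP.
Qed.

Lemma euclidean_dist_sym x y : euclidean_dist x y = euclidean_dist y x.
Proof.
by rewrite /euclidean_dist; congr Num.sqrt; apply: eq_bigr => i _; rewrite -sqrrN opprB.
Qed.

Lemma euclidean_cauchy_schwarz (u v : 'I_n -> R) :
  (\sum_i u i * v i) ^+ 2 <= (\sum_i u i ^+ 2) * (\sum_i v i ^+ 2).
Proof.
have sq0 : 0 <= \sum_i \sum_j (u i * v j - u j * v i) ^+ 2.
  by apply: sumr_ge0 => i _; apply: sumr_ge0 => j _; exact: sqr_ge0.
have sqE : \sum_i \sum_j (u i * v j - u j * v i) ^+ 2 =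
    2 * ((\sum_i u i ^+ 2) * (\sum_i v i ^+ 2) - (\sum_i u i * v i) ^+ 2).
  have uv2 : (\sum_i u i ^+ 2) * (\sum_i v i ^+ 2) =
      \sum_i \sum_j u i ^+ 2 * v j ^+ 2 by rewrite big_distrlr.
  have uvE : (\sum_i u i * v i) ^+ 2 =
      \sum_i \sum_j (u i * v i) * (u j * v j) by rewrite expr2 big_distrlr.
  transitivity (\sum_i \sum_j (u i ^+ 2 * v j ^+ 2) +
      \sum_i \sum_j (u j ^+ 2 * v i ^+ 2) -
      2 * \sum_i \sum_j (u i * v i) * (u j * v j)).
    rewrite mulr_sumr -big_split -sumrB; apply: eq_bigr => i _ /=.
    rewrite mulr_sumr -big_split -sumrB; apply: eq_bigr => j _ /=.
    by ring.
  rewrite [X in _ + X - _]exchange_big /= -uv2 -uvE mulrBr; congr (_ - _).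
  by rewrite mulr_natl mulr2n.
by move: sq0; rewrite sqE pmulr_rge0// subr_ge0.
Qed.

Lemma euclidean_dist_triangle y x z :
  euclidean_dist x z <= euclidean_dist x y + euclidean_dist y z.
Proof.
rewrite /euclidean_dist.
set u := fun i => (x : 'rV[R]_n) 0 i - (y : 'rV[R]_n) 0 i.
set v := fun i => (y : 'rV[R]_n) 0 i - (z : 'rV[R]_n) 0 i.
have u0 : 0 <= \sum_i u i ^+ 2 by apply: sumr_ge0 => i _; exact: sqr_ge0.
have v0 : 0 <= \sum_i v i ^+ 2 by apply: sumr_ge0 => i _; exact: sqr_ge0.
have -> : \sum_i ((x : 'rV[R]_n) 0 i - (z : 'rV[R]_n) 0 i) ^+ 2 =
    \sum_i u i ^+ 2 + (\sum_i u i * v i) *+ 2 + \sum_i v i ^+ 2.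
  rewrite -sumrMnl -!big_split; apply: eq_bigr => i _ /=.
  by rewrite -sqrrD /u /v addrA subrK.
rewrite -(ler_pXn2r (ltn0Sn 1)) ?nnegrE ?addr_ge0 ?sqrtr_ge0//.
rewrite sqrrD !sqr_sqrtr//; last first.
  rewrite -sumrMnl -!big_split; apply: sumr_ge0 => i _ /=.
  by rewrite -sqrrD sqr_ge0.
rewrite lerD2r lerD2l lerMn2r /= -sqrtrM// (le_trans (ler_norm _))//.
by rewrite -sqrtr_sqr ler_wsqrtr// euclidean_cauchy_schwarz.
Qed.

HB.instance Definition _ := @isMetric.Build R (euclidean R n) euclidean_dist
  euclidean_distxx euclidean_dist_positivity euclidean_dist_sym
  euclidean_dist_triangle.

End euclidean_metric.

(* [diam set0 = -oo]; diameters are only ever bounded from above below. *)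
Definition diam (R : realType) (X : metricType R) (A : set X) : \bar R :=
  ereal_sup [set (mdist p.1 p.2)%:E | p in A `*` A].

Definition locally_connected (T : topologicalType) : Prop :=
  forall (x : T) (U : set T), nbhs x U ->
    exists V : set T, [/\ open V, V x, connected V & V `<=` U].

(* [f] is a homeomorphism from [0, 1] onto [J], with inverse [g]. *)
Definition jordan_arc (R : realType) (T : topologicalType) (J : set T)
    (x y : T) : Prop :=
  exists (f : R -> T) (g : T -> R),
    [/\ {within `[0, 1], continuous f} /\ {within J, continuous g},
        f @` `[0, 1] = J,
        (forall t : R, 0 <= t <= 1 -> g (f t) = t),
        f 0 = x
      & f 1 = y].

Definition is_tree (R : realType) (T : metricType R) : Prop :=
  [/\ compact [set: T],
      connected [set: T],
      locally_connected T
    & forall x y : T, x != y -> exists! J : set T, jordan_arc R J x y].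

Definition bounded_turning (R : realType) (C : R) (T : metricType R) : Prop :=
  forall u v : T, exists E : set T,
    [/\ E u, E v, compact E, connected E & (diam E <= (C * mdist u v)%:E)%E].

Definition doubling (R : realType) (D : nat) (T : metricType R) : Prop :=
  forall (x : T) (r : R), 0 < r -> exists s : seq T,
    (size s <= D)%N /\ ball x r `<=` \bigcup_(c in [set` s]) ball c (r / 2).

Definition quasiconformal_tree (R : realType) (T : metricType R) : Prop :=
  [/\ is_tree T,
      exists2 C : R, 1 <= C & bounded_turning C T
    & exists D : nat, doubling D T].

Definition delta_chain (R : realType) (X : metricType R) (delta : R)
    (s : seq X) : Prop :=
  sorted (fun x y : X => mdist x y <= delta) s.

Definition delta_connected (R : realType) (X : metricType R) (delta : R)
    (U : set X) : Prop :=
  forall x y : X, U x -> U y -> exists s : seq X,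
    [/\ delta_chain delta s, [set` s] `<=` U, x \in s & y \in s].

Definition delta_component (R : realType) (X : metricType R) (delta : R)
    (A U : set X) : Prop :=
  [/\ U `<=` A, delta_connected delta U
    & forall V : set X, U `<=` V -> V `<=` A -> delta_connected delta V -> V = U].

Definition lipschitz_light (R : realType) (X Y : metricType R)
    (f : X -> Y) : Prop :=
  exists L Q : R,
    [/\ 0 < L, 0 < Q,
        forall x y : X, mdist (f x) (f y) <= L * mdist x y
      & forall (r : R) (E : set Y), 0 < r -> (diam E <= r%:E)%E ->
          forall U : set X, delta_component r (f @^-1` E) U ->
            (diam U <= (Q * r)%:E)%E].

Definition lipschitz_dim_le (R : realType) (X : metricType R) (n : nat) : Prop :=
  exists f : X -> euclidean R n, lipschitz_light f.

(* [n] ranges over all naturals, [n = 0] included; the value is [+oo] when no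
   [n] qualifies. *)
Definition lipschitz_dim (R : realType) (X : metricType R) : \bar R :=
  ereal_inf [set (n%:R)%:E | n in [set n : nat | lipschitz_dim_le X n]].

(* Main.v *)
(** A map to the line is Lipschitz light as soon as it oscillates, on every chain
    with small steps, by a fixed fraction of the distance of the end points.

    In a compact bounded turning tree, arcs have diameter at most a multiple of
    the distance of their end points: bounded turning gives a path of small
    diameter, which contains a Jordan arc (erase a maximal system of loops and
    reparametrize), and arcs are unique.  A light function is then read off along
    the arcs from a root: at each scale 80^-k a walk goes up and down with steps
    measured by the diameters of subarcs and tracks the walk of the next coarser
    scale, so that the scales do not cancel each other.

    For a union, let g be light on A and u light on B.  Fold u into a zigzag of
    amplitude comparable to the distance to A.  A large multiple of the folded
    function is light on B at scales below the distance to A and vanishes on A, so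
    adding it to g gives a function that is light on the union. *)

Require Import Defs.
From mathcomp Require Import all_boot all_order all_algebra.
From mathcomp Require Import all_classical all_reals all_analysis.
From mathcomp Require Import ring lra zify.

Set Implicit Arguments.
Unset Strict Implicit.
Unset Printing Implicit Defensive.

Import Order.TTheory GRing.Theory Num.Theory.
Import numFieldNormedType.Exports.

Local Open Scope classical_set_scope.
Local Open Scope ring_scope.

(** * Paths and Jordan arcs *)

(** The ratio 80 leaves room for the tracking errors. A walk of scale k stays within 10
    [walk_scale k] of the next coarser one, so all finer walks together shift it by at most 20
    [walk_scale k.+1], a quarter of [walk_scale k]. Between consecutive nodes it swings by at least
    [walk_scale k]; half of this survives in the finest walk after the errors at both ends. Steps
    are measured by diameters of subarcs because these are monotone along an arc and subadditive,
    while distances may shrink along an arc; bounded turning makes the two comparable. Unions are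
    treated in the ambient space: each function on a tree is first extended to all of X with the
    same Lipschitz constant, so that the functions can be added. Dimension 0 is excluded separately:
    a map to a point has the whole space as a fibre, and in a connected tree any two points are
    joined by chains of arbitrarily small step. *)

Lemma within_continuousP (R : realType) (S T : pseudoMetricType R) (A : set S)
    (f : S -> T) :
  {within A, continuous f} <->
  forall t, A t -> forall e, 0 < e -> exists2 d, 0 < d &
    forall s, A s -> ball t d s -> ball (f t) e (f s).
Proof.
rewrite subspace_continuousP; split=> H t At.
  move=> e e0; have := H t At (ball (f t) e) (nbhsx_ballx _ _ e0).
  rewrite /fmap /= nbhs_simpl /within/= => /nbhs_ballP[d d0 sub].
  by exists d => // s As bs; exact: sub.
apply/cvg_ballP => e e0; have [d d0 Hd] := H t At e e0.
rewrite near_withinE; apply/nbhs_ballP; exists d => //= s bs As; exact: Hd.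
Qed.

Lemma compact_quotient_continuous (S Y Z : topologicalType) (K : set S)
    (a : S -> Y) (b : S -> Z) (h : Y -> Z) :
  hausdorff_space Y -> compact K -> {within K, continuous a} ->
  {within K, continuous b} -> (forall s, K s -> h (a s) = b s) ->
  {within a @` K, continuous h}.
Proof.
move=> hY cK ca cb hab; apply/continuous_closedP => C clC.
apply/closed_subspaceP.
have /continuous_closedP/(_ _ clC)/closed_subspaceP[V clV VK] := cb.
exists (a @` (K `&` V)).
  apply: compact_closed => //; apply: continuous_compact.
    by apply: continuous_subspaceW ca => s [].
  exact: compact_closedI.
apply/seteqP; split=> y /=.
  move=> [[s [Ks Vs] <-] ay]; split=> //.
  have Cb : C (b s) by have : (V `&` K) s by []; rewrite VK => -[].
  by rewrite -hab in Cb.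
move=> [Chy [s Ks sy]]; split; last by exists s.
exists s => //; split=> //; have [] : (V `&` K) s => //.
rewrite VK; split=> //; suff : C (b s) by [].
by rewrite -hab// sy.
Qed.

(** The complement of [X] is closed, so it has a last point before [c]: the left end of the
    component of [X] around [c]. *)
Lemma open_left_end (R : realType) (X : set R) (a c : R) : open X -> a <= c ->
  ~ X a -> X c -> exists2 a1, a <= a1 < c & ~ X a1 /\ forall t, a1 < t <= c -> X t.
Proof.
move=> oX ac nXa Xc; pose S := [set t | t <= c /\ ~ X t].
have supS : has_sup S by split; [exists a|exists c => t []].
have Sle t : S t -> t <= sup S by exact: sup_upper_bound.
have sc : sup S <= c by apply: ge_sup; [exists a|move=> t []].
have nXs : ~ X (sup S).
  move=> Xs; have /nbhs_ballP[d/= d0 sub] : nbhs (sup S) X by exact: open_nbhs_nbhs.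
  have [t St lt] := sup_adherent d0 supS; case: (St) => _; apply; apply: sub.
  by rewrite /ball/= ger0_norm ?subr_ge0 ?Sle// ltrBlDr -ltrBlDl.
exists (sup S); last first.
  split=> // t /andP[st tc]; apply: contrapT => nXt.
  by have := Sle t (conj tc nXt); rewrite leNgt st.
rewrite Sle//= lt_neqAle sc andbT; apply/eqP => e; by rewrite e in nXs.
Qed.

Lemma open_right_end (R : realType) (X : set R) (b c : R) : open X -> c <= b ->
  ~ X b -> X c -> exists2 b1, c < b1 <= b & ~ X b1 /\ forall t, c <= t < b1 -> X t.
Proof.
move=> oX cb nXb Xc; have oN : open (-%R @^-1` X).
  apply: open_comp oX => t _; exact: opp_continuous.
have [|||a1 /andP[ba1 a1c] [nX tX]] := @open_left_end _ (-%R @^-1` X) (- b) (- c) oN.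
- by rewrite lerN2.
- by rewrite /preimage/= opprK.
- by rewrite /preimage/= opprK.
exists (- a1); first by rewrite ltrNr a1c lerNl.
split=> // t /andP[ct ta]; have := tX (- t); rewrite /preimage/= opprK; apply.
by rewrite ltrNr ta lerN2.
Qed.

(** If no member covered [K], the sets [K \ X] would form a proper filter base, because [F] is a
    chain, and its cluster point in [K] would lie in no member. *)
Lemma chain_cover_compact (T : topologicalType) (K : set T) (F : set (set T)) :
  compact K -> K !=set0 -> (forall X, F X -> open X) -> total_on F subset ->
  K `<=` \bigcup_(X in F) X -> exists2 X, F X & K `<=` X.
Proof.
move=> cK [k Kk] oF totF cov; apply: contrapT => nex.
have [X0 FX0 _] := cov _ Kk.
have ff : ProperFilter (filter_from F (fun X => K `\` X)).
  apply: filter_from_proper; last first.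
    move=> X FX; apply: contrapT => nn; apply: nex; exists X => // t Kt.
    by apply: contrapT => nXt; apply: nn; exists t.
  apply: filter_from_filter; first by exists X0.
  move=> X Y FX FY; have [XY|YX] := totF _ _ FX FY.
    by exists Y => // t [Kt nY]; split; split=> // /XY.
  by exists X => // t [Kt nX]; split; split=> // /YX.
have FK : filter_from F (fun X => K `\` X) K by exists X0 => // t [].
have [p [Kp clp]] := cK _ ff FK.
have [X FX Xp] := cov _ Kp.
have [|q [[_ nXq] Xq]] := clp (K `\` X) X _ (open_nbhs_nbhs (conj (oF _ FX) Xp)).
  by exists X.
by [].
Qed.

(** * Erasing the loops of a path *)

Section loop_erasure.
Variables (R : realType) (T : metricType R) (g : R -> T).
Hypothesis gc : {within `[0, 1], continuous g}.

(* [G] is the complement of the set of times that are kept; each maximal interval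
   of [G] is a loop of [g]. *)
Definition erasable (G : set R) := [/\ open G, G `<=` `]0, 1[%classic &
  forall a b, 0 <= a -> a < b -> b <= 1 -> ~ G a -> ~ G b ->
    (forall t, a < t < b -> G t) -> g a = g b].

(** The upper bounds for Zorn's lemma. A gap of the union need not be a gap of any member, but a
    compact interval inside it lies in one member, whose gap around it has ends as close to [a] and
    [b] as desired. The path agrees at those ends, and continuity gives [g a = g b]. *)
Lemma erasable_bigcup (F : set (set R)) : F `<=` erasable -> total_on F subset ->
  erasable (\bigcup_(X in F) X).
Proof.
move=> Fe totF; split.
- by apply: bigcup_open => X /Fe[].
- by move=> t [X /Fe[_ sub _]] /sub.
move=> a b a0 ab b1 na nb abG; apply: contrapT => gab.
have eta0 : 0 < mdist (g a) (g b) / 2.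
  by rewrite divr_gt0// mdist_gt0; apply/eqP.
set eta := mdist (g a) (g b) / 2 in eta0.
have ain : `[0, 1]%classic a by rewrite /= in_itv/= a0 (le_trans (ltW ab)).
have bin : `[0, 1]%classic b by rewrite /= in_itv/= b1 (le_trans a0 (ltW ab)).
have /within_continuousP gc' := gc.
have [da da0 Ha] := gc' _ ain _ eta0.
have [db db0 Hb] := gc' _ bin _ eta0.
(* The thirds keep [a' < b']; the minima keep [a'] and [b'] within the continuity radii of [a] and
   [b]. *)
pose a' := a + Num.min da (b - a) / 3; pose b' := b - Num.min db (b - a) / 3.
have ba0 : 0 < b - a by rewrite subr_gt0.
have ma : 0 < Num.min da (b - a) by rewrite lt_min da0.
have mb : 0 < Num.min db (b - a) by rewrite lt_min db0.
have ma1 : Num.min da (b - a) <= da by rewrite ge_min lexx.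
have ma2 : Num.min da (b - a) <= b - a by rewrite ge_min lexx orbT.
have mb1 : Num.min db (b - a) <= db by rewrite ge_min lexx.
have mb2 : Num.min db (b - a) <= b - a by rewrite ge_min lexx orbT.
have ab' : a' < b' by rewrite /a' /b'; lra.
have [|||X FX sub] := @chain_cover_compact _ `[a',
  b']%classic F (@segment_compact _ _ _) _ _ totF.
- by exists a'; rewrite /= in_itv/= lexx ltW.
- by move=> X /Fe[].
- move=> t; rewrite /= in_itv/= => /andP[at' tb']; apply: abG.
  by move: at' tb'; rewrite /a' /b'; lra.
have [oX _ Xgap] := Fe _ FX.
have Xa' : X a' by apply: sub; rewrite /= in_itv/= lexx ltW.
have Xb' : X b' by apply: sub; rewrite /= in_itv/= lexx ltW.
have nXa : ~ X a by move=> Xa; apply: na; exists X.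
have nXb : ~ X b by move=> Xb; apply: nb; exists X.
have [|a1 /andP[aa1 a1a'] [nXa1 Xa1]] := open_left_end oX _ nXa Xa'.
  by rewrite /a'; lra.
have [|b1' /andP[b'b1 b1b] [nXb1 Xb1]] := open_right_end oX _ nXb Xb'.
  by rewrite /b'; lra.
have e : g a1 = g b1'.
  apply: Xgap => //; try lra.
  move=> t /andP[a1t tb1]; have [ta'|a't] := leP t a'.
    by apply: Xa1; rewrite a1t.
  have [tb'|b't] := leP t b'; last by apply: Xb1; rewrite ltW.
  by apply: sub; rewrite /= in_itv/= tb' ltW.
have : ball (g a) eta (g a1).
  apply: Ha; first by rewrite /= in_itv/=; apply/andP; split; lra.
  rewrite /ball/= ltr_norml; move: a1a'; rewrite /a'; lra.
have : ball (g b) eta (g b1').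
  apply: Hb; first by rewrite /= in_itv/=; apply/andP; split; lra.
  rewrite /ball/= ltr_norml; move: b'b1; rewrite /b'; lra.
rewrite !ballEmdist/= -e => h1 h2.
have := metric_triangle (g a) (g a1) (g b); rewrite [mdist (g a1) _]metric_sym.
move: h1 h2; rewrite /eta; lra.
Qed.

(** [K] is the complement of a maximal erasable set. If two kept times with the same image had a
    kept time between them, the whole interval between them could still be erased. *)
Lemma loop_erasure : g 0 != g 1 -> exists K : set R, [/\ compact K, K `<=` `[0,
  1]%classic,
  K 0, K 1 & (forall s t, K s -> K t -> s < t ->
     (g s = g t <-> forall r, s < r < t -> ~ K r))].
Proof.
move=> g01.
have [G [Ge Gmax]] := Zorn_bigcup erasable_bigcup.
have [oG G01 Ggap] := Ge.
have nG0 : ~ G 0 by move=> /G01; rewrite /= in_itv/= ltxx.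
have nG1 : ~ G 1 by move=> /G01; rewrite /= in_itv/= ltxx andbF.
exists (`[0, 1]%classic `&` ~` G); split.
- apply: compact_closedI; first exact: segment_compact.
  exact: open_closedC.
- by move=> t [].
- by split=> //; rewrite /= in_itv/= lexx ler01.
- by split=> //; rewrite /= in_itv/= lexx ler01.
move=> s t [/= + nGs] [/= + nGt] st; rewrite !in_itv/= => /andP[s0 s1] /andP[t0 t1].
split; last first.
  move=> H; apply: Ggap => // r /andP[sr rt]; apply: contrapT => nGr.
  apply: (H r); first by rewrite sr.
  by split=> //=; rewrite in_itv/=; apply/andP; split; lra.
move=> gst r /andP[sr rt] [_]; apply.
pose G' := G `|` `]s, t[%classic.
suff e : G' = G by rewrite -e; right; rewrite /= in_itv/= sr.
apply/seteqP; split; last by move=> x; left.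
apply: contrapT => nsub; apply: (Gmax G').
  by split=> //; move=> x; left.
split.
- by apply: openU => //; exact: interval_open.
- move=> x [/G01//|]; rewrite /= !in_itv/= => /andP[sx xt]; apply/andP; split; lra.
move=> a b a0 ab b1 nGa nGb H.
have nGa' : ~ G a by move=> ?; apply: nGa; left.
have nGb' : ~ G b by move=> ?; apply: nGb; left.
have nas : a <= s \/ t <= a.
  have [?|sa] := leP a s; first by left.
  have [?|at'] := leP t a; first by right.
  by exfalso; apply: nGa; right; rewrite /= in_itv/= sa.
have nbs : b <= s \/ t <= b.
  have [?|sb] := leP b s; first by left.
  have [?|bt'] := leP t b; first by right.
  by exfalso; apply: nGb; right; rewrite /= in_itv/= sb.
(* A gap of [G'] either misses []s, t[] and is then a gap of [G], or contains it; since [s] and [t]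
   are not in [G'], it then equals it. *)
have [out|[as_ tb]] : (b <= s \/ t <= a) \/ (a <= s /\ t <= b) by tauto.
  apply: Ggap => // x axb; case: (H x axb) => //; rewrite /= in_itv/=.
  by case/andP: axb; case: out; lra.
have ea : a = s.
  apply/eqP; rewrite eq_le as_ leNgt; apply/negP => as'.
  have /H[//|] : a < s < b by rewrite as' (lt_le_trans st).
  by rewrite /= in_itv/= ltxx.
have eb : b = t.
  apply/eqP; rewrite eq_le tb andbT leNgt; apply/negP => tb'.
  have /H[//|] : a < t < b by rewrite tb' (le_lt_trans as_).
  by rewrite /= in_itv/= ltxx andbF.
by rewrite ea eb.
Qed.
End loop_erasure.

Section weighted_sum.
Variable R : realType.
Implicit Types a b : nat -> R.

(** For nonnegative terms this is the sum of the series; as a supremum it can be compared without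
    convergence arguments. *)
Definition wsum a : R := sup [set \sum_(n < N) a n / 2 ^+ n.+1 | N in [set: nat]].

Let geo N : \sum_(n < N) (2 ^+ n.+1)^-1 = 1 - (2 ^+ N)^-1 :> R.
Proof.
elim: N => [|N IH]; first by rewrite big_ord0 expr0 invr1 subrr.
rewrite big_ord_recr /= IH exprS.
have : (2 : R) ^+ N != 0 by rewrite expf_neq0// pnatr_eq0.
by move=> ?; field.
Qed.

Let geo1 N (e : R) : 0 <= e -> \sum_(n < N) e / 2 ^+ n.+1 <= e.
Proof.
move=> e0; rewrite -mulr_sumr geo ler_piMr// lerBlDr lerDl invr_ge0 exprn_ge0//.
Qed.

Let has_sup_wsum a : (forall n, a n <= 1) ->
  has_sup [set \sum_(n < N) a n / 2 ^+ n.+1 | N in [set: nat]].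
Proof.
move=> a1; split; first by exists (\sum_(n < 0) a n / 2 ^+ n.+1), 0%N.
exists 1 => _ [N _ <-]; rewrite (le_trans _ (@geo1 N 1 ler01))//.
by apply: ler_sum => n _; rewrite ler_pM2r ?invr_gt0 ?exprn_gt0.
Qed.

Lemma wsum_le a b e : (forall n, b n <= 1) -> 0 <= e ->
  (forall n, a n <= b n + e) -> wsum a <= wsum b + e.
Proof.
move=> b1 e0 abe; apply: ge_sup.
  by exists (\sum_(n < 0) a n / 2 ^+ n.+1), 0%N.
move=> _ [N _ <-].
apply: (@le_trans _ _ (\sum_(n < N) b n / 2 ^+ n.+1 + \sum_(n < N) e / 2 ^+ n.+1)).
  rewrite -big_split/=; apply: ler_sum => n _; rewrite -mulrDl.
  by rewrite ler_pM2r ?invr_gt0 ?exprn_gt0.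
rewrite lerD ?geo1//; apply: sup_upper_bound; first exact: has_sup_wsum.
by exists N.
Qed.

Lemma wsum_lt a b m : (forall n, 0 <= a n) -> (forall n, b n <= 1) ->
  (forall n, a n <= b n) -> a m < b m -> wsum a < wsum b.
Proof.
move=> a0 b1 ab abm; pose e := (b m - a m) / 2 ^+ m.+1.
have e0 : 0 < e by rewrite divr_gt0 ?subr_gt0 ?exprn_gt0.
suff : wsum a + e <= wsum b by move=> H; rewrite (lt_le_trans _ H)// ltrDl.
rewrite -lerBrDr; apply: ge_sup.
  by exists (\sum_(n < 0) a n / 2 ^+ n.+1), 0%N.
move=> _ [N _ <-]; rewrite lerBrDr.
(* With at least [m.+1] terms the partial sum contains the index [m], where the strict gain [e]
   occurs. *)
pose N' := maxn N m.+1.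
have le1 : \sum_(n < N') b n / 2 ^+ n.+1 <= wsum b.
  by apply: sup_upper_bound; [exact: has_sup_wsum|exists N'].
apply: le_trans le1.
have mN : (m < N')%N by rewrite /N' leq_max leqnn orbT.
have NN : (N <= N')%N by rewrite /N' leq_max leqnn.
have leN : \sum_(n < N) a n / 2 ^+ n.+1 <= \sum_(n < N') a n / 2 ^+ n.+1.
  rewrite (big_ord_widen N' (fun n => a n / 2 ^+ n.+1) NN) big_mkcond/=.
  by apply: ler_sum => n _; case: ifP => // _; rewrite divr_ge0// exprn_ge0.
rewrite -lerBrDl -/e; apply: le_trans (_ : e <= _) _ => //.
apply: (@le_trans _ _ (\sum_(n < N') (b n - a n) / 2 ^+ n.+1)); last first.
  by rewrite lerBrDl (le_trans (lerD leN (lexx _)))// -big_split/= ler_sum// => n _;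
     rewrite -mulrDl addrC subrK.
rewrite (bigD1 (Ordinal mN))//= lerDl sumr_ge0// => n _.
by rewrite divr_ge0 ?exprn_ge0// subr_ge0.
Qed.
End weighted_sum.

(** * From a loop-free path to a Jordan arc *)

Section arc_of_loopfree.
Variables (R : realType) (T : metricType R) (g : R -> T) (K : set R).
Hypothesis gc : {within `[0, 1], continuous g}.
Hypothesis cK : compact K.
Hypothesis K01 : K `<=` `[0, 1]%classic.
Hypothesis K0 : K 0.
Hypothesis K1 : K 1.
Hypothesis g01 : g 0 != g 1.
Hypothesis loopfree : forall s t, K s -> K t -> s < t ->
  (g s = g t <-> forall r, s < r < t -> ~ K r).

(* [h n] is a bump at the [n]-th rational point of the path; the weighted sum of
   its running maxima is constant exactly on the stretches where [g] is. *)
Let q (n : nat) : R := if @unpickle rat n is Some x then ratr x else 0.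
Let h (n : nat) (x : T) : R := Num.max 0 (1 - mdist x (g (q n))).

Let h_ge0 n x : 0 <= h n x. Proof. by rewrite /h le_max lexx. Qed.
Let h_le1 n x : h n x <= 1.
Proof. by rewrite /h ge_max ler01 lerBlDr lerDl mdist_ge0. Qed.
Let h_lip n x y : h n x <= h n y + mdist x y.
Proof.
have := metric_triangle y x (g (q n)); rewrite [mdist y x]metric_sym.
have := mdist_ge0 x y; have := h_ge0 n y.
have : 1 - mdist y (g (q n)) <= h n y by rewrite /h le_max lexx orbT.
move=> *; rewrite [X in X <= _]/h ge_max; apply/andP; split; lra.
Qed.

Let A (t : R) (n : nat) : R := sup [set h n (g s) | s in K `&` [set s | s <= t]].

Let Aset t n : 0 <= t -> has_sup [set h n (g s) | s in K `&` [set s | s <= t]].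
Proof.
by move=> t0; split; [exists (h n (g 0)), 0|exists 1 => _ [s _ <-]].
Qed.

Let A_ub t n s : K s -> s <= t -> h n (g s) <= A t n.
Proof.
move=> Ks st; apply: sup_upper_bound; last by exists s.
by apply: Aset; have := K01 Ks; rewrite /= in_itv/= => /andP[? _]; exact: le_trans st.
Qed.

Let A_le t n x : 0 <= t -> (forall s, K s -> s <= t -> h n (g s) <= x) -> A t n <= x.
Proof.
move=> t0 H; apply: ge_sup; first by exists (h n (g 0)), 0.
by move=> _ [s [Ks st] <-]; exact: H.
Qed.

Let K_ge0 s : K s -> 0 <= s.
Proof. by move/K01; rewrite /= in_itv/= => /andP[]. Qed.
Let K_le1 s : K s -> s <= 1.
Proof. by move/K01; rewrite /= in_itv/= => /andP[]. Qed.

Let A_ge0 t n : 0 <= t -> 0 <= A t n.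
Proof. by move=> t0; rewrite (le_trans (h_ge0 n (g 0)))// A_ub. Qed.
Let A_le1 t n : 0 <= t -> A t n <= 1.
Proof. by move=> t0; apply: A_le. Qed.

Let A_mono s t n : 0 <= s -> s <= t -> A s n <= A t n.
Proof.
move=> s0 st; apply: A_le => // r Kr rs; apply: A_ub => //; exact: le_trans st.
Qed.

Let A_osc s t n e : K s -> s <= t ->
  (forall r, K r -> s <= r <= t -> mdist (g r) (g s) <= e) -> A t n <= A s n + e.
Proof.
move=> Ks st H; have e0 : 0 <= e by rewrite (le_trans (mdist_ge0 (g s) (g s)))// H// lexx.
have s0 := K_ge0 Ks.
apply: A_le => [|r Kr rt]; first exact: le_trans st.
have [rs|sr] := leP r s.
  by rewrite (le_trans (A_ub n Kr rs))// lerDl.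
rewrite (le_trans (h_lip n (g r) (g s)))// lerD ?A_ub// H// rt ltW//.
Qed.

(** By loop-freeness [g t] lies outside the compact set of points visited by time [s], at some
    distance at least [m] from it. A bump centred at a path point much closer than [m] to [g t] is
    larger at time [t] than at every kept time up to [s]. *)
Let A_lt s t : K s -> K t -> s < t -> g s != g t -> exists n, A s n < A t n.
Proof.
move=> Ks Kt st gst.
have cKs : compact (g @` (K `&` [set r | r <= s])).
  apply: continuous_compact.
    by apply: continuous_subspaceW gc => r [/K01].
  by apply: compact_closedI => //; exact: closed_le.
have clKs : closed (g @` (K `&` [set r | r <= s])).
  by apply: compact_closed cKs; exact: metric_hausdorff.
have nKt : ~ (g @` (K `&` [set r | r <= s])) (g t).
  move=> [r [Kr rs] e]; have rt : r < t by exact: le_lt_trans st.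
  have /(loopfree Kr Kt rt) H := e.
  move: rs; rewrite /= le_eqVlt => /predU1P[rs|rs].
    by move: gst; rewrite -rs e eqxx.
  by apply: (H s); rewrite ?rs.
have : nbhs (g t) (~` (g @` (K `&` [set r | r <= s]))).
  by apply: open_nbhs_nbhs; split=> //; exact: closed_openC.
move=> /nbhs_ballP[eta/= eta0 sub].
(* The cap at 1 keeps [1 - m] nonnegative, so that the upper bound survives the maximum with 0 in
   [h]. *)
pose m := Num.min eta 1.
have m0 : 0 < m by rewrite lt_min eta0 ltr01.
have m1 : m <= 1 by rewrite ge_min lexx orbT.
have far r : K r -> r <= s -> m <= mdist (g t) (g r).
  move=> Kr rs; rewrite leNgt; apply/negP => lt; apply: (sub (g r)); last by exists r.
  by rewrite ballEmdist/= (lt_le_trans lt)// ge_min lexx.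
have t01 : `[0, 1]%classic t := K01 Kt.
have /within_continuousP/(_ t t01 (m / 2)) := gc.
case; first by rewrite divr_gt0.
move=> d d0 Hd.
have t0 : 0 < t by exact: le_lt_trans (K_ge0 Ks) st.
have [x xin] : exists x : rat, ratr x \in `]Num.max 0 (t - d), t[.
  by apply: rat_in_itvoo; rewrite gt_max t0 ltrBlDr ltrDl.
move: xin; rewrite in_itv/= gt_max -andbA => /and3P[x0 xd xt].
have := Hd (ratr x); rewrite /= in_itv/= (ltW x0)/=.
rewrite (ltW (lt_le_trans xt _)) ?K_le1// => /(_ isT).
have btx : ball t d (ratr x).
  by rewrite /ball/= gtr0_norm ?subr_gt0// ltrBlDr -ltrBlDl.
move=> /(_ btx); rewrite ballEmdist/= => dx.
exists (pickle x).
have qx : q (pickle x) = ratr x by rewrite /q pickleK.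
have lt : 1 - mdist (g t) (g (ratr x)) <= A t (pickle x).
  by rewrite (le_trans _ (A_ub _ Kt (lexx t)))// /h qx le_max lexx orbT.
apply: lt_le_trans lt.
apply: (@le_lt_trans _ _ (1 - m + mdist (g t) (g (ratr x)))); last by lra.
apply: A_le; first exact: K_ge0.
move=> r Kr rs; rewrite /h qx ge_max.
have := far r Kr rs; have := metric_triangle (g t) (g (ratr x)) (g r).
rewrite [mdist (g (ratr x)) (g r)]metric_sym.
have := mdist_ge0 (g t) (g (ratr x)) => *; apply/andP; split; lra.
Qed.

Let Phi t := wsum (A t).

Let Phi_mono s t : 0 <= s -> s <= t -> Phi s <= Phi t.
Proof.
move=> s0 st; have := @wsum_le _ (A s) (A t) 0; rewrite addr0; apply=> //.
  by move=> n; apply: A_le1; exact: le_trans st.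
by move=> n; rewrite addr0 A_mono.
Qed.

Let Phi_osc s t e : K s -> s <= t -> 0 <= e ->
  (forall r, K r -> s <= r <= t -> mdist (g r) (g s) <= e) -> Phi t <= Phi s + e.
Proof.
move=> Ks st e0 H; apply: wsum_le => // n; first by apply: A_le1; exact: K_ge0.
exact: A_osc.
Qed.

Let Phi_lt s t : K s -> K t -> s < t -> g s != g t -> Phi s < Phi t.
Proof.
move=> Ks Kt st gst; have [n Hn] := A_lt Ks Kt st gst.
apply: (@wsum_lt _ (A s) (A t) n) => // m.
- exact: A_ge0 (K_ge0 Ks).
- exact: A_le1 (K_ge0 Kt).
- by apply: A_mono; [exact: K_ge0|exact: ltW].
Qed.

Let Phi_eq0 s t : K s -> K t -> s < t -> g s = g t -> Phi s = Phi t.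
Proof.
move=> Ks Kt st gst; apply/eqP; rewrite eq_le Phi_mono ?K_ge0 ?(ltW st)//=.
have /(loopfree Ks Kt st) nK := gst.
have := @Phi_osc s t 0 Ks (ltW st) (lexx 0); rewrite addr0; apply=> r Kr /andP[].
rewrite le_eqVlt => /predU1P[<-|sr]; first by rewrite mdistxx.
rewrite le_eqVlt => /predU1P[->|rt]; first by rewrite gst mdistxx.
by exfalso; apply: (nK r) => //; rewrite sr.
Qed.

Let Phi_eqP s t : K s -> K t -> (Phi s = Phi t <-> g s = g t).
Proof.
move=> Ks Kt; have [st|ts|->//] := ltgtP s t.
  split; last exact: Phi_eq0.
  by move=> e; apply/eqP; apply: contrapT => /negP /(Phi_lt Ks Kt st); rewrite e ltxx.
split; last by move=> e; symmetry; apply: Phi_eq0.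
move=> e; apply/eqP; rewrite eq_sym; apply: contrapT => /negP /(Phi_lt Kt Ks ts).
by rewrite e ltxx.
Qed.

(** Bumps are 1-Lipschitz and the weights sum to at most 1, so between kept times [Phi] grows by at
    most the oscillation of [g]. *)
Let Phi_cont : {within K, continuous Phi}.
Proof.
apply/within_continuousP => t Kt e e0.
have t01 : `[0, 1]%classic t := K01 Kt.
have e4 : 0 < e / 4 by rewrite divr_gt0.
have /within_continuousP/(_ t t01 (e / 4) e4)[d d0 Hd] := gc.
have near r : K r -> `|t - r| < d -> mdist (g t) (g r) < e / 4.
  by move=> Kr dr; have := Hd r (K01 Kr) dr; rewrite ballEmdist.
exists d => // s Ks; rewrite /ball/= => ds.
have [st|ts] := leP s t.
  have := Phi_mono (K_ge0 Ks) st; rewrite -subr_ge0 => p.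
  rewrite ger0_norm//; apply: (@le_lt_trans _ _ (e / 2)); last by lra.
  rewrite lerBlDl; apply: Phi_osc => //; first by rewrite divr_ge0// ltW.
  move=> r Kr /andP[sr rt]; have := metric_triangle (g r) (g t) (g s).
  rewrite [mdist (g r) (g t)]metric_sym.
  have := near s Ks ds; have := near r Kr; move: ds; rewrite !ger0_norm ?subr_ge0//.
  move=> h1 h2; have := h2 _; lra.
have := Phi_mono (K_ge0 Kt) (ltW ts); rewrite -subr_ge0 => p.
rewrite distrC ger0_norm//; apply: (@le_lt_trans _ _ (e / 4)); last by lra.
rewrite lerBlDl; apply: Phi_osc => //; rewrite ?(ltW e4) ?(ltW ts)//.
move=> r Kr /andP[tr rs]; rewrite metric_sym ltW// near// distrC ger0_norm ?subr_ge0//.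
by move: ds; rewrite distrC ger0_norm ?subr_ge0 ?(ltW ts)//; lra.
Qed.

(** An intermediate value theorem although [K] may be disconnected: the path has the same value at
    both ends of a gap of [K], so [Phi] does not jump there. *)
Let Phi_surj x : Phi 0 <= x <= Phi 1 -> exists2 s, K s & Phi s = x.
Proof.
move=> /andP[x0 x1].
pose S := K `&` [set s | Phi s <= x].
have supS : has_sup S by split; [exists 0|exists 1 => s [/K_le1]].
have clK : closed K by apply: compact_closed cK; exact: Rhausdorff.
have Ks : K (sup S).
  apply: clK.
  by apply: (@closureS _ S K _) => [s []//|]; case: supS; exact: closure_sup.
have Kball e : 0 < e -> exists2 s, S s & sup S - e < s <= sup S.
  move=> e0; have [s Ss lt] := sup_adherent e0 supS; exists s => //.
  by rewrite lt sup_upper_bound.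
have le : Phi (sup S) <= x.
  rewrite leNgt; apply/negP => lt.
  have e0 : 0 < Phi (sup S) - x by rewrite subr_gt0.
  have /within_continuousP/(_ _ Ks _ e0)[d d0 Hd] := Phi_cont.
  have [s [Ks' /= Ps] /andP[ds ss]] := Kball d d0.
  have bs : ball (sup S) d s.
    by rewrite /ball/= ger0_norm ?subr_ge0// ltrBlDr -ltrBlDl.
  have := Hd s Ks' bs; rewrite /ball/= ltr_norml => /andP[_].
  move: Ps; lra.
exists (sup S) => //; apply/eqP; rewrite eq_le le/= leNgt; apply/negP => lt.
have s1 : sup S < 1.
  rewrite lt_neqAle K_le1// andbT; apply/eqP => e; move: lt; rewrite e ltNge.
  by rewrite x1.
(* [inf S'] is either [sup S] itself or the far end of the gap that starts at [sup S]. *)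
pose S' := K `&` [set s | sup S < s].
have infS : has_inf S' by split; [exists 1|exists 0 => s [/K_ge0]].
have Ki : K (inf S').
  apply: clK.
  move=> B /nbhs_ballP[d/= d0 sub].
  have [s [Ks' ss] lts] := inf_adherent d0 infS; exists s; split=> //; apply: sub.
  have is' : inf S' <= s by apply: ge_inf => //; case: infS.
  by rewrite /ball/= distrC ger0_norm ?subr_ge0// ltrBlDr addrC.
have gtS s : K s -> sup S < s -> x < Phi s.
  move=> Ks' ss; rewrite ltNge; apply/negP => Ps.
  by move: ss; rewrite ltNge sup_upper_bound.
have le_inf : sup S <= inf S'.
  by apply: lb_le_inf; [exists 1|move=> s [_ /ltW]].
have : x <= Phi (inf S').
  rewrite leNgt; apply/negP => lt'.
  have e0 : 0 < x - Phi (inf S') by rewrite subr_gt0.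
  have /within_continuousP/(_ _ Ki _ e0)[d d0 Hd] := Phi_cont.
  have [s [Ks' ss] lts] := inf_adherent d0 infS.
  have is' : inf S' <= s by apply: ge_inf => //; case: infS.
  have bs : ball (inf S') d s.
    by rewrite /ball/= distrC ger0_norm ?subr_ge0// ltrBlDr addrC.
  have := Hd s Ks' bs; rewrite /ball/= ltr_norml => /andP[+ _].
  have := gtS s Ks' ss; lra.
move: le_inf; rewrite le_eqVlt => /predU1P[<-|lti]; first by move=> xle; move: lt;
  rewrite ltNge xle.
have -> : Phi (inf S') = Phi (sup S).
  symmetry; apply: Phi_eq0 => //; apply/(loopfree Ks Ki lti) => r /andP[r1 r2] Kr.
  by move: r2; rewrite ltNge; apply/negP/negPn; apply: ge_inf => //; case: infS.
by move=> xle; move: lt; rewrite ltNge xle.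
Qed.

(** On [K] the maps [Psi] and [g] have the same fibres, so each factors through the other, and
    compactness of [K] makes both factors continuous. *)
Lemma loopfree_arc : jordan_arc R (g @` K) (g 0) (g 1).
Proof.
have lt01 : Phi 0 < Phi 1 by exact: Phi_lt.
pose c := Phi 1 - Phi 0; have c0 : 0 < c by rewrite subr_gt0.
pose Psi t := (Phi t - Phi 0) / c.
have Psi_eqP s t : K s -> K t -> (Psi s = Psi t <-> g s = g t).
  move=> Ks Kt; rewrite -Phi_eqP//; split; last by rewrite /Psi => ->.
  by move=> /(mulIf _)/addIr; apply; rewrite invr_neq0// gt_eqF.
have Psi_cont : {within K, continuous Psi}.
  move=> t; apply: cvgM; last exact: cvg_cst.
  by apply: cvgB; [exact: Phi_cont|exact: cvg_cst].
have PsiK : Psi @` K = `[0, 1]%classic.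
  apply/seteqP; split=> x.
    move=> [s Ks <-]; rewrite /= in_itv/= /Psi.
    rewrite divr_ge0 ?subr_ge0 ?Phi_mono ?K_ge0 ?(ltW c0)//=.
    by rewrite ler_pdivrMr// mul1r lerB// Phi_mono ?K_le1 ?K_ge0.
  rewrite /= in_itv/= => /andP[x0 x1].
  have [|s Ks Ps] := @Phi_surj (Phi 0 + x * c).
    by rewrite lerDl mulr_ge0 ?(ltW c0)//= -lerBrDl -/c ler_piMl// ltW.
  by exists s => //; rewrite /Psi Ps addrAC subrr add0r mulfK// gt_eqF.
pose f x := g (xget 0 [set s | K s /\ Psi s = x]).
pose k y := Psi (xget 0 [set s | K s /\ g s = y]).
have fE s : K s -> f (Psi s) = g s.
  move=> Ks; rewrite /f; case: xgetP => [r _ [Kr]|/(_ s)/not_andP[]//].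
  by move/Psi_eqP; apply.
have kE s : K s -> k (g s) = Psi s.
  move=> Ks; rewrite /k; case: xgetP => [r _ [Kr]|/(_ s)/not_andP[]//].
  by move/Psi_eqP; apply.
have gcK : {within K, continuous g} by exact: continuous_subspaceW gc.
have Psi0 : Psi 0 = 0 by rewrite /Psi subrr mul0r.
have Psi1 : Psi 1 = 1 by rewrite /Psi divff// gt_eqF.
exists f, k; split.
- split; last first.
    by apply: (compact_quotient_continuous _ cK gcK Psi_cont kE); exact: metric_hausdorff.
  rewrite -PsiK.
  by apply: (compact_quotient_continuous _ cK Psi_cont gcK fE); exact: Rhausdorff.
- apply/seteqP; split=> y.
    by move=> [x]; rewrite -PsiK => -[s Ks <-] <-; exists s; rewrite ?fE.
  by move=> [s Ks <-]; exists (Psi s); rewrite ?fE// -PsiK; exists s.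
- move=> x x01; have : `[0, 1]%classic x by rewrite /= in_itv.
  by rewrite -PsiK => -[s Ks <-]; rewrite fE ?kE.
- by rewrite -[X in f X]Psi0 fE.
- by rewrite -[X in f X]Psi1 fE.
Qed.

End arc_of_loopfree.

Lemma path_contains_arc (R : realType) (T : metricType R) (g : R -> T) :
  {within `[0, 1], continuous g} -> g 0 != g 1 ->
  exists2 J, J `<=` g @` `[0, 1] & jordan_arc R J (g 0) (g 1).
Proof.
move=> gc g01; have [K [cK K01 K0 K1 lf]] := loop_erasure gc g01.
exists (g @` K); first exact: image_subset.
exact: loopfree_arc.
Qed.

(** * Paths in bounded turning spaces *)

Lemma mdist_le_diam (R : realType) (T : metricType R) (E : set T) (r : R) x y :
  (diam E <= r%:E)%E -> E x -> E y -> mdist x y <= r.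
Proof.
move=> Er Ex Ey; rewrite -lee_fin; apply: le_trans Er.
by apply: ereal_sup_ubound; exists (x, y).
Qed.

Lemma mball_open (R : realType) (T : metricType R) (x : T) (e : R) : open (ball x e).
Proof.
rewrite openE => y; rewrite ballEmdist/= => xy; apply/nbhs_ballP.
exists (e - mdist x y); first by rewrite /= subr_gt0.
move=> z; rewrite !ballEmdist/= => yz.
by rewrite (le_lt_trans (metric_triangle x y z))// -ltrBrDl.
Qed.

Lemma compact_net (R : realType) (T : metricType R) (e : R) :
  compact [set: T] -> 0 < e ->
  exists s : seq T, forall x, exists2 c, c \in s & mdist c x < e.
Proof.
move=> cT e0; apply: contrapT => nex.
pose U (s : seq T) := [set x | forall c, c \in s -> e <= mdist c x].
have ff : ProperFilter (filter_from [set: seq T] U).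
  apply: filter_from_proper; last first.
    move=> s _; apply: contrapT => ns; apply: nex; exists s => x.
    apply: contrapT => nx; apply: ns; exists x => c cs; rewrite leNgt; apply/negP => lt.
    by apply: nx; exists c.
  apply: filter_from_filter; first by exists [::].
  move=> s t _ _; exists (s ++ t) => // x Ux.
  by split=> c cs; apply: Ux; rewrite mem_cat cs ?orbT.
have [|p [_ clp]] := cT _ ff; first by exists [::].
have [||q [Uq pq]] := clp (U [:: p]) (ball p e).
- by exists [:: p].
- exact: nbhsx_ballx.
by have := Uq p (mem_head _ _); move: pq; rewrite ballEmdist/= leNgt => ->.
Qed.

Lemma compact_seq_cluster (R : realType) (T : metricType R) (x : nat -> T) :
  compact [set: T] -> exists p, forall e, 0 < e -> forall n, exists2 m, (n <= m)%N &
    mdist p (x m) < e.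
Proof.
move=> cT; have [|p [_ clp]] := cT (x @ \oo) _; first exact: filterT.
exists p => e e0 n.
have [||q [[m nm <-] pq]] := clp (x @` [set m | (n <= m)%N]) (ball p e).
- by exists n => // m nm; exists m.
- exact: nbhsx_ballx.
by exists m => //; move: pq; rewrite ballEmdist.
Qed.

Section connected_chain.
Variables (R : realType) (T : metricType R) (E : set T) (s : seq T) (e : R).
Hypothesis cE : connected E.
Hypothesis net : forall x : T, exists2 c, c \in s & mdist c x < e.

Let B (i : 'I_(size s)) : set T := ball (tnth (in_tuple s) i) e.
Let adj (i j : 'I_(size s)) := `[< exists z, [/\ E z, B i z & B j z] >].

Let netB x : exists i, B i x.
Proof.
have [c cs cx] := net x; have ci : (index c s < size s)%N by rewrite index_mem.
exists (Ordinal ci); rewrite /B ballEmdist/= (tnth_nth c)/=.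
by rewrite nth_index.
Qed.

Let B_open i : open (B i).
Proof. exact: mball_open. Qed.

(** The part of [E] in balls reachable from [i0] is open and closed in [E], because two balls that
    share a point of [E] are adjacent. *)
Let reach i0 x : E x -> B i0 x -> forall y, E y ->
  exists2 j, connect adj i0 j & B j y.
Proof.
move=> Ex Bx y Ey.
pose A := [set z | E z /\ exists2 j, connect adj i0 j & B j z].
suff AE : A = E by move: Ey; rewrite -AE => -[].
apply: cE.
- by exists x; split=> //; exists i0.
- exists (\bigcup_(j in [set j | connect adj i0 j]) B j).
    by apply: bigcup_open => j _; exact: B_open.
  apply/seteqP; split=> z; first by move=> [Ez [j cj Bz]]; split=> //; exists j.
  by move=> [Ez [j cj Bz]]; split=> //; exists j.
exists (~` (\bigcup_(j in [set j | ~~ connect adj i0 j]) B j)).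
  by apply: open_closedC; apply: bigcup_open => j _; exact: B_open.
apply/seteqP; split=> z.
  move=> [Ez [j cj Bz]]; split=> // -[k /= /negP nk Bkz]; apply: nk.
  by apply: connect_trans cj (connect1 _); apply/asboolP; exists z.
move=> [Ez nz]; split=> //; have [j Bj] := netB z; exists j => //.
by apply: contrapT => /negP nj; apply: nz; exists j.
Qed.

Let chain_of_path (p : seq 'I_(size s)) i x y : path adj i p -> E x -> E y -> B i x ->
  B (last i p) y -> exists q : seq T, [/\ path (fun a b => mdist a b <= 2 * e) x q,
   last x q = y, {in q, forall z, E z} & size q = (size p).+1].
Proof.
have near j a b : B j a -> B j b -> mdist a b <= 2 * e.
  rewrite /B !ballEmdist/= => ja jb.
  have := metric_triangle a (tnth (in_tuple s) j) b;
    rewrite [mdist a (tnth _ _)]metric_sym.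
  lra.
elim: p i x => [|j p IH] i x /=.
  move=> _ Ex Ey Bx By; exists [:: y]; split=> //=; first by rewrite (near i).
  by move=> z; rewrite inE => /eqP ->.
move=> /andP[/asboolP[z [Ez iz jz]] pj] Ex Ey Bx By.
have [q [pq lq Eq sq]] := IH _ _ pj Ez Ey jz By.
exists (z :: q); split=> //=; [by rewrite pq (near i)| |by rewrite sq].
by move=> w; rewrite inE => /orP[/eqP ->|/Eq].
Qed.

(** A path of overlapping balls can be taken without repetition, which bounds the length by the size
    of the net, independently of [x], [y] and [E]. *)
Lemma connected_chain x y : E x -> E y ->
  exists q : seq T, [/\ path (fun a b => mdist a b <= 2 * e) x q,
   last x q = y, {in q, forall z, E z} & (size q <= size s)%N].
Proof.
move=> Ex Ey; have [i Bi] := netB x.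
have [j /connectP[p pp ->] Bj] := reach Ex Bi Ey.
case/shortenP: pp Bj => p' pp' up' _ Bj.
have [q [pq lq Eq sq]] := chain_of_path pp' Ex Ey Bi Bj.
exists q; split=> //; rewrite sq.
have := max_card (mem (i :: p')); rewrite card_ord => /(leq_trans _); apply.
by rewrite (card_uniqP up').
Qed.
End connected_chain.

(** The number [N] depends on [delta] alone, so that every link of a level is cut into equally many
    pieces; shorter chains are padded with [y]. The condition on [mdist x y] stands inside the
    existential so that a choice function exists on all pairs. *)
Lemma subdivision (R : realType) (T : metricType R) (C delta : R) :
  compact [set: T] -> bounded_turning C T -> 0 < delta ->
  exists N, forall x y : T, exists c : nat -> T, mdist x y <= delta ->
    [/\ c 0%N = x, c N.+1 = y, (forall i, (i <= N)%N ->
      mdist (c i) (c i.+1) <= delta / 2) &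
     forall i, mdist x (c i) <= C * mdist x y].
Proof.
move=> cT bt d0; have d4 : 0 < delta / 4 by rewrite divr_gt0.
have [s net] := compact_net cT d4.
exists (size s) => x y; have [E [Ex Ey cE kE dE]] := bt x y.
have [q [pq lq Eq sq]] := connected_chain kE net Ex Ey.
exists (fun i => nth y (x :: q) i) => xy; split=> //.
- by rewrite nth_default//= ltnS.
- move=> i _; have [iq|qi] := ltnP i (size q).
    have /pathP/(_ i iq) := pq => /(_ y)/=.
    by have -> : 2 * (delta / 4) = delta / 2 by lra.
  have [->|] := eqVneq i (size q).
    have := nth_last y (x :: q); rewrite /= lq => ->.
    by rewrite nth_default// mdistxx divr_ge0// ltW.
  by move=> ne; rewrite !nth_default//= ?mdistxx ?divr_ge0 ?(ltW d0)//=; lia.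
- move=> i; apply: (mdist_le_diam dE Ex).
  have [iq|qi] := ltnP i (size q).+1; last by rewrite nth_default.
  have : nth y (x :: q) i \in x :: q by rewrite mem_nth.
  by rewrite inE => /orP[/eqP ->|/Eq].
Qed.

Section path_of_bounded_turning.
Variables (R : realType) (T : metricType R) (C : R) (u v : T).
Hypothesis C0 : 0 <= C.
Hypothesis cT : compact [set: T].
Hypothesis uv : u != v.
Hypothesis bt : bounded_turning C T.

Let delta (n : nat) : R := mdist u v / 2 ^+ n.
Let delta_gt0 n : 0 < delta n.
Proof. by rewrite divr_gt0 ?mdist_gt0// exprn_gt0. Qed.
Let deltaS n : delta n = 2 * delta n.+1.
Proof.
have : (2 : R) ^+ n != 0 by rewrite expf_neq0// pnatr_eq0.
by move=> ?; rewrite /delta exprS; field.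
Qed.

Section refinements.
Variables (N : nat -> nat) (c : nat -> T -> T -> nat -> T).
Hypothesis cE : forall n x y, mdist x y <= delta n ->
  [/\ c n x y 0%N = x, c n x y (N n).+1 = y,
     (forall i, (i <= N n)%N -> mdist (c n x y i) (c n x y i.+1) <= delta n / 2) &
     forall i, mdist x (c n x y i) <= C * mdist x y].

(* Level [n.+1] splits each link of level [n] into [(N n).+1] links.  The chain goes
   from [u] to [v] over the first [\prod_(i < n) (N i).+1] links; what follows is
   irrelevant. *)
Fixpoint chain_pt (n k : nat) : T :=
  if n is n'.+1 then
    let d := (N n').+1 in
    c n' (chain_pt n' (k %/ d)) (chain_pt n' (k %/ d).+1) (k %% d)
  else if k == 0%N then u else v.

Lemma chain_pt_step n k : mdist (chain_pt n k) (chain_pt n k.+1) <= delta n.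
Proof.
elim: n k => [|n IH] k /=.
  case: k => [|k] /=; first by rewrite /delta expr0 divr1.
  by rewrite mdistxx ltW.
have dE : delta n.+1 = delta n / 2 by rewrite (deltaS n); lra.
have [_ cN cstep _] := cE (IH (k %/ (N n).+1)%N).
rewrite dE; have lt := ltn_pmod k (ltn0Sn (N n)).
(* In the last link of a block the next index opens the following block, whose first point is the
   end point [(N n).+1] of this one. *)
have [e|ne] := eqVneq (k %% (N n).+1)%N (N n).
  have -> : (k.+1 %/ (N n).+1)%N = (k %/ (N n).+1).+1.
    by rewrite {1}(divn_eq k (N n).+1) e -addnS -mulSnr mulnK//.
  have -> : (k.+1 %% (N n).+1)%N = 0%N.
    by rewrite {1}(divn_eq k (N n).+1) e -addnS -mulSnr modnMl.
  have [c0 _ _ _] := cE (IH (k %/ (N n).+1).+1%N).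
  by rewrite c0 -{2}cN e cstep.
have ltN : ((k %% (N n).+1).+1 < (N n).+1)%N by rewrite ltnS ltn_neqAle ne -ltnS.
have -> : (k.+1 %/ (N n).+1)%N = (k %/ (N n).+1)%N.
  by rewrite [X in (X.+1 %/ _)%N](divn_eq k (N n).+1) -addnS divnMDl// (divn_small ltN)
    addn0.
have -> : (k.+1 %% (N n).+1)%N = (k %% (N n).+1).+1.
  by rewrite [X in (X.+1 %% _)%N](divn_eq k (N n).+1) -addnS modnMDl (modn_small ltN).
by rewrite cstep// -ltnS.
Qed.

Lemma chain_pt_refine n k :
  mdist (chain_pt n (k %/ (N n).+1)) (chain_pt n.+1 k) <= C * delta n.
Proof.
have [_ _ _ /(_ (k %% (N n).+1)%N)] := cE (chain_pt_step n (k %/ (N n).+1)%N).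
by move=> /le_trans; apply; rewrite ler_wpM2l// chain_pt_step.
Qed.

Let W n := (\prod_(i < n) (N i).+1)%N.

Let W0 n : (0 < W n)%N.
Proof. by rewrite /W prodn_gt0. Qed.

Let chain_pt0 n : chain_pt n 0 = u.
Proof.
elim: n => [//|n IH] /=; rewrite div0n mod0n IH.
by have [] := cE (chain_pt_step n 0); rewrite IH.
Qed.

Let chain_pt1 n : chain_pt n (W n) = v.
Proof.
elim: n => [|n IH] /=; first by rewrite /W big_ord0.
rewrite /W big_ord_recr /= -/(W n) mulnK// modnMl IH.
by have [] := cE (chain_pt_step n (W n)); rewrite IH.
Qed.

Let K n (t : R) := Num.truncn ((W n)%:R * t).
Let gam n t := chain_pt n (K n t).

(** At a fixed time the link of level [n.+1] is one of the pieces of the link of level [n], which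
    reduces [gam_step] to [chain_pt_refine]. *)
Let K_div n t : 0 <= t -> (K n.+1 t %/ (N n).+1)%N = K n t.
Proof.
move=> t0; have WS : (W n.+1)%:R = (W n)%:R * (N n).+1%:R :> R.
  by rewrite /W big_ord_recr/= natrM.
have w0 m : 0 <= (W m)%:R * t :> R by rewrite mulr_ge0.
apply/eqP; rewrite eqn_leq; apply/andP; split.
  rewrite /K truncn_ge_nat//.
  rewrite -(ler_pM2r (_ : 0 < (N n).+1%:R))// mulrAC -WS -natrM.
  by rewrite (le_trans (_ : _ <= (K n.+1 t)%:R)) ?ler_nat ?leq_divM// /K truncn_le.
rewrite leq_divRL// /K truncn_ge_nat// natrM WS mulrAC ler_pM2r//.
by rewrite truncn_le.
Qed.

Let gam_step n t : 0 <= t -> mdist (gam n t) (gam n.+1 t) <= C * delta n.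
Proof. by move=> t0; rewrite /gam -K_div// chain_pt_refine. Qed.

(** As [delta m = 2 * (delta m - delta m.+1)], the step bounds telescope. *)
Let gam_tail n m t : 0 <= t -> (n <= m)%N ->
  mdist (gam n t) (gam m t) <= 2 * C * (delta n - delta m).
Proof.
move=> t0; elim: m => [|m IH].
  by rewrite leqn0 => /eqP ->; rewrite mdistxx subrr mulr0.
rewrite leq_eqVlt => /predU1P[->|]; first by rewrite mdistxx subrr mulr0.
rewrite ltnS => /IH{}IH; have := metric_triangle (gam n t) (gam m t) (gam m.+1 t).
have := gam_step m t0; have := deltaS m; move: IH; rewrite mulrBr => *.
rewrite mulrBr.
have : 2 * C * delta m - C * delta m = 2 * C * delta m.+1 by rewrite deltaS; ring.
lra.
Qed.

Let gam_near n s t : 0 <= s -> 0 <= t -> `|s - t| < (W n)%:R^-1 ->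
  mdist (gam n s) (gam n t) <= delta n.
Proof.
wlog st : s t / s <= t.
  move=> H s0 t0; have [st|/ltW ts] := leP s t; first exact: H.
  by rewrite distrC metric_sym; exact: H.
move=> s0 t0; rewrite distrC ger0_norm ?subr_ge0// => lt.
have w0 : 0 < (W n)%:R :> R by rewrite ltr0n.
have lt1 : (W n)%:R * t < (W n)%:R * s + 1.
  have : (t - s) * (W n)%:R < 1 by rewrite -ltr_pdivlMr// div1r.
  by rewrite mulrBl [t * _]mulrC [s * _]mulrC; lra.
have K1 : (K n s <= K n t)%N by apply: le_truncn; rewrite ler_pM2l.
have K2 : (K n t <= (K n s).+1)%N.
  rewrite /K truncn_le_nat; apply: (lt_le_trans lt1).
  by rewrite -addn1 natrD lerD2r// ltW// truncnS_gt.
rewrite /gam; have [->|ne] := eqVneq (K n s) (K n t); first by rewrite mdistxx ltW.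
by have -> : K n t = (K n s).+1 by [lia]; exact: chain_pt_step.
Qed.

(** Compactness gives a cluster point of the chain points at each time, and [gam_tail] bounds its
    distance to level [n] by [2 * C * delta n]. The chains thus converge uniformly, while their own
    jumps are at most [delta n]. *)
Lemma refined_path : exists g : R -> T, [/\ {within `[0, 1], continuous g},
  g 0 = u, g 1 = v & forall t, 0 <= t -> mdist u (g t) <= (1 + 2 * C) * mdist u v].
Proof.
have /choice[g Hg] : forall t, exists p, 0 <= t ->
    forall n, mdist (gam n t) p <= 2 * C * delta n.
  move=> t; have [p Hp] := @compact_seq_cluster _ _ (gam^~ t) cT; exists p => t0 n.
  apply/ler_addgt0Pl => e e0; have [m nm pm] := Hp e e0 n.
  have := metric_triangle (gam n t) (gam m t) p.
  have := gam_tail t0 nm; rewrite mulrBr.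
  have : 0 <= 2 * C * delta m by apply: mulr_ge0 (ltW (delta_gt0 m)); rewrite mulr_ge0.
  by move: pm; rewrite [mdist p _]metric_sym; lra.
(* One jump [delta n] plus two approximation errors [2 * C * delta n]. *)
have small e : 0 < e -> exists n, (1 + 4 * C) * delta n < e.
  move=> e0; have k0 : 0 < (1 + 4 * C) * mdist u v.
    by rewrite mulr_gt0 ?mdist_gt0//; have := C0; lra.
  exists (Num.truncn ((1 + 4 * C) * mdist u v / e)).+1.
  set m := Num.truncn _.
  have h1 : (1 + 4 * C) * mdist u v / e < m.+1%:R by exact: truncnS_gt.
  have h2 : (m.+1%:R : R) < 2 ^+ m.+1 by rewrite -natrX ltr_nat ltn_expl//.
  rewrite /delta mulrA ltr_pdivrMr ?exprn_gt0//.
  by move: (lt_trans h1 h2); rewrite ltr_pdivrMr// [e * _]mulrC.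
have ptE t p : 0 <= t -> (forall n, gam n t = p) -> g t = p.
  move=> t0 e; apply/eqP; apply: contrapT => /negP; rewrite -mdist_gt0 => d0.
  have [n Hn] := small _ d0; have := Hg t t0 n; rewrite e metric_sym.
  have : 0 <= 2 * C * delta n by apply: mulr_ge0 (ltW (delta_gt0 n)); rewrite mulr_ge0.
  have := delta_gt0 n; move: Hn; rewrite mulrDl mul1r.
  have -> : 4 * C * delta n = 2 * (2 * C * delta n) by ring.
  lra.
exists g; split.
- apply/within_continuousP => t; rewrite /= in_itv/= => /andP[t0 t1] e e0.
  have [n Hn] := small e e0.
  exists (W n)%:R^-1; first by rewrite invr_gt0 ltr0n.
  move=> s; rewrite /= in_itv/= => /andP[s0 s1] ts.
  have := gam_near t0 s0 ts; have := Hg t t0 n; have := Hg s s0 n.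
  have := metric_triangle (g t) (gam n t) (g s).
  have := metric_triangle (gam n t) (gam n s) (g s).
  rewrite ballEmdist/= [mdist (g t) (gam n t)]metric_sym.
  move: Hn; rewrite mulrDl mul1r.
  have -> : 4 * C * delta n = 2 * (2 * C * delta n) by ring.
  lra.
- by apply: ptE => // n; rewrite /gam /K mulr0 truncn0.
- by apply: ptE => // n; rewrite /gam /K mulr1 natrK.
- move=> t t0; have := Hg t t0 0%N.
  have -> : delta 0 = mdist u v by rewrite /delta expr0 divr1.
  have := metric_triangle u (gam 0 t) (g t).
  have : mdist u (gam 0 t) <= mdist u v.
    by rewrite /gam/=; case: ifP; rewrite ?mdistxx ?mdist_ge0.
  lra.
Qed.
End refinements.

Lemma bounded_turning_path : exists g : R -> T, [/\ {within `[0, 1], continuous g},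
  g 0 = u, g 1 = v & forall t, 0 <= t -> mdist u (g t) <= (1 + 2 * C) * mdist u v].
Proof.
have /choice[N HN] := fun n => subdivision cT bt (delta_gt0 n).
have /choice[c Hc] := fun p : nat * (T * T) => HN p.1 p.2.1 p.2.2.
by apply: (@refined_path N (fun n x y => c (n, (x, y)))) => n x y;
  exact: (Hc (n, (x, y))).
Qed.
End path_of_bounded_turning.

(** * Arcs in a tree *)

Section path_operations.
Variables (R : realType) (T : metricType R).
Implicit Types g h : R -> T.

Lemma subpath_continuous g (a b : R) : {within `[0, 1], continuous g} ->
  0 <= a <= 1 -> 0 <= b <= 1 ->
  {within `[0, 1], continuous (fun t => g (a + (b - a) * t))}.
Proof.
move=> /within_continuousP gc /andP[a0 a1] /andP[b0 b1].
have inI t : 0 <= t <= 1 -> `[0, 1]%classic (a + (b - a) * t).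
  move=> /andP[t0 t1]; rewrite /= in_itv/=.
  have -> : a + (b - a) * t = a * (1 - t) + b * t by ring.
  rewrite addr_ge0 ?mulr_ge0 ?subr_ge0//=.
  have : a * (1 - t) <= 1 - t by rewrite ler_piMl// subr_ge0.
  have : b * t <= t by rewrite ler_piMl.
  lra.
apply/within_continuousP => t; rewrite /= in_itv/= => t01 e e0.
have [d d0 Hd] := gc _ (inI t t01) e e0.
exists d => // s; rewrite in_itv/= => s01 ts.
apply: Hd; first exact: inI.
rewrite /ball/=.
have -> : a + (b - a) * t - (a + (b - a) * s) = (b - a) * (t - s) by ring.
rewrite normrM (le_lt_trans _ ts)// ler_piMl// ler_norml; apply/andP; split; lra.
Qed.

Lemma concat_path g h : {within `[0, 1], continuous g} ->
  {within `[0, 1], continuous h} -> g 1 = h 0 ->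
  exists k : R -> T, [/\ {within `[0, 1], continuous k}, k 0 = g 0, k 1 = h 1 &
    k @` `[0, 1] `<=` g @` `[0, 1] `|` h @` `[0, 1]].
Proof.
move=> gc hc gh; pose k t := if t <= 1 / 2 then g (2 * t) else h (2 * t - 1).
have kL t : t <= 1 / 2 -> k t = g (2 * t) by rewrite /k => ->.
have kR t : 1 / 2 <= t -> k t = h (2 * t - 1).
  rewrite /k le_eqVlt => /predU1P[<-|t12]; last by rewrite leNgt t12.
  rewrite lexx.
  have -> : 2 * (1 / 2) = 1 :> R by lra.
  by rewrite subrr.
exists k; split.
- have -> : `[0, 1]%classic = `[0, 1 / 2]%classic `|` `[1 / 2, 1]%classic :> set R.
    apply/seteqP; split=> t; rewrite /= !in_itv/=.
      by move=> /andP[-> ->]; rewrite andbT; case: (leP t (1 / 2)) => [|/ltW];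
        [left|right].
    by case=> /andP[h1 h2]; apply/andP; split; lra.
  move: gc hc => /within_continuousP gc /within_continuousP hc.
  apply: withinU_continuous; first exact: itv_closed. exact: itv_closed.
    apply/within_continuousP => t; rewrite /= in_itv/= => /andP[t0 t1] e e0.
    have [|d d0 Hd] := gc (2 * t) _ e e0; first by rewrite /= in_itv/=; apply/andP;
      split; lra.
    exists (d / 2) => [|s]; first by rewrite divr_gt0.
    rewrite in_itv/= => /andP[s0 s1] ts; rewrite !kL//.
    apply: Hd; first by rewrite /= in_itv/=; apply/andP; split; lra.
    by rewrite /ball/= -mulrBr normrM gtr0_norm// mulrC -ltr_pdivlMr.
  apply/within_continuousP => t; rewrite /= in_itv/= => /andP[t0 t1] e e0.
  have [|d d0 Hd] := hc (2 * t - 1) _ e e0; first by rewrite /= in_itv/=; apply/andP;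
    split; lra.
  exists (d / 2) => [|s]; first by rewrite divr_gt0.
  rewrite in_itv/= => /andP[s0 s1] ts; rewrite !kR//.
  apply: Hd; first by rewrite /= in_itv/=; apply/andP; split; lra.
  rewrite /ball/=; have -> : 2 * t - 1 - (2 * s - 1) = 2 * (t - s) by ring.
  by rewrite normrM gtr0_norm// mulrC -ltr_pdivlMr.
- by rewrite kL ?mulr0//; lra.
- by rewrite kR; [congr h; lra|lra].
- move=> _ [t /= + <-]; rewrite in_itv/= => /andP[t0 t1].
  have [t12|/ltW t12] := leP t (1 / 2).
    left; rewrite kL//; exists (2 * t) => //; rewrite /= in_itv/=; apply/andP; split; lra.
  right; rewrite kR//; exists (2 * t - 1) => //; rewrite /= in_itv/=; apply/andP; split;
    lra.
Qed.
End path_operations.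

Section segments.
Variables (R : realType) (T : metricType R).

(* The arc from [x] to [y], or [[set x]] if [x = y]. *)
Definition seg (x y : T) : set T :=
  [set z | (x = y /\ z = x) \/ exists2 J, jordan_arc R J x y & J z].

Hypothesis arcs : forall x y : T, x != y -> exists! J : set T, jordan_arc R J x y.

Lemma jordan_arc_neq J (x y : T) : jordan_arc R J x y -> x <> y.
Proof.
move=> [f [g [_ _ gf f0 f1]]] xy.
have := gf 0; rewrite f0 xy -f1 gf ?lexx ?ler01// => /(_ isT)/eqP.
by rewrite oner_eq0.
Qed.

Lemma seg_arc x y J : jordan_arc R J x y -> seg x y = J.
Proof.
move=> aJ; have xy := jordan_arc_neq aJ; apply/seteqP; split=> z.
  move=> [[//]|[J' aJ' J'z]].
  have [|J0 [_ uJ]] := arcs (x := x) (y := y); first exact/eqP.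
  by rewrite -(uJ _ aJ) (uJ _ aJ').
by move=> Jz; right; exists J.
Qed.

Lemma seg_param x y : x <> y -> exists b : R -> T,
  [/\ {within `[0, 1], continuous b}, b 0 = x, b 1 = y, b @` `[0, 1] = seg x y &
   forall s t, 0 <= s <= 1 -> 0 <= t <= 1 -> b s = b t -> s = t].
Proof.
move=> /eqP xy; have [J [aJ _]] := arcs xy.
rewrite (seg_arc aJ); have [f [g [[fc _] fJ gf f0 f1]]] := aJ.
exists f; split=> // s t s01 t01 fst; by rewrite -(gf s)// -(gf t)// fst.
Qed.

Lemma segxx x z : seg x x z -> z = x.
Proof. by move=> [[]//|[J /jordan_arc_neq]]. Qed.

(** The path contains an arc with the same ends, and by uniqueness it is the arc. The order and
    betweenness properties of [seg] all rest on this. *)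
Lemma seg_path (g : R -> T) : {within `[0, 1], continuous g} ->
  seg (g 0) (g 1) `<=` g @` `[0, 1].
Proof.
move=> gc; have [e|/eqP ne] := pselect (g 0 = g 1).
  rewrite e => z /segxx ->; exists 1 => //; rewrite /= in_itv/= lexx ler01//.
by have [J JK aJ] := path_contains_arc gc ne; rewrite (seg_arc aJ).
Qed.

Lemma seg_subpath (g : R -> T) (a b : R) : {within `[0, 1], continuous g} ->
  0 <= a <= 1 -> 0 <= b <= 1 ->
  forall z, seg (g a) (g b) z -> exists2 t, Num.min a b <= t <= Num.max a b & z = g t.
Proof.
move=> gc a01 b01 z; have := seg_path (subpath_continuous gc a01 b01).
rewrite mulr0 addr0 mulr1 addrC subrK => /(_ z) H /H[t /= + <-].
rewrite in_itv/= => /andP[t0 t1]; exists (a + (b - a) * t) => //.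
have -> : a + (b - a) * t = a * (1 - t) + b * t by ring.
have [ab|/ltW ba] := leP a b.
  apply/andP; split.
    have : a * t <= b * t by rewrite ler_wpM2r.
    by rewrite mulrBr mulr1; lra.
  have : a * (1 - t) <= b * (1 - t) by rewrite ler_wpM2r ?subr_ge0.
  by rewrite !mulrBr !mulr1; lra.
apply/andP; split.
  have : b * (1 - t) <= a * (1 - t) by rewrite ler_wpM2r ?subr_ge0.
  by rewrite !mulrBr !mulr1; lra.
have : b * t <= a * t by rewrite ler_wpM2r.
by rewrite mulrBr mulr1; lra.
Qed.

Lemma seg_any_param x y : exists b : R -> T,
  [/\ {within `[0, 1], continuous b}, b 0 = x, b 1 = y & b @` `[0, 1] = seg x y].
Proof.
have [<-|ne] := pselect (x = y); last first.
  by have [b [? ? ? ? _]] := seg_param ne; exists b.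
exists (fun=> x); split=> //.
  by apply: continuous_subspaceT => t; exact: cvg_cst.
apply/seteqP; split=> z; first by move=> [t _ <-]; left.
by move/segxx => ->; exists 0 => //; rewrite /= in_itv/= lexx ler01.
Qed.

Lemma seg_l x y : seg x y x.
Proof.
have [b [bc b0 b1 <-]] := seg_any_param x y; exists 0 => //.
by rewrite /= in_itv/= lexx ler01.
Qed.

Lemma seg_r x y : seg x y y.
Proof.
have [b [bc b0 b1 <-]] := seg_any_param x y; exists 1 => //.
by rewrite /= in_itv/= lexx ler01.
Qed.

Lemma seg_sub_sym x y : seg x y `<=` seg y x.
Proof.
have [b [bc <- <- <-]] := seg_any_param y x => z Hz.
have [||t t01 ->] := seg_subpath (a := 1) (b := 0) bc _ _ Hz; rewrite ?lexx ?ler01//.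
exists t => //; rewrite /= in_itv/=.
by move: t01; rewrite min_r ?max_l.
Qed.

Lemma seg_sym x y : seg x y = seg y x.
Proof. by apply/seteqP; split; exact: seg_sub_sym. Qed.

Lemma seg_tri z x y : seg x y `<=` seg x z `|` seg z y.
Proof.
have [g [gc g0 g1 <-]] := seg_any_param x z.
have [h [hc h0 h1 <-]] := seg_any_param z y.
have [|k [kc k0 k1 ksub]] := concat_path gc hc; first by rewrite g1.
have := seg_path kc; rewrite k0 k1 g0 h1 => H w /H; exact: ksub.
Qed.

Lemma seg_subl x y z : seg x y z -> seg x z `<=` seg x y.
Proof.
have [b [bc <- _ <-]] := seg_any_param x y => -[t /= + <-] w Hw.
rewrite in_itv/= => t01; have /andP[t0 t1] := t01.
have [||s + ->] := seg_subpath (a := 0) (b := t) bc _ _ Hw; rewrite ?lexx ?ler01//.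
rewrite min_l ?max_r// => /andP[s0 st]; exists s => //.
by rewrite /= in_itv/= s0 (le_trans st).
Qed.

Lemma seg_subr x y z : seg x y z -> seg z y `<=` seg x y.
Proof. by rewrite seg_sym [seg z y]seg_sym; exact: seg_subl. Qed.

Lemma seg_meet x y z w : seg x y z -> seg x z w -> seg z y w -> w = z.
Proof.
have [<-|ne] := pselect (x = y).
  by move=> /segxx -> /segxx ->.
have [b [bc <- <- <- binj]] := seg_param ne => -[t /= + <-] H1 H2.
rewrite in_itv/= => t01; have /andP[t0 t1] := t01.
have [||s + e1] := seg_subpath (a := 0) (b := t) bc _ _ H1; rewrite ?lexx ?ler01//.
rewrite min_l ?max_r// => /andP[s0 st].
have [||r + e2] := seg_subpath (a := t) (b := 1) bc _ _ H2; rewrite ?lexx ?ler01//.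
rewrite min_l ?max_r// => /andP[tr r1].
have sr : s = r.
  apply: binj; last by rewrite -e1.
    by rewrite s0 (le_trans st).
  by rewrite r1 (le_trans t0).
have ts : t = s by apply/eqP; rewrite eq_le st sr tr.
by rewrite e1 ts.
Qed.

Lemma seg_comparable x y z w : seg x y z -> seg x y w -> seg x w z \/ seg x z w.
Proof.
have [<-|ne] := pselect (x = y).
  by move=> /segxx -> /segxx ->; left; exact: seg_l.
have [b [bc b0 b1 bE binj]] := seg_param ne.
have key s t : 0 <= s <= 1 -> 0 <= t <= 1 -> s <= t -> seg x (b t) (b s).
  move=> s01 t01 st; have : seg x y (b s) by rewrite -bE; exists s.
  move=> /(seg_tri (b t))[//|]; rewrite -b1 => H.
  have [||r + e2] := seg_subpath (a := t) (b := 1) bc _ _ H; rewrite ?lexx ?ler01//.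
  have /andP[t0 t1] := t01; rewrite min_l ?max_r// => /andP[tr r1].
  have sr : s = r by apply: binj => //; rewrite r1 (le_trans t0).
  have -> : t = s by apply/eqP; rewrite eq_le st sr tr.
  exact: seg_r.
rewrite -bE => -[s /= + <-] [t /= + <-]; rewrite !in_itv/= => s01 t01.
by have [st|/ltW ts] := leP s t; [left|right]; apply: key.
Qed.

Lemma seg_compact x y : compact (seg x y).
Proof.
have [b [bc _ _ <-]] := seg_any_param x y.
by apply: continuous_compact => //; exact: segment_compact.
Qed.

Lemma seg_closed x y : closed (seg x y).
Proof. by apply: compact_closed (@seg_compact x y); exact: metric_hausdorff. Qed.

Lemma seg_connected x y : connected (seg x y).
Proof.
have [b [bc _ _ <-]] := seg_any_param x y.
by apply: connected_continuous_connected => //; exact: segment_connected.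
Qed.

(** Take for [m] the last point of the arc from [p] to [x] that lies on the arc from [p] to [y]. The
    arcs from [m] to [x] and to [y] then meet only in [m]. If the arc from [x] to [y] avoided [m],
    its part on [seg x m] would be open and closed in it, hence all of it, forcing [y = m]. *)
Lemma seg_median p x y : exists m, [/\ seg p x m, seg p y m & seg x y m].
Proof.
have [<-|ne] := pselect (p = x).
  by exists p; split; rewrite ?seg_l//; exact: seg_l.
have [b [bc b0 b1 bE binj]] := seg_param ne.
pose S := `[0, 1]%classic `&` b @^-1` (seg p y).
have supS : has_sup S.
  split; last by exists 1 => s [/=]; rewrite in_itv/= => /andP[].
  exists 0; split; first by rewrite /= in_itv/= lexx ler01.
  by rewrite /preimage/= b0; exact: seg_l.
have Sle s : S s -> s <= sup S by exact: sup_upper_bound.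
have s01 : 0 <= sup S <= 1.
  apply/andP; split.
    have [[s Ss] _] := supS; apply: le_trans (Sle _ Ss).
    by case: Ss => /=; rewrite in_itv/= => /andP[].
  by apply: ge_sup; [case: supS|move=> s [/=]; rewrite in_itv/= => /andP[]].
have s01' : `[0, 1]%classic (sup S) by rewrite /= in_itv.
have mpy : seg p y (b (sup S)).
  apply: seg_closed => B /nbhs_ballP[e/= e0 sub].
  move/within_continuousP : (bc) => /(_ _ s01' e e0)[d d0 Hd].
  have [s Ss lt] := sup_adherent d0 supS; exists (b s); case: (Ss) => sI sb.
  split=> //; apply: sub; apply: Hd => //.
  by rewrite /ball/= ger0_norm ?subr_ge0 ?Sle// ltrBlDr -ltrBlDl.
have mpx : seg p x (b (sup S)) by rewrite -bE; exists (sup S).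
set m := b (sup S) in mpy mpx *.
exists m; split=> //; apply: contrapT => nm.
have disj w : seg x m w -> seg m y w -> w = m.
  rewrite seg_sym -b1 => Hw wy.
  have [||r + wE] := seg_subpath (a := sup S) (b := 1) bc _ _ Hw; rewrite ?lexx ?ler01//.
  have /andP[S0 S1] := s01; rewrite min_l ?max_r// => /andP[Sr r1].
  have Srr : S r.
    split; first by rewrite /= in_itv/= r1 (le_trans S0).
    by rewrite /preimage/= -wE; exact: seg_subr wy.
  by rewrite wE; congr b; apply/eqP; rewrite eq_le Sle.
have : seg x y `&` seg x m = seg x y.
  apply: (seg_connected (x := x) (y := y)).
  - by exists x; split; exact: seg_l.
  - exists (~` seg m y); first exact/closed_openC/seg_closed.
    apply/seteqP; split=> w [wxy H]; split=> //.
      by move=> wmy; apply: nm; rewrite -(disj w).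
    by have [//|//] := seg_tri m wxy.
  - by exists (seg x m) => //; exact: seg_closed.
move=> E; have [_ xmy] : (seg x y `&` seg x m) y by rewrite E; exact: seg_r.
by apply: nm; rewrite -(disj y) //; exact: seg_r.
Qed.

Hypothesis cT : compact [set: T].
Variable C : R.
Hypothesis C0 : 0 <= C.
Hypothesis bt : bounded_turning C T.

(** The path that contains the arc stays within [(1 + 2 * C) * mdist x y] of [x]; the factor 2 turns
    this radius into a diameter. *)
Definition arc_turning : R := 2 * (1 + 2 * C).

Lemma arc_turning_gt0 : 0 < arc_turning. Proof. by rewrite /arc_turning; have := C0;
  lra. Qed.

Lemma seg_bounded x y z w : seg x y z -> seg x y w ->
  mdist z w <= arc_turning * mdist x y.
Proof.
have [<-|/eqP ne] := pselect (x = y).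
  by move=> /segxx -> /segxx ->; rewrite !mdistxx mulr0.
have [g [gc g0 g1 gb]] := bounded_turning_path C0 cT ne bt.
have near v : seg x y v -> mdist x v <= (1 + 2 * C) * mdist x y.
  rewrite -g0 -g1 => /(seg_path gc)[t /= + <-]; rewrite in_itv/= => /andP[t0 _].
  by rewrite g0 g1 gb.
move=> /near h1 /near h2; have := metric_triangle z x w.
rewrite [mdist z x]metric_sym /arc_turning; move: h1 h2.
have -> : 2 * (1 + 2 * C) * mdist x y = (1 + 2 * C) * mdist x y + (1 + 2 * C) * mdist x y.
  by ring.
lra.
Qed.

Definition arcdiam (x y : T) : R :=
  sup [set mdist p.1 p.2 | p in seg x y `*` seg x y].

Let has_sup_arcdiam x y : has_sup [set mdist p.1 p.2 | p in seg x y `*` seg x y].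
Proof.
split; first by exists (mdist x x), (x, x) => //=; split; exact: seg_l.
by exists (arc_turning * mdist x y) => _ [[z w] [/= h1 h2] <-]; exact: seg_bounded.
Qed.

Lemma arcdiam_ub x y z w : seg x y z -> seg x y w -> mdist z w <= arcdiam x y.
Proof. by move=> h1 h2; apply: sup_upper_bound => //; exists (z, w). Qed.

Lemma arcdiam_lub x y r : (forall z w, seg x y z -> seg x y w -> mdist z w <= r) ->
  arcdiam x y <= r.
Proof.
move=> H; apply: ge_sup; first by case: (has_sup_arcdiam x y).
by move=> _ [[z w] [/= h1 h2] <-]; exact: H.
Qed.

Lemma arcdiam_le x y : arcdiam x y <= arc_turning * mdist x y.
Proof. by apply: arcdiam_lub => z w; exact: seg_bounded. Qed.

Lemma mdist_le_rho x y : mdist x y <= arcdiam x y.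
Proof. by apply: arcdiam_ub; [exact: seg_l|exact: seg_r]. Qed.

Lemma arcdiam_ge0 x y : 0 <= arcdiam x y.
Proof. exact: le_trans (mdist_ge0 x y) (mdist_le_rho x y). Qed.

Lemma arcdiamxx x : arcdiam x x = 0.
Proof.
apply/eqP; rewrite eq_le arcdiam_ge0 andbT; apply: arcdiam_lub => z w /segxx -> /segxx ->.
by rewrite mdistxx.
Qed.

Lemma arcdiam_sym x y : arcdiam x y = arcdiam y x.
Proof. by rewrite /arcdiam seg_sym. Qed.

Lemma arcdiam_mono x y x' y' : seg x y `<=` seg x' y' -> arcdiam x y <= arcdiam x' y'.
Proof. by move=> sub; apply: arcdiam_lub => z w /sub h1 /sub; exact: arcdiam_ub. Qed.

Lemma arcdiam_tri x y z : arcdiam x z <= arcdiam x y + arcdiam y z.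
Proof.
apply: arcdiam_lub => a b /(seg_tri y) ha /(seg_tri y) hb.
have := arcdiam_ge0 x y; have := arcdiam_ge0 y z.
case: ha => ha; case: hb => hb.
- have := arcdiam_ub ha hb; lra.
- have := arcdiam_ub ha (seg_r x y); have := arcdiam_ub (seg_l y z) hb.
  have := metric_triangle a y b; lra.
- have := arcdiam_ub (seg_r x y) hb; have := arcdiam_ub ha (seg_l y z).
  have := metric_triangle a y b; lra.
- have := arcdiam_ub ha hb; lra.
Qed.

End segments.

(** * Zigzag walks on the line *)

Section walker.
Variables (R : realType) (r0 : R) (n : nat).

Definition walk_scale (k : nat) : R := r0 / 80 ^+ k.

(* A state gives, for each scale [k], the index of the last node of scale [k], the
   value of the walk of scale [k] there, and its current direction. *)
Definition wpos (rho : nat -> nat -> R) (s : nat -> nat * R * R) (j k : nat) :=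
  (s k).1.2 + (s k).2 * rho (s k).1.1 j.

(* Nodes are selected from the finest scale [n] upwards: a node of scale [k] must be
   one of every finer scale.  Segments of scale [k] then have length comparable to
   [walk_scale k] and no short leftover pieces can accumulate. *)
Definition wnode (rho : nat -> nat -> R) (s : nat -> nat * R * R) (j k : nat) :=
  all (fun l => walk_scale l <= rho (s l).1.1 j) (iota k (n.+1 - k)).

(* At a node the walk of scale [k] turns towards the walk of scale [k.-1], which
   it can follow because its steps add up to at least as much (subadditivity). *)
Fixpoint wstate (rho : nat -> nat -> R) (j : nat) : nat -> nat * R * R :=
  if j is j'.+1 then
    let s := wstate rho j' in fun k =>
    if wnode rho s j k then
      (j, wpos rho s j k, if wpos rho s j k <= wpos rho s j k.-1 then 1 else -1)
    else s k
  else fun=> (0%N, 0, 1).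

Definition walk (rho : nat -> nat -> R) (k j : nat) := wpos rho (wstate rho j) j k.

Definition wlast rho k j := (wstate rho j k).1.1.

Lemma wlast_le rho k j : (wlast rho k j <= j)%N.
Proof.
rewrite /wlast; elim: j => [//|j IH] /=; case: ifP => //= _.
exact: leq_trans IH _.
Qed.

(* The walk is non-anticipating: on a branching tree this makes the values read
   off along different arcs from the root agree on their common part. *)
Lemma wstate_local rho rho' m :
  (forall i j, (i <= j)%N -> (j <= m)%N -> rho i j = rho' i j) ->
  forall j, (j <= m)%N -> wstate rho j =1 wstate rho' j.
Proof.
move=> e; elim=> [//|j IH] jm k /=.
have {}IH := IH (ltnW jm).
have ep l : wpos rho (wstate rho j) j.+1 l = wpos rho' (wstate rho' j) j.+1 l.
  rewrite /wpos -!IH e//.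
  exact: leq_trans (wlast_le rho l j) (leqnSn _).
have -> : wnode rho (wstate rho j) j.+1 k = wnode rho' (wstate rho' j) j.+1 k.
  rewrite /wnode; apply: eq_in_all => l _; rewrite -!IH e//.
  exact: leq_trans (wlast_le rho l j) (leqnSn _).
by rewrite !ep IH.
Qed.

Lemma walk_local rho rho' m :
  (forall i j, (i <= j)%N -> (j <= m)%N -> rho i j = rho' i j) ->
  forall k, walk rho k m = walk rho' k m.
Proof.
move=> e k; rewrite /walk /wpos !(wstate_local e)// e//.
by have := wlast_le rho' k m.
Qed.

Hypothesis r0_gt0 : 0 < r0.

Lemma walk_scale_gt0 k : 0 < walk_scale k.
Proof. by rewrite /walk_scale divr_gt0// exprn_gt0. Qed.

Lemma walk_scaleS k : walk_scale k = 80 * walk_scale k.+1.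
Proof.
have e0 : (80 : R) ^+ k != 0 by rewrite expf_neq0// pnatr_eq0.
by rewrite /walk_scale exprS; field.
Qed.

Variable rho : nat -> nat -> R.
Hypothesis rho0 : forall i, rho i i = 0.
Hypothesis rho_mono : forall i' i j j', (i' <= i)%N -> (i <= j)%N -> (j <= j')%N ->
  rho i j <= rho i' j'.
Hypothesis rho_tri : forall i j k, (i <= j)%N -> (j <= k)%N ->
  rho i k <= rho i j + rho j k.
Hypothesis rho_step : forall i, rho i i.+1 <= walk_scale n.

Let F := walk rho.
Let L := wlast rho.
Let nd k j := wnode rho (wstate rho j) j.+1 k.

Let rho_ge0 i j : (i <= j)%N -> 0 <= rho i j.
Proof. by move=> ij; rewrite -(rho0 i) rho_mono. Qed.

Let ndE k j : (k <= n)%N -> nd k j = (walk_scale k <= rho (L k j) j.+1) && nd k.+1 j.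
Proof.
by move=> kn; rewrite /nd /wnode subSn//= subSS.
Qed.

Let LS k j : L k j.+1 = if nd k j then j.+1 else L k j.
Proof. by rewrite /L /wlast /=; rewrite -/(nd k j); case: ifP. Qed.

Let gap_n j : rho (L n j) j <= walk_scale n.
Proof.
elim: j => [|j IH]; first by rewrite rho0 ltW// walk_scale_gt0.
rewrite LS; case: ifPn; first by rewrite rho0 ltW// walk_scale_gt0.
by rewrite ndE// /nd /wnode subnn andbT -ltNge => /ltW.
Qed.

(** A node of scale [k.+1] fails to be one of scale [k] only when it is closer than [walk_scale k]
    to the last node of scale [k]. *)
Let gap_k k j : (k < n)%N ->
  (L k j <= L k.+1 j)%N /\ rho (L k j) (L k.+1 j) <= walk_scale k.
Proof.
move=> kn; elim: j => [|j [IH1 IH2]].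
  by split=> //; rewrite /L /wlast/= rho0 ltW// walk_scale_gt0.
rewrite !LS ndE; last exact: ltnW.
case: (nd k.+1 j); rewrite ?andbT ?andbF//.
case: ifPn => [_|]; first by rewrite rho0 ltW// walk_scale_gt0.
rewrite -ltNge => /ltW ->; split=> //.
exact: leq_trans (wlast_le _ _ _) _.
Qed.

Let gap2 k j : (k <= n)%N -> rho (L k j) j <= 2 * walk_scale k.
Proof.
(* Induction from the finest scale to the coarser ones: the gaps between successive last nodes add
   up geometrically. *)
move=> kn; have -> : k = (n - (n - k))%N by lia.
elim: (n - k)%N => [|d IH].
  by rewrite subn0 (le_trans (gap_n j))// ler_peMl ?ltW ?walk_scale_gt0// ltr1n.
case: (leqP n d) => nd'.
  by move: IH; have -> : (n - d = n - d.+1)%N by lia.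
have eS : (n - d = (n - d.+1).+1)%N by lia.
move: IH; rewrite eS => IH.
have kn' : (n - d.+1 < n)%N by lia.
have [le1 le2] := gap_k j kn'.
have := rho_tri le1 (wlast_le _ _ _) => /le_trans; apply.
have := walk_scaleS (n - d.+1); have := walk_scale_gt0 (n - d.+1).+1; move: IH le2.
rewrite /L; lra.
Qed.

Let stS k j : wstate rho j.+1 k = if nd k j then
  (j.+1, wpos rho (wstate rho j) j.+1 k,
   if wpos rho (wstate rho j) j.+1 k <= wpos rho (wstate rho j) j.+1 k.-1
   then 1 else -1) else wstate rho j k.
Proof. by []. Qed.

Let FS k j : F k j.+1 = wpos rho (wstate rho j) j.+1 k.
Proof.
rewrite /F /walk {1}/wpos stS; case: ifP => //= _.
by rewrite rho0 mulr0 addr0.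
Qed.

Let st_const k i j : (L k j <= i)%N -> (i <= j)%N -> wstate rho i k = wstate rho j k.
Proof.
elim: j => [|j IH]; first by move=> _; rewrite leqn0 => /eqP ->.
move=> Li; rewrite leq_eqVlt => /predU1P[->//|]; rewrite ltnS => ij.
move: Li; rewrite LS stS; case: ifPn => [_ ji|_ Li].
  by move: ij; rewrite leqNgt ji.
exact: IH.
Qed.

Let sg_cases k j : (wstate rho j k).2 = 1 \/ (wstate rho j k).2 = -1.
Proof.
elim: j => [|j IH]; first by left.
rewrite stS; case: ifP => //= _; case: ifP => _; by [left|right].
Qed.

(** On one segment the walk is a signed [rho]-distance from its node, hence 1-Lipschitz for [rho] by
    monotonicity and subadditivity. The index [j'] may lie beyond [j], so that the bound also
    applies just before the state is updated. *)
Let seg_lip0 k i j j' : (L k j <= i)%N -> (i <= j)%N -> (i <= j')%N ->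
  `|wpos rho (wstate rho j) j' k - F k i| <= rho i j'.
Proof.
move=> Li ij ij'; rewrite /F /walk /wpos (st_const Li ij) -!/(L k j).
set V := (wstate rho j k).1.2; set s := (wstate rho j k).2.
have -> : V + s * rho (L k j) j' - (V + s * rho (L k j) i) =
  s * (rho (L k j) j' - rho (L k j) i) by ring.
have -> : `|s * (rho (L k j) j' - rho (L k j) i)| =
   `|rho (L k j) j' - rho (L k j) i|.
  by rewrite normrM /s; case: (sg_cases k j) => ->; rewrite ?normrN normr1 mul1r.
rewrite ger0_norm ?subr_ge0 ?rho_mono//.
by rewrite lerBlDl rho_tri.
Qed.

Let seg_lip k i j : (L k j.-1 <= i)%N -> (i <= j)%N -> `|F k j - F k i| <= rho i j.
Proof.
case: j => [|j].
  by move=> _; rewrite leqn0 => /eqP ->; rewrite subrr normr0 rho0.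
move=> Li; rewrite leq_eqVlt => /predU1P[->|]; first by rewrite subrr normr0 rho0.
by rewrite ltnS => ij; rewrite FS seg_lip0// ltnW.
Qed.

Let seg_lip1 k i j : (L k j <= i)%N -> (i <= j)%N -> `|F k j - F k i| <= rho i j.
Proof.
case: j => [|j].
  by move=> _; rewrite leqn0 => /eqP ->; rewrite subrr normr0 rho0.
move=> Li ij; apply: seg_lip => //=; move: Li; rewrite LS; case: ifP => // _ ji.
by apply: leq_trans (wlast_le _ _ _) (leq_trans _ ji).
Qed.

Let Lnode k j : (0 < L k j)%N -> L k (L k j) = L k j /\
  ((k <= n)%N -> walk_scale k <= rho (L k (L k j).-1) (L k j)).
Proof.
elim: j => [//|j IH]; rewrite LS; case: ifPn => [ndj _|_ /IH//].
rewrite LS ndj; split=> // kn.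
by move: ndj; rewrite ndE// => /andP[].
Qed.

Let node_rho k j : (k <= n)%N -> nd k j ->
  walk_scale k <= rho (L k j) j.+1 <= 3 * walk_scale k.
Proof.
move=> kn; rewrite ndE// => /andP[-> _] /=.
have := rho_tri (wlast_le rho k j) (leqnSn j); rewrite -/(L k j).
have := gap2 j kn; have := rho_step j.
have : walk_scale n <= walk_scale k.
  rewrite /walk_scale ler_pM2l// lef_pV2 ?posrE ?exprn_gt0//.
  by rewrite ler_weXn2l// ler1n.
lra.
Qed.

(** The turning rule in sign form, so that [gapV] treats both directions alike. At scale 0, where
    [k.-1] is 0 again, the walk always goes up. *)
Let sgE k j : 0 <= (wstate rho j k).2 * (F k.-1 (L k j) - (wstate rho j k).1.2) .
Proof.
elim: j => [|j IH].
  by rewrite /F /walk /wpos/= /L /wlast/= rho0 mulr0 addr0 subrr mulr0.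
rewrite stS LS; case: ifPn => //= _; rewrite FS.
case: ifPn => [|]; first by rewrite mul1r subr_ge0.
by rewrite -ltNge mulN1r oppr_ge0 subr_le0 => /ltW.
Qed.

(** Over a segment of length r the walk moves by r towards the coarser walk, which moves by at most
    r. A gap D in that direction becomes a number between D - 2r and D, and r is at most
    [3 * walk_scale k]; hence the 6. *)
Let gapV k j : (0 < k <= n)%N ->
  `|F k.-1 (L k j) - (wstate rho j k).1.2| <= 6 * walk_scale k.
Proof.
move=> /andP[k0 kn]; elim: j => [|j IH].
  rewrite /F /walk /wpos/= /L /wlast/= rho0 mulr0 addr0 subrr normr0.
  by rewrite mulr_ge0// ltW// walk_scale_gt0.
rewrite stS LS; case: ifPn => //= ndj.
have /andP[_ r3] := node_rho kn ndj.
have kn' : (k.-1 < n)%N by rewrite prednK.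
have [Lk _] := gap_k j kn'; rewrite prednK// in Lk.
have := @seg_lip k.-1 (L k j) j.+1 Lk (leq_trans (wlast_le _ _ _) (leqnSn _)).
move: (sgE k j) IH; rewrite /wpos -/(L k j).
set V := (wstate rho j k).1.2; set a := F _ _; set b := F k.-1 j.+1.
set r := rho _ _ in r3 *.
have r_ge0 : 0 <= r by apply: rho_ge0; apply: leq_trans (wlast_le _ _ _) (leqnSn _).
rewrite !ler_norml; case: (sg_cases k j) => ->; lra.
Qed.

(** The gap 6 at the last node, plus at most 2 for the motion of each of the two walks since
    then. *)
Let gapF k j : (0 < k <= n)%N -> `|F k j - F k.-1 j| <= 10 * walk_scale k.
Proof.
move=> /andP[k0 kn].
have g6 : `|F k.-1 (L k j) - (wstate rho j k).1.2| <= 6 * walk_scale k.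
  by apply: gapV; rewrite k0.
have kn' : (k.-1 < n)%N by rewrite prednK.
have [Lk _] := gap_k j kn'; rewrite prednK// in Lk.
have l1 := seg_lip1 Lk (wlast_le _ _ _).
have l2 : `|F k j - (wstate rho j k).1.2| <= rho (L k j) j.
  rewrite /F /walk /wpos -/(L k j) addrAC subrr add0r normrM.
  rewrite [X in _ * X]ger0_norm ?rho_ge0 ?wlast_le//.
  by case: (sg_cases k j) => ->; rewrite ?normrN normr1 mul1r.
have g2 := gap2 j kn.
move: g6 l1 l2; rewrite -/(L k j) !ler_norml; lra.
Qed.

Let tail k j : (k <= n)%N -> `|F n j - F k j| <= 20 * walk_scale k.+1.
Proof.
move=> kn; have -> : k = (n - (n - k))%N by lia.
elim: (n - k)%N => [|d IH].
  by rewrite subn0 subrr normr0 mulr_ge0// ltW// walk_scale_gt0.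
case: (leqP n d) => nd'.
  by move: IH; have -> : (n - d = n - d.+1)%N by lia.
have eS : (n - d = (n - d.+1).+1)%N by lia.
move: IH; rewrite eS => IH.
have kn' : (0 < (n - d.+1).+1 <= n)%N by lia.
have := gapF j kn'; rewrite /=; move: IH.
have := walk_scaleS (n - d.+1).+1; have := walk_scale_gt0 (n - d.+1).+2.
rewrite !ler_norml; lra.
Qed.

(** Take the last two nodes of scale [k] up to [j]. The remainder after [c] is at most 2 scales and
    the segment before [c] at most 3, so a distance above 5 scales puts both after [i]. *)
Lemma walk_osc k i j : (k <= n)%N -> (i <= j)%N -> 5 * walk_scale k < rho i j ->
  exists b c, [/\ (i <= b)%N, (b <= c)%N,
    (c <= j)%N & walk_scale k / 2 <= `|F n c - F n b|].
Proof.
move=> kn ij rij.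
have g1 := gap2 j kn; set c := L k j in g1.
have cj : (c <= j)%N by exact: wlast_le.
have l0 := walk_scale_gt0 k.
have ic : (i < c)%N.
  rewrite ltnNge; apply/negP => ci; have := rho_mono ci ij (leqnn j); lra.
have c0 : (0 < c)%N by exact: leq_ltn_trans ic.
have [Lc] := @Lnode k j c0; move=> /(_ kn); rewrite -/c => rbc.
set b := L k c.-1 in rbc.
have bc' : (b <= c.-1)%N by exact: wlast_le.
have bc : (b <= c)%N by lia.
have ndc : nd k c.-1.
  move: Lc; have := LS k c.-1; rewrite prednK// -/c => ->; case: ifP => // _ e.
  by move: bc'; rewrite /b e; lia.
have := node_rho kn ndc; rewrite prednK// -/b => /andP[_ r3].
have ib : (i <= b)%N.
  rewrite leqNgt; apply/negP => bi.
  have := rho_mono (ltnW bi) ij (leqnn j); have := rho_tri bc cj; lra.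
exists b, c; split=> //.
have Fcb : `|F k c - F k b| = rho b c.
  have -> : F k b = (wstate rho c.-1 k).1.2.
    rewrite /F /walk /wpos.
    have -> : wstate rho b k = wstate rho c.-1 k by apply: st_const.
    by rewrite -/(L k c.-1) -/b rho0 mulr0 addr0.
  have := FS k c.-1; rewrite prednK// => ->; rewrite /wpos -/(L k c.-1) -/b.
  rewrite addrAC subrr add0r normrM [X in _ * X]ger0_norm ?rho_ge0//.
  by case: (sg_cases k c.-1) => ->; rewrite ?normrN normr1 mul1r.
have tc := tail c kn; have tb := tail b kn.
have l80 := walk_scaleS k.
have d1 : `|F k c - F k b| <= `|F n c - F n b| + `|F n c - F k c| + `|F n b - F k b|.
  have -> : F k c - F k b = (F n c - F n b) - (F n c - F k c) + (F n b - F k b) by ring.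
  by rewrite (le_trans (ler_normD _ _))// lerD2r (le_trans (ler_normB _ _)).
lra.
Qed.

(** Consecutive nodes are at least [walk_scale k] apart, so at most one turn occurs and two segments
    suffice. *)
Let walk_lip0 k i j : (k <= n)%N -> (i <= j)%N -> rho i j < walk_scale k ->
  `|F k j - F k i| <= 2 * rho i j.
Proof.
move=> kn ij rij.
have rge0 := rho_ge0 ij.
case: (leqP (L k j) i) => [Li|ic].
  by have := seg_lip1 Li ij; move: rge0; rewrite !ler_norml; lra.
set c := L k j in ic; have cj : (c <= j)%N by exact: wlast_le.
have c0 : (0 < c)%N by exact: leq_ltn_trans ic.
have [Lc] := @Lnode k j c0; move=> /(_ kn); rewrite -/c => rbc.
have bi : (L k c.-1 <= i)%N.
  rewrite leqNgt; apply/negP => ib.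
  have bc : (L k c.-1 <= c)%N by apply: leq_trans (wlast_le _ _ _) (leq_pred _).
  have := rho_mono (ltnW ib) bc cj; lra.
have l1 := seg_lip bi (ltnW ic).
have l2 : `|F k j - F k c| <= rho c j by apply: seg_lip1.
have m1 := rho_mono (leqnn i) (ltnW ic) cj.
have m2 := rho_mono (ltnW ic) cj (leqnn j).
move: l1 l2; rewrite !ler_norml; lra.
Qed.

(** Use the finest scale still above [rho i j]. The walk of that scale contributes 2, and the finer
    ones at most 20 at each end, because [walk_scale k.+1 <= rho i j]. *)
Lemma walk_lip i j : (i <= j)%N -> rho i j < r0 -> `|F n j - F n i| <= 42 * rho i j.
Proof.
move=> ij rij; have rge0 := rho_ge0 ij.
have lev0 : walk_scale 0 = r0 by rewrite /walk_scale expr0 divr1.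
have : exists2 k, (k <= n)%N & rho i j < walk_scale k /\ ((k < n)%N ->
  walk_scale k.+1 <= rho i j).
  have ex : exists k, (k <= n)%N && (rho i j < walk_scale k) by exists 0%N; rewrite lev0.
  have bd k : (k <= n)%N && (rho i j < walk_scale k) -> (k <= n)%N by case/andP.
  case: (ex_maxnP ex bd) => k /andP[kn rk] kmax; exists k => //; split=> // kn'.
  rewrite leNgt; apply/negP => lt; have := kmax k.+1; rewrite kn' lt => /(_ isT).
  by rewrite ltnn.
move=> [k kn [rk rk1]].
have l2 := walk_lip0 kn ij rk.
have [kn'|nk] := ltnP k n.
  have {}rk1 := rk1 kn'.
  have ti := tail i kn; have tj := tail j kn.
  move: l2 ti tj; rewrite !ler_norml; lra.
have ek : k = n by apply/eqP; rewrite eqn_leq kn.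
by move: l2; rewrite ek !ler_norml; lra.
Qed.

(** For the coarsest admissible scale, [rho i j] is at most 5 * 80 scales, and the swing is at least
    half a scale; hence 800. *)
Lemma walk_light i j : (i <= j)%N -> rho i j < r0 -> 5 * walk_scale n < rho i j ->
  exists b c, [/\ (i <= b)%N, (b <= c)%N, (c <= j)%N &
    rho i j / 800 <= `|F n c - F n b|].
Proof.
move=> ij rij rn.
have lev0 : walk_scale 0 = r0 by rewrite /walk_scale expr0 divr1.
have ex : exists k, (k <= n)%N && (5 * walk_scale k < rho i j) by exists n; rewrite leqnn.
case: (ex_minnP ex) => k /andP[kn rk] kmin.
have rk' : rho i j <= 400 * walk_scale k.
  case: k kn rk kmin => [|k] kn rk kmin.
    by have := walk_scale_gt0 0; rewrite lev0; lra.
  rewrite leNgt; apply/negP => lt; have := kmin k; rewrite ltnn => H.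
  suff: false by []. apply: H; rewrite ltnW//= walk_scaleS; lra.
have [b [c [ib bc cj osc]]] := walk_osc kn ij rk.
by exists b, c; split=> //; lra.
Qed.

End walker.

(** * Light functions on a tree *)

Lemma first_hit (R : realType) (f : R -> R) (r : R) : {within `[0, 1], continuous f} ->
  f 0 < r -> r <= f 1 ->
  exists s, [/\ 0 <= s <= 1, f s = r & forall t, 0 <= t < s -> f t < r].
Proof.
move=> fc f0 f1; pose S := `[0, 1]%classic `&` [set s | r <= f s].
have infS : has_inf S.
  split; last by exists 0 => s [/=]; rewrite in_itv/= => /andP[].
  by exists 1; split; rewrite //= in_itv/= lexx ler01.
have leS s : S s -> inf S <= s by apply: ge_inf; case: infS.
have s01 : 0 <= inf S <= 1.
  apply/andP; split; last by apply: leS; split; rewrite //= in_itv/= lexx ler01.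
  by apply: lb_le_inf; [case: infS|move=> s [/=]; rewrite in_itv/= => /andP[]].
have below t : 0 <= t < inf S -> f t < r.
  move=> /andP[t0 ts]; rewrite ltNge; apply/negP => rf.
  have /leS : S t by split=> //; rewrite /= in_itv/= t0 (le_trans (ltW ts))//;
    case/andP: s01.
  by rewrite leNgt ts.
have s01' : `[0, 1]%classic (inf S) by rewrite /= in_itv.
have /within_continuousP/(_ _ s01') Hc := fc.
exists (inf S); split=> //; apply/eqP; rewrite eq_le; apply/andP; split; rewrite leNgt;
  apply/negP => lt.
- have e0 : 0 < f (inf S) - r by rewrite subr_gt0.
  have [d d0 Hd] := Hc _ e0.
  have spos : 0 < inf S.
    have /andP[s0 _] := s01; rewrite lt_neqAle s0 andbT; apply/eqP => e.
    by move: lt; rewrite -e ltNge ltW.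
  pose t := Num.max 0 (inf S - d / 2).
  have t0 : 0 <= t by rewrite /t le_max lexx.
  have ts : t < inf S by rewrite /t gt_max spos/= ltrBlDr ltrDl divr_gt0.
  have td : inf S - d / 2 <= t by rewrite /t le_max lexx orbT.
  have t01 : `[0, 1]%classic t.
    by rewrite /= in_itv/= t0 (le_trans (ltW ts))//; case/andP: s01.
  have /Hd : ball (inf S) d t by rewrite /ball/= ger0_norm ?subr_ge0 ?(ltW ts)//; lra.
  move=> /(_ t01); rewrite /ball/= ltr_norml => /andP[_].
  have := below t; rewrite t0 ts => /(_ isT); lra.
- have e0 : 0 < r - f (inf S) by rewrite subr_gt0.
  have [d d0 Hd] := Hc _ e0.
  have [s [s01'' rs] lts] := inf_adherent d0 infS.
  have is' : inf S <= s by apply: leS.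
  have bs : ball (inf S) d s by rewrite /ball/= distrC ger0_norm ?subr_ge0// ltrBlDr
    addrC.
  have := Hd s s01'' bs; rewrite /ball/= ltr_norml => /andP[+ _]; move: rs => /=; lra.
Qed.

Section tree_walk.
Variables (R : realType) (T : metricType R).
Hypothesis arcs : forall x y : T, x != y -> exists! J : set T, jordan_arc R J x y.
Hypothesis cT : compact [set: T].
Variable C : R.
Hypothesis C0 : 0 <= C.
Hypothesis bt : bounded_turning C T.
Variable p : T.

Let seg_l := seg_l arcs.
Let seg_r := seg_r arcs.
Let seg_tri := @seg_tri R T arcs.
Let seg_subl := @seg_subl R T arcs.
Let seg_subr := @seg_subr R T arcs.
Let arcdiamxx := arcdiamxx arcs cT C0 bt.
Let arcdiam_mono := arcdiam_mono arcs cT C0 bt.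
Let arcdiam_tri := arcdiam_tri arcs cT C0 bt.
Let arcdiam_le := arcdiam_le arcs cT C0 bt.

(** The ancestor order of the tree rooted at [p]. *)
Definition tle (x y : T) := seg p y x.

Lemma tle_trans x y z : tle x y -> tle y z -> tle x z.
Proof. by move=> xy yz; exact: seg_subl yz _ xy. Qed.

Lemma tle_anti x y : tle x y -> tle y x -> x = y.
Proof. by move=> xy yx; rewrite (seg_meet arcs xy yx (seg_r _ _)). Qed.

Lemma tle_between x y z : tle x y -> tle y z -> seg x z y.
Proof.
move=> xy yz; have [yx|//] := seg_tri x yz.
by rewrite (tle_anti xy yx); exact: seg_l.
Qed.

Lemma tle_seg x y z : tle x z -> seg x z y -> tle x y /\ tle y z.
Proof.
move=> xz xzy; have yz : tle y z by exact: seg_subr xz _ xzy.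
split=> //; have [//|yx] := seg_comparable arcs xz yz.
by rewrite (seg_meet arcs xz yx xzy); exact: seg_r.
Qed.

Lemma tle_arcdiam a b c d : tle a b -> tle b c -> tle c d -> arcdiam b c <= arcdiam a d.
Proof.
move=> ab bc cd; apply: arcdiam_mono => w bcw.
have acb := tle_between ab bc.
have adc := tle_between (tle_trans ab bc) cd.
exact: seg_subl adc _ (seg_subr acb bcw).
Qed.

Variable r : R.
Hypothesis r0 : 0 < r.

(** The value [arcdiam t] may stay equal to [r] along a stretch of the arc; selecting the first such
    point makes the next node unique. *)
Definition is_next (t z : T) := arcdiam t z = r /\ forall w, seg t z w ->
  arcdiam t w = r -> w = z.

(* Greedy subdivision from the root in steps of [arcdiam] exactly [r]. *)
Fixpoint node (i : nat) (z : T) : Prop :=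
  if i is i'.+1 then exists2 t, node i' t & tle t z /\ is_next t z else z = p.

(** By induction both nodes have the same parent. They lie on one arc from the root, so they are
    comparable, and the later one would not be the first point at arc diameter [r]. *)
Lemma node_uniq i y z z' : node i z -> node i z' -> tle z y -> tle z' y -> z = z'.
Proof.
elim: i z z' => [z z' -> -> //|i IH z z'] [t nt [tz Hz]] [t' nt' [tz' Hz']] zy zy'.
have tt' : t = t' by apply: IH;
  [exact: nt|exact: nt'|exact: tle_trans zy|exact: tle_trans zy'].
subst t'.
have key a b : tle t a -> tle a b -> is_next t a -> is_next t b -> a = b.
  by move=> ta ab [ra _] [_ Hb]; apply: Hb => //; exact: tle_between.
have [zz'|zz'] := seg_comparable arcs zy zy'; first by apply: key.
by symmetry; apply: key.
Qed.

Lemma next_exists t y : tle t y -> r <= arcdiam t y -> exists z, [/\ tle t z,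
  tle z y & is_next t z].
Proof.
move=> ty rty; have [b [bc b0 b1 bE]] := seg_any_param arcs t y.
pose f s := arcdiam t (b s).
have fc : {within `[0, 1], continuous f}.
  apply/within_continuousP => s s01 e e0.
  have K0 := arc_turning_gt0 C0.
  have eK : 0 < e / arc_turning C by rewrite divr_gt0.
  move/within_continuousP : (bc) => /(_ s s01 _ eK)[d d0 Hd]; exists d => // s' s01' ss'.
  have := Hd s' s01' ss'; rewrite ballEmdist/= ltr_pdivlMr// => lt.
  have := arcdiam_le (b s) (b s'); have := arcdiam_le (b s') (b s).
  have := arcdiam_tri t (b s) (b s'); have := arcdiam_tri t (b s') (b s).
  rewrite [mdist (b s') _]metric_sym [arc_turning C * _]mulrC /f /ball/= ltr_norml => *.
  apply/andP; split; lra.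
have [||s [s01 fs Hs]] := first_hit (r := r) fc.
- by rewrite /f b0 arcdiamxx.
- by rewrite /f b1.
have tyz : seg t y (b s) by rewrite -bE; exists s.
have [tz zy] := tle_seg ty tyz.
exists (b s); split=> //; split=> // w; rewrite -{1}b0 => Hw rw.
have [||s' + wE] := seg_subpath arcs (a := 0) (b := s) bc _ _ Hw; rewrite ?lexx ?ler01//.
have /andP[s0 s1] := s01; rewrite min_l ?max_r// => /andP[s'0].
rewrite le_eqVlt => /predU1P[e|ss]; first by rewrite wE e.
by have := Hs s'; rewrite s'0 ss /f -wE rw ltxx => /(_ isT).
Qed.

Definition reached y i := exists2 z, node i z & tle z y.

Definition node_pt y i := xget p [set z | node i z /\ tle z y].

Lemma node_ptP y i : reached y i -> node i (node_pt y i) /\ tle (node_pt y i) y.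
Proof.
move=> [z nz zy]; rewrite /node_pt; case: xgetP => [w _ //|/(_ z)].
by move=> /(_ (conj nz zy)).
Qed.

Lemma node_pt_eq y i z : node i z -> tle z y -> node_pt y i = z.
Proof.
move=> nz zy; have [|n1 t1] := @node_ptP y i; first by exists z.
exact: (node_uniq n1 nz t1 zy).
Qed.

Lemma reachedS y i : reached y i.+1 -> [/\ reached y i,
  tle (node_pt y i) (node_pt y i.+1) &
  is_next (node_pt y i) (node_pt y i.+1)].
Proof.
move=> Hr; have [[t nt [tz nz]] zy] := node_ptP Hr.
have ty := tle_trans tz zy.
rewrite (node_pt_eq nt ty); split=> //; by exists t.
Qed.

Lemma reached_le y i j : (i <= j)%N -> reached y j -> reached y i.
Proof.
move=> ij; rewrite -(subnK ij); elim: (j - i)%N => [//|d IH].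
by rewrite addSn => /reachedS[/IH].
Qed.

Lemma node_pt_le y i j : (i <= j)%N -> reached y j -> tle (node_pt y i) (node_pt y j).
Proof.
move=> ij; rewrite -(subnK ij); elim: (j - i)%N => [|d IH]; first by move=> _;
  exact: seg_r.
by rewrite addSn => /reachedS[/IH h1 h2 _]; exact: tle_trans h2.
Qed.

Lemma node_pt_far y i j : (i < j)%N -> reached y j ->
  r <= arcdiam (node_pt y i) (node_pt y j).
Proof.
move=> ij yj; have [_ _ [<- _]] := reachedS (reached_le ij yj).
apply: tle_arcdiam; [exact: seg_r|exact: node_pt_le (leqnSn i) (reached_le ij yj)|exact:
  node_pt_le].
Qed.

(** Nodes below [y] are pairwise at arc diameter at least [r], hence at distance at least
    [r / arc_turning C], and no two of them share a point of a net of half that radius. *)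
Lemma reached_max y : exists m, reached y m /\ forall j, reached y j -> (j <= m)%N.
Proof.
have K0 := arc_turning_gt0 C0.
have k2 : 0 < 2 * arc_turning C by exact: mulr_gt0.
have e0 : 0 < r / (2 * arc_turning C) by rewrite divr_gt0.
have [s net] := compact_net cT e0.
have /choice[c Hc] : forall x, exists c, c \in s /\ mdist c x < r / (2 * arc_turning C).
  by move=> x; have [c cs cx] := net x; exists c.
have bnd i : reached y i -> (i <= size s)%N.
  move=> yi; have : uniq [seq c (node_pt y j) | j <- iota 0 i].
    rewrite map_inj_in_uniq ?iota_uniq// => j k.
    wlog jk : j k / (j < k)%N.
      move=> H ji ki e; have [jk|kj|//] := ltngtP j k; first exact: H.
      by symmetry; apply: H.
    rewrite !mem_iota !add0n => _ /andP[_ ki] e; exfalso.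
    have := node_pt_far jk (reached_le (ltnW ki) yi).
    have := arcdiam_le (node_pt y j) (node_pt y k).
    have [_] := Hc (node_pt y j); have [_] := Hc (node_pt y k); rewrite -e.
    set z := c _; rewrite !(ltr_pdivlMr _ _ k2).
    have := metric_triangle (node_pt y j) z (node_pt y k);
      rewrite [mdist (node_pt y j) z]metric_sym.
    move=> h1 h2 h3 h4 h5.
    have : arc_turning C * mdist (node_pt y j) (node_pt y k) <=
      arc_turning C * (mdist z (node_pt y j) + mdist z (node_pt y k)) by rewrite ler_pM2l.
    have -> : arc_turning C * (mdist z (node_pt y j) + mdist z (node_pt y k)) =
      (mdist z (node_pt y j) * (2 * arc_turning C) + mdist z (node_pt y k) * (2 *
        arc_turning C)) / 2 by field.
    by move: h2 h3 h4 h5; lra.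
  move=> us; have := uniq_leq_size us (s2 := s); rewrite size_map size_iota; apply.
  by move=> z /mapP[j _ ->]; have [] := Hc (node_pt y j).
have ex : exists i, `[< reached y i >].
  exists 0%N; apply/asboolP; exists p => //; exact: seg_l.
have bnd' i : `[< reached y i >] -> (i <= size s)%N by move/asboolP/bnd.
case: (ex_maxnP ex bnd') => m' /asboolP h1 h2.
by exists m'; split=> // j /asboolP; exact: h2.
Qed.

Definition node_count y := sval (cid (reached_max y)).

Lemma node_count_reached y : reached y (node_count y).
Proof. by rewrite /node_count; case: cid => /= m []. Qed.

Lemma node_count_max y j : reached y j -> (j <= node_count y)%N.
Proof. by rewrite /node_count; case: cid => /= m [_]; apply. Qed.

Lemma node_count_near y : arcdiam (node_pt y (node_count y)) y < r.
Proof.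
rewrite ltNge; apply/negP => rle.
have [nn ny] := node_ptP (node_count_reached y).
have [z [tz zy nz]] := next_exists ny rle.
have /node_count_max : reached y (node_count y).+1 by exists z => //;
  exists (node_pt y (node_count y)).
by rewrite ltnn.
Qed.

Lemma reached_tle x y i : tle x y -> reached x i ->
  reached y i /\ node_pt y i = node_pt x i.
Proof.
move=> xy /node_ptP[nz zx]; have zy := tle_trans zx xy.
by split; [exists (node_pt x i)|exact: node_pt_eq].
Qed.

Lemma node_count_pt y j : (j <= node_count y)%N ->
  node_count (node_pt y j) = j /\ node_pt (node_pt y j) j = node_pt y j.
Proof.
move=> jc; have yj := reached_le jc (node_count_reached y); have [nj ty] := node_ptP yj.
have e : node_pt (node_pt y j) j = node_pt y j by apply: node_pt_eq => //; exact: seg_r.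
split=> //; apply/eqP; rewrite eqn_leq; apply/andP; split; last first.
  by apply: node_count_max; exists (node_pt y j) => //; exact: seg_r.
rewrite leqNgt; apply/negP => lt.
have rc := node_count_reached (node_pt y j).
have := node_pt_far lt rc; rewrite e.
have [_ le2] := node_ptP rc.
have le1 := node_pt_le (ltnW lt) rc; rewrite e in le1.
by rewrite (tle_anti le2 le1) arcdiamxx leNgt r0.
Qed.

(* Frozen after the last node, so that it is defined for all indices. *)
Definition node_dist y i j :=
  arcdiam (node_pt y (minn i (node_count y))) (node_pt y (minn j (node_count y))).

Lemma node_dist_le y i : node_dist y i i.+1 <= r.
Proof.
rewrite /node_dist; have [lt|ge] := ltnP i (node_count y).
  rewrite (minn_idPl lt).
  by have [_ _ [-> _]] := reachedS (reached_le lt (node_count_reached y)).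
rewrite (minn_idPr (leqW ge)).
by rewrite arcdiamxx ltW.
Qed.

Let minr y i : reached y (minn i (node_count y)).
Proof. by apply: reached_le (node_count_reached y); exact: geq_minr. Qed.

Lemma node_dist_mono y i' i j j' : (i' <= i)%N -> (i <= j)%N -> (j <= j')%N ->
  node_dist y i j <= node_dist y i' j'.
Proof.
move=> h1 h2 h3; apply: tle_arcdiam; apply: node_pt_le; rewrite ?minr//.
- by rewrite leq_min geq_minr andbT (leq_trans (geq_minl _ _)).
- by rewrite leq_min geq_minr andbT (leq_trans (geq_minl _ _)).
- by rewrite leq_min geq_minr andbT (leq_trans (geq_minl _ _)).
Qed.

Lemma node_dist_tri y i j k : (i <= j)%N -> (j <= k)%N ->
  node_dist y i k <= node_dist y i j + node_dist y j k.
Proof. by move=> _ _; exact: arcdiam_tri. Qed.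

Variables (big : R) (n : nat).
Hypothesis big_gt0 : 0 < big.
Hypothesis arcdiam_big : forall x y : T, arcdiam x y < big.
Hypothesis rE : r = walk_scale big n.

(** A step function along each branch: its value is that of the walk at the last node before [y].
    This is why the bounds below carry an additive [r]. *)
Definition treewalk y := walk big n (node_dist y) n (node_count y).

Let prof0 y i : node_dist y i i = 0. Proof. exact: arcdiamxx. Qed.
Let node_dist_step y i : node_dist y i i.+1 <= walk_scale big n.
Proof. by rewrite -rE node_dist_le. Qed.
Let wlip y i j : (i <= j)%N ->
  `|walk big n (node_dist y) n j - walk big n (node_dist y) n i| <= 42 * node_dist y i j.
Proof.
move=> ij; apply: (walk_lip big_gt0 (prof0 y) _ (@node_dist_tri y) (node_dist_step y) ij
  (arcdiam_big _ _)).
exact: node_dist_mono.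
Qed.

Lemma treewalk_bound y : `|treewalk y| <= 42 * big.
Proof.
have := wlip y (leq0n (node_count y)).
have -> : walk big n (node_dist y) n 0 = 0.
  by rewrite /walk /wpos/= prof0 mulr0 addr0.
rewrite subr0 => /le_trans; apply; rewrite ler_pM2l//; exact: ltW (arcdiam_big _ _).
Qed.

Let node_pt_sub x y : tle x y -> (node_count x <= node_count y)%N /\
  forall i, (i <= node_count x)%N -> node_pt x i = node_pt y i.
Proof.
move=> xy; split; first by apply: node_count_max;
  have [] := reached_tle xy (node_count_reached x).
by move=> i ix; have [] := reached_tle xy (reached_le ix (node_count_reached x)).
Qed.

(** By [walk_local], the walk towards [y] has passed through the value at [x]; values at comparable
    points can thus be read off one walk. *)
Let treewalk_sub x y : tle x y -> treewalk x = walk big n (node_dist y) n (node_count x).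
Proof.
move=> xy; have [cxy pE] := node_pt_sub xy.
apply: walk_local => i j ij jx; have ix := leq_trans ij jx.
rewrite /node_dist !(minn_idPl _) ?(leq_trans jx)// ?(leq_trans ix)//.
by rewrite !pE.
Qed.

Let node_pt_tle x : tle (node_pt x (node_count x)) x.
Proof. by have [] := node_ptP (node_count_reached x). Qed.

Let profE x y : tle x y -> node_dist y (node_count x) (node_count y) = arcdiam (node_pt
  x (node_count x)) (node_pt y (node_count y)).
Proof.
by move=> xy; have [cxy pE] := node_pt_sub xy;
  rewrite /node_dist minnn (minn_idPl cxy) pE.
Qed.

Lemma treewalk_lip x y : tle x y -> `|treewalk y - treewalk x| <= 42 * (arcdiam x y + r).
Proof.
move=> xy; have [cxy pE] := node_pt_sub xy.
rewrite (treewalk_sub xy) (le_trans (wlip y cxy))// ler_pM2l// profE//.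
have h1 : arcdiam (node_pt x (node_count x)) (node_pt y (node_count y)) <= arcdiam
  (node_pt x (node_count x)) y.
  apply: tle_arcdiam; [exact: seg_r| |exact: node_pt_tle].
  by rewrite pE//; apply: node_pt_le cxy _; exact: node_count_reached.
have := arcdiam_tri (node_pt x (node_count x)) x y; have := node_count_near x; lra.
Qed.

(** Passing to the last nodes loses at most [r]. More than 7 [r] leaves over 5 [r] for [walk_light],
    and more than half of [arcdiam x y], which turns 800 into 1600. *)
Lemma treewalk_light x y : tle x y -> 7 * r < arcdiam x y ->
  exists a b, [/\ seg x y a,
    seg x y b & arcdiam x y / 1600 <= `|treewalk b - treewalk a|].
Proof.
move=> xy rxy; have [cxy pE] := node_pt_sub xy.
have px : tle (node_pt x (node_count x)) x by exact: node_pt_tle.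
have h1 : arcdiam x y <= arcdiam (node_pt x (node_count x)) y by apply: tle_arcdiam =>
  //; exact: seg_r.
have h2 := arcdiam_tri (node_pt x (node_count x)) (node_pt y (node_count y)) y.
have h3 := node_count_near y.
have h4 : 5 * walk_scale big n < node_dist y (node_count x) (node_count y).
  rewrite -rE profE//; move: rxy h1 h2 h3 r0.
  by set A := arcdiam x y; set B := arcdiam _ y; set D := arcdiam _ _;
    set E := arcdiam _ _; lra.
have [b [c [xb bc cy osc]]] := walk_light big_gt0 (prof0 y) (@node_dist_mono y)
  (@node_dist_tri y) (node_dist_step y) cxy (arcdiam_big _ _) h4.
(* The last node of [x] may lie before [x], off the arc from [x] to [y]; there [x] replaces it,
   having the same value. *)
have key i : (node_count x <= i)%N -> (i <= node_count y)%N ->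
    exists2 a, seg x y a & treewalk a = walk big n (node_dist y) n i.
  rewrite leq_eqVlt => /predU1P[<- _|xi iy].
    by exists x; [exact: seg_l|exact: treewalk_sub].
  have yi := reached_le iy (node_count_reached y); have [ni ty] := node_ptP yi.
  have [ci _] := node_count_pt iy.
  exists (node_pt y i); last by rewrite (treewalk_sub ty) ci.
  apply: (tle_between _ ty); have [//|tx] := seg_comparable arcs xy ty.
  have /node_count_max : reached x i by exists (node_pt y i).
  by rewrite leqNgt xi.
have [b' sb wb] := key b xb (leq_trans bc cy).
have [c' sc wc] := key c (leq_trans xb bc) cy.
exists b', c'; split=> //; rewrite wb wc; apply: le_trans osc.
rewrite profE//; move: rxy h1 h2 h3 r0.
by set A := arcdiam x y; set B := arcdiam _ y; set D := arcdiam _ _;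
  set E := arcdiam _ _; lra.
Qed.

End tree_walk.

Lemma filter_seq (S : choiceType) (I : Type) (U : set_system I) {FU : Filter U}
    (s : seq S) (P : S -> set I) :
  (forall c, U (P c)) -> U [set n | forall c, c \in s -> P c n].
Proof.
move=> UP; elim: s => [|c s IH].
  by apply: filterS filterT => n _ c; rewrite in_nil.
apply: filterS (filterI (UP c) IH) => n [Pc Ps] d.
by rewrite inE => /predU1P[->//|]; exact: Ps.
Qed.

Section tree_light.
Variables (R : realType) (T : metricType R).
Hypothesis arcs : forall x y : T, x != y -> exists! J : set T, jordan_arc R J x y.
Hypothesis cT : compact [set: T].
Variable C : R.
Hypothesis C0 : 0 <= C.
Hypothesis bt : bounded_turning C T.
Variable p : T.

Let K0 := arc_turning_gt0 C0.

Let bigex : exists2 big : R, 0 < big & forall x y : T, arcdiam x y < big.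
Proof.
have [s net] := compact_net cT (@ltr01 R).
pose B : R := \sum_(c <- s) mdist p c + 1.
have pB x : mdist p x <= B.
  have [c cs cx] := net x; have := metric_triangle p c x.
  have : mdist p c <= \sum_(c <- s) mdist p c.
    by rewrite (big_rem c)//= lerDl sumr_ge0// => i _; exact: mdist_ge0.
  by rewrite /B; lra.
have B0 : 0 <= B by exact: le_trans (mdist_ge0 p p) (pB p).
exists (arc_turning C * (2 * B) + 1).
  by rewrite ltr_wpDl// mulr_ge0 ?(ltW K0)// mulr_ge0.
move=> x y; apply: le_lt_trans (arcdiam_le arcs cT C0 bt x y) _.
rewrite ltr_pwDr// ler_pM2l//; have := metric_triangle x p y.
have := pB x; have := pB y; rewrite [mdist x p]metric_sym; lra.
Qed.

Let lev_small (big e : R) : 0 < big -> 0 < e -> \forall n \near \oo, walk_scale big n < e.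
Proof.
move=> b0 e0; exists (Num.truncn (big / e)).+1 => //= n Hn.
rewrite /walk_scale ltr_pdivrMr ?exprn_gt0// mulrC -ltr_pdivrMr//.
apply: (@lt_trans _ _ n%:R); last by rewrite -natrX ltr_nat ltn_expl.
apply: (lt_le_trans (truncnS_gt _)); by rewrite ler_nat.
Qed.

(* The subdivisions of different finest scales [n] are unrelated, so the walks
   need not converge; their limit is taken along an ultrafilter. *)
Lemma tree_walk_limit : exists f : T -> R,
  (forall x y, tle p x y -> `|f y - f x| <= 42 * arcdiam x y) /\
  (forall x y, tle p x y -> exists a b,
     [/\ seg x y a, seg x y b & arcdiam x y / 3200 <= `|f b - f a|]).
Proof.
have [big big0 arcdiam_big] := bigex.
have levp n : 0 < walk_scale big n by exact: walk_scale_gt0.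
have /choice[F HF] : forall n, exists g : T -> R, [/\ (forall y, `|g y| <= 42 * big),
    (forall x y, tle p x y -> `|g y - g x| <= 42 * (arcdiam x y + walk_scale big n)) &
    (forall x y, tle p x y -> 7 * walk_scale big n < arcdiam x y -> exists a b,
     [/\ seg x y a, seg x y b & arcdiam x y / 1600 <= `|g b - g a|])].
  move=> n; exists (treewalk arcs cT C0 bt p (levp n) big n); split.
  - by move=> y; apply: treewalk_bound.
  - by move=> x y; apply: treewalk_lip.
  - by move=> x y; apply: treewalk_light.
have [U [UU ooU]] := ultraFilterLemma (eventually_filter : ProperFilter \oo).
have FU : Filter U by exact: filter_filter.
have /choice[f Hf] : forall x, exists l : R, F^~ x @ U --> l.
  move=> x; have UI : fmap (F^~ x) U `[- (42 * big), 42 * big]%classic.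
    apply: (@filterE _ U) => n; rewrite /= in_itv/= -ler_norml.
    by have [] := HF n.
  have [l [_ cl]] := @segment_compact R (- (42 * big)) (42 * big) (fmap (F^~ x) U) _ UI.
  exists l => B Bl; have [//|nB] := in_ultra_setVsetC (F^~ x @^-1` B) UU.
  by have [q [nq Bq]] := cl (~` B) B nB Bl.
have Uf x e : 0 < e -> U [set n | `|f x - F n x| < e].
  by move=> e0; have /cvgrPdist_lt/(_ e e0) := Hf x.
have Ul e : 0 < e -> U [set n | walk_scale big n < e].
  by move=> e0; apply: ooU; exact: lev_small.
have Uex A : U A -> exists n, A n by move=> UA; exact: filter_ex UA.
have lipf x y : tle p x y -> `|f y - f x| <= 42 * arcdiam x y.
  move=> xy; apply/ler_addgt0Pl => e e0.
  have e1 : 0 < e / 100 by lra.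
  have [n [[/= n1 n2] n3]] := Uex _ (filterI (filterI (Uf x _ e1) (Uf y _ e1)) (Ul _ e1)).
  have [_ /(_ x y xy) + _] := HF n; move: n1 n2 n3.
  rewrite !ltr_norml !ler_norml; move: (arcdiam x y) => D; lra.
have lip2 x y : `|f y - f x| <= 84 * arc_turning C * mdist x y.
  have [m [px py xy]] := seg_median arcs p x y.
  have h1 : arcdiam m x <= arcdiam x y.
    apply: (arcdiam_mono arcs cT C0 bt); rewrite seg_sym//; exact: seg_subl.
  have h2 : arcdiam m y <= arcdiam x y.
    by apply: (arcdiam_mono arcs cT C0 bt); exact: seg_subr.
  have h3 := arcdiam_le arcs cT C0 bt x y.
  have := lipf m x px; have := lipf m y py; rewrite !ler_norml -mulrA.
  by move: h1 h2 h3; move: (arcdiam m x) (arcdiam m y) (arcdiam x y) (arc_turning C * _)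
    => *; lra.
(* The points where [F n] oscillates depend on [n], so pointwise limits do not suffice. Closeness on
   a finite net, at one index, spreads to all points because [F n] is Lipschitz up to a multiple of
   [walk_scale big n]. *)
have unif e : 0 < e -> exists2 n, walk_scale big n < e & forall a, `|f a - F n a| <= e.
  move=> e0; have e1 : 0 < e / 1000 by lra.
  have eta0 : 0 < e / 1000 / arc_turning C by exact: divr_gt0.
  have [s net] := compact_net cT eta0.
  have [n [/= n1 n2]] := Uex _ (filterI (Ul _ e1) (filter_seq s (fun c => Uf c _ e1))).
  exists n; first by apply: lt_trans n1 _; lra.
  move=> a; have [c cs ca] := net a.
  have tc : arc_turning C * mdist c a < e / 1000 by rewrite mulrC -ltr_pdivlMr.
  have [m [pc pa ca']] := seg_median arcs p c a.
  have h1 : arcdiam m c <= arcdiam c a.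
    apply: (arcdiam_mono arcs cT C0 bt); rewrite seg_sym//; exact: seg_subl.
  have h2 : arcdiam m a <= arcdiam c a.
    by apply: (arcdiam_mono arcs cT C0 bt); exact: seg_subr.
  have h3 := arcdiam_le arcs cT C0 bt c a.
  have [_ Fl _] := HF n; have d1 := Fl m c pc; have d2 := Fl m a pa.
  have d3 := lip2 c a; rewrite -mulrA in d3; have d4 := n2 c cs.
  have : `|f a - F n a| <= `|f a - f c| + `|f c - F n c| + `|F n c - F n m| + `|F n a -
    F n m|.
    rewrite [`|F n a - _|]distrC.
    have -> : f a - F n a = (f a - f c) + (f c - F n c) + (F n c - F n m) + (F n m - F n
      a) by ring.
    by rewrite !(le_trans (ler_normD _ _))// !lerD// (le_trans (ler_normD _ _))// lerD//
      ler_normD.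
  move: h1 h2 h3 tc n1 d1 d2 d3 d4.
  move: (arcdiam m c) (arcdiam m a) (arcdiam c a) (arc_turning C * _) (walk_scale big n).
  move: `|f a - F n a| `|f a - f c| `|f c - F n c| `|F n c - F n m| `|F n a - F n m| =>
    *; lra.
exists f; split=> // x y xy.
have [xy0|] := eqVneq (arcdiam x y) 0.
  exists x, x; rewrite subrr normr0 xy0 mul0r.
  by split=> //; exact: seg_l.
move=> ne; have D0 : 0 < arcdiam x y by rewrite lt_def ne (arcdiam_ge0 arcs cT C0 bt).
have e0 : 0 < arcdiam x y / 10000 by lra.
have [n n1 n2] := unif _ e0.
have [_ _ /(_ x y xy)[|a [b [sa sb osc]]]] := HF n.
  by move: n1 D0; move: (arcdiam x y) (walk_scale big n) => *; lra.
exists a, b; split=> //.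
have := n2 a; have := n2 b; rewrite !ler_norml.
have : `|F n b - F n a| <= `|f b - f a| + `|f b - F n b| + `|f a - F n a|.
  have -> : F n b - F n a = (f b - f a) - (f b - F n b) + (f a - F n a) by ring.
  by rewrite (le_trans (ler_normD _ _))// lerD2r (le_trans (ler_normB _ _)).
have := n2 a; have := n2 b; move: osc D0.
move: (arcdiam x y) `|F n b - F n a| `|f b - f a| `|f b - F n b| `|f a - F n a| => *; lra.
Qed.

(** The median splits an arc into two branches on which the root order is total. Both branches enter
    the Lipschitz constant, 84 = 2 * 42, and the longer one has at least half the arc diameter,
    which gives 6400 = 2 * 3200. *)
Lemma tree_light : exists f : T -> R, exists L c : R, [/\ 0 < L, 0 < c,
  forall x y, `|f x - f y| <= L * mdist x y &
  forall x y, exists a b, [/\ seg x y a, seg x y b & c * mdist x y <= `|f b - f a|]].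
Proof.
have [f [lipf light]] := tree_walk_limit.
exists f, (84 * arc_turning C), (1 / 6400); split.
- by rewrite mulr_gt0// ltr0n.
- lra.
- move=> x y; have [m [px py xy]] := seg_median arcs p x y.
  have h1 : arcdiam m x <= arcdiam x y.
    apply: (arcdiam_mono arcs cT C0 bt); rewrite seg_sym//; exact: seg_subl.
  have h2 : arcdiam m y <= arcdiam x y.
    by apply: (arcdiam_mono arcs cT C0 bt); exact: seg_subr.
  have h3 := arcdiam_le arcs cT C0 bt x y.
  have := lipf m x px; have := lipf m y py; rewrite !ler_norml -mulrA.
  by move: h1 h2 h3; move: (arcdiam m x) (arcdiam m y) (arcdiam x y) (arc_turning C * _)
    => *; lra.
- move=> x y; have [m [px py xy]] := seg_median arcs p x y.
  have h1 := mdist_le_rho arcs cT C0 bt x y.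
  have h2 := arcdiam_tri arcs cT C0 bt x m y.
  rewrite [arcdiam x m]arcdiam_sym// in h2.
  have [mx|ym] := leP (arcdiam m y) (arcdiam m x).
    have [a [b [sa sb osc]]] := light m x px.
    have sub z : seg m x z -> seg x y z by rewrite seg_sym//; exact: seg_subl.
    exists a, b; split; [exact: sub|exact: sub|].
    move: h1 h2 mx osc.
    by move: (arcdiam m x) (arcdiam m y) (arcdiam x y) (mdist x y) `|f b - f a| => *; lra.
  have [a [b [sa sb osc]]] := light m y py.
  have sub z : seg m y z -> seg x y z by exact: seg_subr.
  exists a, b; split; [exact: sub|exact: sub|].
  move: h1 h2 ym osc.
  by move: (arcdiam m x) (arcdiam m y) (arcdiam x y) (mdist x y) `|f b - f a| => *; lra.
Qed.

End tree_light.

(** * Folding the line *)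

Lemma inf_image_le (R : realType) (I : Type) (S : set I) (f g : I -> R) (e : R) :
  S !=set0 -> has_lbound (f @` S) -> (forall i, S i -> f i <= g i + e) ->
  inf (f @` S) <= inf (g @` S) + e.
Proof.
move=> [i0 Si0] lb H; rewrite -lerBlDr; apply: lb_le_inf; first by exists (g i0), i0.
move=> _ [i Si <-]; rewrite lerBlDr (le_trans _ (H i Si))//.
by apply: ge_inf => //; exists i.
Qed.

Section chain_of_reals.
Variable R : realType.

Lemma bool_switch (P : nat -> bool) N i j : (i <= N)%N -> (j <= N)%N -> P i != P j ->
  exists2 k, (k < N)%N & P k != P k.+1.
Proof.
move=> iN jN Pij; apply: contrapT => nex.
have cst k : (k <= N)%N -> P k = P 0%N.
  elim: k => [//|k IH kN]; rewrite -IH 1?ltnW//.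
  apply/eqP; rewrite eq_sym; apply: contrapT => /negP ne; apply: nex; by exists k.
by move: Pij; rewrite !cst// eqxx.
Qed.

(** One fold of the line at [c]. If both values are on the same side, nothing is lost; otherwise the
    sequence passes within [e] of [c], and one of the two values is at least [l / 2] away from
    it. *)
Lemma abs_osc (v : nat -> R) (c e l : R) N i j : 0 <= e -> (i <= N)%N -> (j <= N)%N ->
  (forall k, (k < N)%N -> `|v k - v k.+1| <= e) -> l <= `|v i - v j| ->
  exists i' j', [/\ (i' <= N)%N, (j' <= N)%N &
    l / 2 - e <= `| `|v i' - c| - `|v j' - c| |].
Proof.
move=> e0 iN jN step lij.
have [l0|l0] := leP l 0.
  by exists i, i; split=> //; rewrite subrr normr0; lra.
have [same|diff] := eqVneq (v i <= c) (v j <= c).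
  exists i, j; split=> //.
  have -> : `| `|v i - c| - `|v j - c| | = `|v i - v j|.
    have [ic|ci] := leP (v i) c; have [jc|cj] := leP (v j) c.
    - rewrite (ler0_norm (_ : v i - c <= 0)) ?subr_le0//.
      rewrite (ler0_norm (_ : v j - c <= 0)) ?subr_le0// -normrN; congr `|_|; ring.
    - by move: same; rewrite ic leNgt cj.
    - by move: same; rewrite jc leNgt ci.
    - rewrite (gtr0_norm (_ : 0 < v i - c)) ?subr_gt0//.
      rewrite (gtr0_norm (_ : 0 < v j - c)) ?subr_gt0//; congr `|_|; ring.
  lra.
have [k kN Pk] := bool_switch (P := fun k => v k <= c) iN jN diff.
have near : `|v k - c| <= e.
  have := step k kN; move: Pk; rewrite ler_norml => Pk /andP[h1 h2].
  rewrite ler_norml; case: (leP (v k) c) Pk => h3; case: (leP (v k.+1) c) => // h4 _;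
    apply/andP; split; lra.
have tri : `|v i - v j| <= `|v i - c| + `|v j - c|.
  by rewrite [`|v j - c|]distrC (le_trans _ (ler_normD _ _))// addrA subrK.
have [big|big] := leP (l / 2) `|v i - c|.
  exists i, k; split=> //; first exact: ltnW.
  by apply: le_trans (ler_norm _); lra.
exists j, k; split=> //; first exact: ltnW.
by apply: le_trans (ler_norm _); lra.
Qed.
End chain_of_reals.

Section fold.
Variable R : realType.
Implicit Types (t s a b : R).

(** An integer power of 2, possibly with negative exponent; not a general dyadic rational. *)
Definition dyadic a := exists i j : nat, a = 2 ^+ i / 2 ^+ j.

Lemma dyadic_gt0 a : dyadic a -> 0 < a.
Proof. by move=> [i [j ->]]; rewrite divr_gt0 ?exprn_gt0. Qed.

Let p2 k : (2 : R) ^+ k != 0. Proof. by rewrite expf_neq0// pnatr_eq0. Qed.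

Lemma dyadic_half a : dyadic a -> dyadic (a / 2).
Proof.
by move=> [i [j ->]]; exists i, j.+1; rewrite exprS; have := p2 j => ?; field.
Qed.

Lemma dyadic_cmp a b : dyadic a -> dyadic b ->
  (exists k, b = a * 2 ^+ k) \/ (exists k, b = a / 2 ^+ k.+1).
Proof.
move=> [i [j ->]] [i' [j' ->]].
have [le|lt] := leqP (i + j') (i' + j).
  left; exists (i' + j - (i + j'))%N; apply/eqP.
  rewrite mulrAC eqr_div// -mulrA -!exprD; apply/eqP; congr (_ ^+ _); lia.
right; exists (i + j' - (i' + j)).-1; rewrite prednK ?subn_gt0//.
apply/eqP; rewrite -mulrA -invfM -exprD eqr_div// -!exprD; apply/eqP; congr (_ ^+ _); lia.
Qed.

Lemma dyadic_scale s : 0 < s -> exists2 a, dyadic a & s <= a < 2 * s.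
Proof.
move=> s0; pose M := (Num.truncn s^-1).+1.
have sM : (2 ^+ M)^-1 < s.
  rewrite invf_plt ?posrE ?exprn_gt0//; apply: lt_trans (truncnS_gt _) _.
  by rewrite -natrX ltr_nat ltn_expl.
have ex : exists j, s <= 2 ^+ j / 2 ^+ M.
  exists (M + (Num.truncn s).+1)%N; rewrite exprD mulrAC divff// mul1r ltW//.
  by apply: lt_trans (truncnS_gt _) _; rewrite -natrX ltr_nat ltn_expl.
case: (ex_minnP ex) => -[|j] sj jmin.
  by move: sj; rewrite expr0 div1r leNgt sM.
exists (2 ^+ j.+1 / 2 ^+ M); first by exists j.+1, M.
rewrite sj /= exprS -mulrA ltr_pM2l// ltNge; apply/negP => /jmin.
by rewrite ltnn.
Qed.

(* [fold t s] is a lower envelope of unit cones centred at all dyadic points.  Those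
   of spacing [a < s] are lifted by [2 * (s - a)], so that as a function of [t] it is
   a zigzag of amplitude about [s], which moves continuously with [s]. *)
Definition cone t s (z : R * int) := `|t - z.2%:~R * z.1| + 2 * Num.max 0 (s - z.1).

Definition fold t s := inf [set cone t s z | z in [set z | dyadic z.1]].

Let cone_ge0 t s z : 0 <= cone t s z.
Proof. by rewrite addr_ge0// mulr_ge0// le_max lexx. Qed.

Let dyadic1 : dyadic 1. Proof. by exists 0%N, 0%N; rewrite divr1. Qed.

Let has_lb t s : has_lbound [set cone t s z | z in [set z | dyadic z.1]].
Proof. by exists 0 => _ [z _ <-]. Qed.

Lemma fold_ge0 t s : 0 <= fold t s.
Proof. by apply: lb_le_inf => [|_ [z _ <-]//]; exists (cone t s (1, 0)), (1, 0). Qed.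

Lemma fold_cone t s z : dyadic z.1 -> fold t s <= cone t s z.
Proof. by move=> dz; apply: ge_inf => //; exists z. Qed.

Lemma fold_le t s e : (forall z, dyadic z.1 -> e <= cone t s z) -> e <= fold t s.
Proof.
move=> H; apply: lb_le_inf => [|_ [z dz <-]]; last exact: H.
by exists (cone t s (1, 0)), (1, 0).
Qed.

Lemma fold_lipl t t' s : `|fold t s - fold t' s| <= `|t - t'|.
Proof.
have key x y : fold x s <= fold y s + `|x - y|.
  apply: inf_image_le => //; first by exists (1, 0).
  move=> z _; rewrite /cone addrAC lerD2r.
  have -> : x - z.2%:~R * z.1 = (y - z.2%:~R * z.1) + (x - y) by ring.
  exact: ler_normD.
have := key t t'; have := key t' t; rewrite [`|t' - t|]distrC ler_norml.
by move=> *; apply/andP; split; lra.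
Qed.

Lemma fold_lipr t s s' : `|fold t s - fold t s'| <= 2 * `|s - s'|.
Proof.
have key x y : fold t x <= fold t y + 2 * `|x - y|.
  apply: inf_image_le => //; first by exists (1, 0).
  move=> z _; rewrite /cone -addrA lerD2l -mulrDr ler_pM2l// ge_max.
  apply/andP; split; first by rewrite addr_ge0// le_max lexx.
  have -> : x - z.1 = (y - z.1) + (x - y) by ring.
  by rewrite lerD ?ler_norm// le_max lexx orbT.
have := key s s'; have := key s' s; rewrite [`|s' - s|]distrC ler_norml.
by move=> *; apply/andP; split; lra.
Qed.

Let floor_mul t a : 0 < a -> exists m : int, m%:~R * a <= t < m%:~R * a + a.
Proof.
move=> a0; exists (Num.floor (t / a)).
rewrite -ler_pdivlMr// floor_le_tmp /=.
have := floorD1_gt (t / a); rewrite intrD ltr_pdivrMr// => /lt_le_trans; apply.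
by rewrite mulrDl mul1r.
Qed.

(** Cones with a spacing between [s] and [2 * s] are not lifted, and the nearest centre is within
    half the spacing. The case [s = 0] follows by continuity in [s]. *)
Lemma fold_le_scale t s : 0 <= s -> fold t s <= s.
Proof.
have pos x : 0 < x -> fold t x <= x.
  move=> x0; have [a da /andP[xa ax]] := dyadic_scale x0.
  have a0 := dyadic_gt0 da; have [m /andP[m1 m2]] := floor_mul t a0.
  have pen : Num.max 0 (x - a) = 0 by apply/max_idPl; rewrite subr_le0.
  have [h|h] := leP (t - m%:~R * a) (a / 2).
    apply: le_trans (@fold_cone t x (a, m) da) _; rewrite /cone/= pen mulr0 addr0.
    by rewrite ger0_norm ?subr_ge0//; lra.
  apply: le_trans (@fold_cone t x (a, m + 1) da) _; rewrite /cone/= pen mulr0 addr0.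
  by rewrite intrD mulrDl mul1r ler_norml; apply/andP; split; lra.
rewrite le_eqVlt => /predU1P[<-|]; last exact: pos.
apply/ler_addgt0Pl => e e0; rewrite addr0.
have e3 : 0 < e / 3 by rewrite divr_gt0.
have := pos _ e3; have := fold_lipr t 0 (e / 3).
rewrite sub0r normrN (gtr0_norm e3) ler_norml => /andP[_]; lra.
Qed.

Section evaluation.
Variables (s a : R) (m : int).
Hypothesis s0 : 0 < s.
Hypothesis da : dyadic a.
Hypothesis sa : s <= a < 2 * s.

Let a0 := dyadic_gt0 da.
Let c := m%:~R * a + a / 2.

(** On a cell only the unlifted cones at its ends and the cone at its midpoint, lifted by
    [2 * s - a], matter: coarser centres are multiples of [a], and finer cones are lifted too high.
    The minimum is written with nested absolute values so that [abs_osc] can be applied twice. *)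
Lemma fold_eval t : m%:~R * a <= t <= m%:~R * a + a ->
  fold t s = (a / 2 + (2 * s - a)) / 2 - `| `|t - c| - (a / 2 - (2 * s - a)) / 2 |.
Proof.
move=> /andP[t1 t2]; have /andP[s1 s2] := sa.
set w := 2 * s - a; have w0 : 0 < w by rewrite subr_gt0.
set y := `|t - c|; have y2 : y <= a / 2.
  by rewrite /y /c ler_norml; apply/andP; split; lra.
have y0 : 0 <= y by exact: normr_ge0.
have yE : (t - m%:~R * a = a / 2 - y /\ y <= m%:~R * a + a - t) \/
    (m%:~R * a + a - t = a / 2 - y /\ y <= t - m%:~R * a).
  have [tc|ct] := leP t c.
    by left; rewrite /y ler0_norm ?subr_le0// /c; move: tc; rewrite /c; split; lra.
  by right; rewrite /y gtr0_norm ?subr_gt0// /c; move: ct; rewrite /c; split; lra.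
have -> : (a / 2 + w) / 2 - `|y - (a / 2 - w) / 2| = Num.min (a / 2 - y) (y + w).
  have [h|h] := leP (a / 2 - y) (y + w).
    by rewrite ger0_norm; lra.
  by rewrite ler0_norm; lra.
apply/eqP; rewrite eq_le; apply/andP; split.
  rewrite le_min; apply/andP; split.
    have pen : Num.max 0 (s - a) = 0 by apply/max_idPl; rewrite subr_le0.
    case: yE => -[yE _].
      apply: le_trans (@fold_cone t s (a, m) da) _; rewrite /cone/= pen mulr0 addr0.
      by rewrite ger0_norm ?subr_ge0// yE.
    apply: le_trans (@fold_cone t s (a, m + 1) da) _; rewrite /cone/= pen mulr0 addr0.
    by rewrite intrD mulrDl mul1r distrC ger0_norm ?subr_ge0// yE.
  apply: le_trans (@fold_cone t s (a / 2, 2 * m + 1) (dyadic_half da)) _.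
  rewrite /cone/= intrD intrM.
  have -> : t - (2%:~R * m%:~R + 1%:~R) * (a / 2) = t - c by rewrite /c; field.
  rewrite lerD2l (max_idPr _) ?subr_ge0 /w; lra.
apply: fold_le => -[b k] /= db; rewrite /cone/=.
have far (z : int) : Num.min (a / 2 - y) (y + w) <= `|t - z%:~R * a|.
  rewrite ge_min; apply/orP; left.
  have [zm|mz] := leP z m.
    have : z%:~R * a <= m%:~R * a by rewrite ler_pM2r// ler_int.
    move=> h; apply: le_trans (ler_norm _); case: yE; lra.
  have : (m + 1)%:~R * a <= z%:~R * a by rewrite ler_pM2r// ler_int lezD1.
  rewrite intrD mulrDl mul1r distrC => h; apply: le_trans (ler_norm _); case: yE; lra.
have pen0 : 0 <= 2 * Num.max 0 (s - b) by rewrite mulr_ge0// le_max lexx.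
have [[j ->]|[j bE]] := dyadic_cmp da db.
  have -> : k%:~R * (a * 2 ^+ j) = (k * 2 ^+ j)%:~R * a.
    by rewrite intrM rmorphXn/= mulrCA mulrC.
  by apply: le_trans (far (k * 2 ^+ j)) _; rewrite lerDl mulr_ge0// le_max lexx.
case: j bE => [|j] bE; last first.
  have b4 : b <= a / 4.
    rewrite bE ler_pM2l// lef_pV2 ?posrE ?exprn_gt0//.
    have -> : (4 : R) = 2 ^+ 2 by rewrite -natrX.
    by rewrite ler_weXn2l// ler1n.
  apply: (@le_trans _ _ (2 * (s - b))); first by rewrite ge_min; apply/orP; left;
    move: w0; rewrite /w; lra.
  apply: (@le_trans _ _ (2 * Num.max 0 (s - b)));
    first by rewrite ler_pM2l// le_max lexx orbT.
  by rewrite lerDr.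
have bE' : b = a / 2 by rewrite bE expr1.
have [km|mk] := leP k (2 * m).
  have : k%:~R * b <= (2 * m)%:~R * b by rewrite ler_pM2r ?(dyadic_gt0 db)// ler_int.
  rewrite intrM bE' => h; rewrite ge_min; apply/orP; left.
  have : `|t - k%:~R * (a / 2)| >= t - m%:~R * a.
    by apply: le_trans (ler_norm _); move: h;
      have -> : 2%:~R * m%:~R * (a / 2) = m%:~R * a by [field]; lra.
  by move: pen0; rewrite bE'; case: yE; lra.
have [km|mk'] := leP (2 * m + 2) k.
  have : (2 * m + 2)%:~R * b <= k%:~R * b by rewrite ler_pM2r ?(dyadic_gt0 db)// ler_int.
  rewrite intrD intrM bE' => h; rewrite ge_min; apply/orP; left.
  have : `|t - k%:~R * (a / 2)| >= m%:~R * a + a - t.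
    rewrite distrC; apply: le_trans (ler_norm _); move: h.
    by have -> : (2%:~R * m%:~R + 2%:~R) * (a / 2) = m%:~R * a + a by [field]; lra.
  by move: pen0; rewrite bE'; case: yE; lra.
have -> : k = 2 * m + 1 by move: mk mk'; clear; lia.
rewrite intrD intrM bE'.
have -> : t - (2%:~R * m%:~R + 1%:~R) * (a / 2) = t - c by rewrite /c; field.
rewrite ge_min; apply/orP; right; rewrite lerD2l (max_idPr _) ?subr_ge0 /w; lra.
Qed.

Lemma fold_near t : `|t - m%:~R * a| <= a / 8 -> m%:~R * a <= t ->
  fold t s = `|t - m%:~R * a|.
Proof.
move=> + mt; rewrite ger0_norm ?subr_ge0// => ta.
rewrite fold_eval; last by apply/andP; split=> //; lra.
have /andP[s1 s2] := sa.
rewrite (ler0_norm (_ : t - c <= 0)); last by rewrite /c; lra.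
by rewrite ger0_norm /c; lra.
Qed.
End evaluation.

Lemma fold_near_left (s a : R) (m : int) t : 0 < s -> dyadic a -> s <= a < 2 * s ->
  `|t - m%:~R * a| <= a / 8 -> t <= m%:~R * a -> fold t s = `|t - m%:~R * a|.
Proof.
move=> s0 da sa + mt; rewrite ler0_norm ?subr_le0// => ta.
have a0 := dyadic_gt0 da; have /andP[s1 s2] := sa.
have e : (m - 1)%:~R * a = m%:~R * a - a by rewrite intrB mulrBl mul1r.
rewrite (@fold_eval s a (m - 1)) ?e//; last by apply/andP; split; lra.
rewrite (gtr0_norm (_ : 0 < t - (m%:~R * a - a + a / 2))); last by lra.
by rewrite ger0_norm; lra.
Qed.

(** Values within [s / 8] of each other either straddle a multiple of [a], near which the zigzag is
    one fold, or stay in one cell, where it is two folds. Each fold halves the oscillation and costs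
    [e]. *)
Lemma fold_osc (v : nat -> R) (s e l : R) N i j : 0 < s -> 0 <= e ->
  (i <= N)%N -> (j <= N)%N ->
  (forall k, (k < N)%N -> `|v k - v k.+1| <= e) ->
  (forall k k', (k <= N)%N -> (k' <= N)%N -> `|v k - v k'| <= s / 8) ->
  l <= `|v i - v j| ->
  exists i' j', [/\ (i' <= N)%N,
    (j' <= N)%N & l / 4 - 2 * e <= `|fold (v i') s - fold (v j') s|].
Proof.
move=> s0 e0 iN jN step win lij.
have [a da sa] := dyadic_scale s0; have /andP[s1 s2] := sa.
have a0 := dyadic_gt0 da; have [m /andP[m1 m2]] := floor_mul (v 0%N) a0.
have [l0|l0] := leP l 0; first by exists i, i; rewrite subrr normr0; split=> //; lra.
have straddle (z : int) : (forall k, (k <= N)%N -> `|v k - z%:~R * a| <= a / 8) ->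
    exists i' j', [/\ (i' <= N)%N,
      (j' <= N)%N & l / 4 - 2 * e <= `|fold (v i') s - fold (v j') s|].
  move=> H; have FE k : (k <= N)%N -> fold (v k) s = `|v k - z%:~R * a|.
    move=> kN; have [h|/ltW h] := leP (z%:~R * a) (v k).
      exact: fold_near (H k kN) h.
    exact: fold_near_left (H k kN) h.
  have [i' [j' [i'N j'N osc]]] := abs_osc (z%:~R * a) e0 iN jN step lij.
  by exists i', j'; split=> //; rewrite !FE//; lra.
have [[k [kN vk]]|nlow] := pselect (exists k, (k <= N)%N /\ v k < m%:~R * a).
  apply: (straddle m) => q qN; have := win q k qN kN; have := win 0%N q (leq0n _) qN.
  by rewrite !ler_norml => /andP[h1 h2] /andP[h3 h4]; apply/andP; split; lra.
have [[k [kN vk]]|nup] := pselect (exists k, (k <= N)%N /\ m%:~R * a + a < v k).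
  apply: (straddle (m + 1)) => q qN; have := win q k qN kN;
    have := win 0%N q (leq0n _) qN.
  rewrite intrD mulrDl mul1r.
  by rewrite !ler_norml => /andP[h1 h2] /andP[h3 h4]; apply/andP; split; lra.
have FE k : (k <= N)%N -> fold (v k) s = (a / 2 + (2 * s - a)) / 2 -
    `| `|v k - (m%:~R * a + a / 2)| - (a / 2 - (2 * s - a)) / 2 |.
  move=> kN; apply: fold_eval => //; apply/andP; split; rewrite leNgt; apply/negP => lt.
    by apply: nlow; exists k.
  by apply: nup; exists k.
have [i' [j' [i'N j'N osc]]] := abs_osc (m%:~R * a + a / 2) e0 iN jN step lij.
have step' k : (k < N)%N ->
    `| `|v k - (m%:~R * a + a / 2)| - `|v k.+1 - (m%:~R * a + a / 2)| | <= e.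
  move=> kN; apply: le_trans (step k kN).
  have -> : v k - v k.+1 = (v k - (m%:~R * a + a / 2)) - (v k.+1 - (m%:~R * a + a / 2))
    by ring.
  exact: ler_dist_dist.
have [i2 [j2 [i2N j2N osc2]]] := abs_osc (v := fun k => `|v k - (m%:~R * a + a / 2)|)
  ((a / 2 - (2 * s - a)) / 2) e0 i'N j'N step' osc.
exists i2, j2; split=> //.
have cancel (k x y : R) : (k - x) - (k - y) = y - x by ring.
by rewrite !FE// cancel distrC; lra.
Qed.

End fold.

(** * Lightness along chains *)

Section chain_light.
Variables (R : realType) (X : metricType R).
Implicit Types (f g u : X -> R) (A B : set X).

(** One constant is both the threshold on the steps and the fraction of oscillation, so lowering it
    weakens both. *)
Definition chain_light f A (c : R) := forall (N : nat) (x : nat -> X) (d : R),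
  (forall i, (i <= N)%N -> A (x i)) -> (forall i, (i < N)%N ->
    mdist (x i) (x i.+1) <= d) ->
  d <= c * mdist (x 0%N) (x N) -> exists i j, [/\ (i <= N)%N, (j <= N)%N &
    c * mdist (x 0%N) (x N) <= `|f (x i) - f (x j)|].

Definition lipschitz_with f (L : R) := forall x y, `|f x - f y| <= L * mdist x y.

Lemma chain_light_weaken f A c c' : c' <= c -> chain_light f A c -> chain_light f A c'.
Proof.
move=> cc H N x d xA step dc.
have le : c' * mdist (x 0%N) (x N) <= c * mdist (x 0%N) (x N).
  by rewrite ler_wpM2r// mdist_ge0.
have [i [j [iN jN osc]]] := H N x d xA step (le_trans dc le).
by exists i, j; split=> //; exact: le_trans osc.
Qed.

Lemma lipschitz_with_weaken f L L' : L <= L' -> lipschitz_with f L -> lipschitz_with f L'.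
Proof.
by move=> LL H x y; rewrite (le_trans (H x y))// ler_wpM2r// mdist_ge0.
Qed.

Definition setdist A x := inf [set mdist x a | a in A].

Lemma setdist_lip A x y : A !=set0 -> `|setdist A x - setdist A y| <= mdist x y.
Proof.
move=> A0; have key z w : setdist A z <= setdist A w + mdist z w.
  apply: inf_image_le => //.
    by exists 0 => _ [a _ <-]; exact: mdist_ge0.
  by move=> a _; rewrite addrC; exact: metric_triangle.
have := key x y; have := key y x; rewrite [mdist y x]metric_sym ler_norml.
by move=> *; apply/andP; split; lra.
Qed.

Lemma setdist_le A x a : A a -> setdist A x <= mdist x a.
Proof.
move=> Aa; apply: ge_inf; last by exists a.
by exists 0 => _ [b _ <-]; exact: mdist_ge0.
Qed.

Lemma setdist_ge A x e : A !=set0 -> (forall a, A a -> e <= mdist x a) ->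
  e <= setdist A x.
Proof.
move=> [a0 Aa0] H; apply: lb_le_inf; first by exists (mdist x a0), a0.
by move=> _ [a Aa <-]; exact: H.
Qed.

(* A chain that stays close to [A] relative to its size is seen by [g]; otherwise it
   has a large piece in [B] along which [setdist A] is nearly constant and large, and
   there the folded copy of [u] dominates because [K] is large. *)
Section union.
Variables (A B : set X) (g u : X -> R) (Lg Lu cg cu : R).
Hypothesis A0 : A !=set0.
Hypothesis Lg0 : 0 < Lg.
Hypothesis Lu1 : 1 <= Lu.
Hypothesis cg0 : 0 < cg <= 1.
Hypothesis cu0 : 0 < cu <= 1.
Hypothesis lipg : lipschitz_with g Lg.
Hypothesis lipu : lipschitz_with u Lu.
Hypothesis lightg : chain_light g A cg.
Hypothesis lightu : chain_light u B cu.

(** With D the distance of the ends of the chain, [eta * D] separates near from far points, and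
    errors of that size cost [g] little of [cg * D]. A far piece has size l = [kap * D], so that [u]
    varies on it by at most an eighth of [s]. Steps up to [c * D] change [u] by at most
    [cu * l / 32], and [eps] makes the drift of [s] equally harmless. [K] lifts an oscillation
    [cu * l / 8] of the fold to [(4 * Lg + 1) * l], above the variation [4 * Lg * l] of [g]. *)
Let eps := cu / 128.
Let s x := eps * setdist A x.
Let K := 8 / cu * (4 * Lg + 1).
Let F x := g x + K * fold (u x) (s x).
Let LF := Lg + K * (Lu + 2 * eps).
Let eta := cg / (8 * (LF + 1)).
Let kap := eps * eta / (32 * Lu).
Let c := cu * kap / (32 * Lu).

Let cg1 : 0 < cg. Proof. by case/andP: cg0. Qed.
Let cg2 : cg <= 1. Proof. by case/andP: cg0. Qed.
Let cu1 : 0 < cu. Proof. by case/andP: cu0. Qed.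
Let cu2 : cu <= 1. Proof. by case/andP: cu0. Qed.
Let eps0 : 0 < eps. Proof. by rewrite /eps; have := cu1; lra. Qed.
Let eps1 : eps <= 1 / 128. Proof. by rewrite /eps; have := cu2; lra. Qed.
Let Lu0 : 0 < Lu. Proof. exact: lt_le_trans ltr01 Lu1. Qed.
Let K0 : 0 < K.
Proof. by rewrite /K mulr_gt0// ?divr_gt0//; have := Lg0; lra. Qed.
Let LF0 : 0 < LF.
Proof. by rewrite /LF addr_gt0// mulr_gt0//; have := eps0; have := Lu0; lra. Qed.
Let eta0 : 0 < eta.
Proof. by rewrite /eta divr_gt0// mulr_gt0//; have := LF0; lra. Qed.
Let etaE : 8 * (LF + 1) * eta = cg.
Proof. by rewrite /eta; field; have := LF0; lra. Qed.
Let eta1 : 8 * eta <= cg.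
Proof.
have : 0 < LF * eta by rewrite mulr_gt0.
by move: etaE eta0; rewrite mulrDr mulr1 mulrDl -mulrA; lra.
Qed.
Let eta2 : 8 * (LF * eta) <= cg.
Proof. by have := etaE; have := eta0; rewrite mulrDr mulr1 mulrDl -mulrA; lra. Qed.
Let kap0 : 0 < kap.
Proof. by rewrite /kap divr_gt0// mulr_gt0. Qed.
Let kapE : 32 * (Lu * kap) = eps * eta.
Proof. by rewrite /kap; field; have := Lu0; lra. Qed.
Let kap1 : kap <= Lu * kap.
Proof. by rewrite ler_peMl// ltW. Qed.
Let epseta : eps * eta <= eta.
Proof. by rewrite ler_piMl ?ltW//; have := eps1; lra. Qed.
Let kap2 : 32 * kap <= eta.
Proof. by have := kap1; have := kapE; have := epseta; lra. Qed.
Let c0 : 0 < c. Proof. by rewrite /c divr_gt0// mulr_gt0. Qed.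
Let cE : 32 * (Lu * c) = cu * kap.
Proof. by rewrite /c; field; have := Lu0; lra. Qed.
Let c1 : c <= Lu * c. Proof. by rewrite ler_peMl// ltW. Qed.
Let cukap : cu * kap <= kap. Proof. by rewrite ler_piMl// ltW. Qed.

Let s_lip x y : `|s x - s y| <= eps * mdist x y.
Proof. by rewrite /s -mulrBr normrM (gtr0_norm eps0) ler_pM2l// setdist_lip. Qed.

Let fold_lip x y : `|fold (u x) (s x) - fold (u y) (s y)| <= (Lu + 2 * eps) * mdist x y.
Proof.
have h1 := fold_lipl (u x) (u y) (s x); have h2 := fold_lipr (u y) (s x) (s y).
have h3 := lipu x y; have h4 := s_lip x y.
have -> : fold (u x) (s x) - fold (u y) (s y) = (fold (u x) (s x) - fold (u y) (s x)) +
  (fold (u y) (s x) - fold (u y) (s y)) by ring.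
by rewrite (le_trans (ler_normD _ _))// mulrDl -mulrA lerD//; lra.
Qed.

Let F_lip : lipschitz_with F LF.
Proof.
move=> x y; rewrite /F.
have -> : g x + K * fold (u x) (s x) - (g y + K * fold (u y) (s y)) =
  (g x - g y) + K * (fold (u x) (s x) - fold (u y) (s y)) by ring.
rewrite (le_trans (ler_normD _ _))// /LF mulrDl lerD//.
by rewrite normrM (gtr0_norm K0) -[X in _ <= X]mulrA ler_pM2l.
Qed.

Let F_on_A x : A x -> F x = g x.
Proof.
move=> Ax; have sx : s x = 0.
  apply/eqP; rewrite mulf_eq0; apply/orP; right; rewrite eq_le.
  by rewrite -{1}(mdistxx x) setdist_le//= setdist_ge// => a _; exact: mdist_ge0.
rewrite /F sx; have -> : fold (u x) 0 = 0.
  by apply/eqP; rewrite eq_le fold_ge0 fold_le_scale.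
by rewrite mulr0 addr0.
Qed.

(** Each point of the chain is replaced by a nearby point of [A], where [F] is [g]; the Lipschitz
    bound of [F] carries the oscillation back. *)
Let near_case N (x : nat -> X) d :
  (forall i, (i < N)%N -> mdist (x i) (x i.+1) <= d) ->
  d <= c * mdist (x 0%N) (x N) ->
  (forall i, (i <= N)%N -> exists2 a, A a & mdist (x i) a <= eta * mdist (x 0%N) (x N)) ->
  exists i j, [/\ (i <= N)%N,
    (j <= N)%N & c * mdist (x 0%N) (x N) <= `|F (x i) - F (x j)|].
Proof.
move=> step dc near; set D := mdist (x 0%N) (x N) in dc near *.
have D0 : 0 <= D by exact: mdist_ge0.
have /choice[a Ha] : forall i, exists a, (i <= N)%N -> A a /\ mdist (x i) a <= eta * D.
  move=> i; have [iN|Ni] := leqP i N; last by exists (x 0%N).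
  by have [a Aa da] := near i iN; exists a.
have etaD : 0 <= eta * D by rewrite mulr_ge0// ltW.
have D1 : D <= mdist (a 0%N) (a N) + 2 * (eta * D).
  have [_ h1] := Ha 0%N (leq0n _); have [_ h2] := Ha N (leqnn _).
  have := metric_triangle (x 0%N) (a 0%N) (x N);
    have := metric_triangle (a 0%N) (a N) (x N).
  by rewrite [mdist (a N) (x N)]metric_sym -/D; lra.
have stepa i : (i < N)%N -> mdist (a i) (a i.+1) <= d + 2 * (eta * D).
  move=> iN; have [_ h1] := Ha i (ltnW iN); have [_ h2] := Ha i.+1 iN.
  have := metric_triangle (a i) (x i) (a i.+1);
    have := metric_triangle (x i) (x i.+1) (a i.+1).
  by rewrite [mdist (a i) (x i)]metric_sym; have := step i iN; lra.
have cD : c * D <= kap * D.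
  by rewrite ler_wpM2r//; have := c1; have := cE; have := cukap; have := kap0; lra.
have kD : 32 * (kap * D) <= eta * D by rewrite mulrA ler_wpM2r.
have eD : 8 * (eta * D) <= cg * D by rewrite mulrA ler_wpM2r.
have eD2 : 8 * (LF * eta * D) <= cg * D by rewrite mulrA ler_wpM2r.
have cgD : cg * D <= D by rewrite ler_piMl.
have cga : cg * D - 2 * (eta * D) <= cg * mdist (a 0%N) (a N).
  have : cg * D <= cg * (mdist (a 0%N) (a N) + 2 * (eta * D)) by rewrite ler_pM2l.
  rewrite mulrDr; have : cg * (2 * (eta * D)) <= 2 * (eta * D).
    by rewrite ler_piMl// mulr_ge0.
  lra.
have dca : d + 2 * (eta * D) <= cg * mdist (a 0%N) (a N) by lra.
have [i [j [iN jN osc]]] := lightg (fun i iN => (Ha i iN).1) stepa dca.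
exists i, j; split=> //.
have [Aai hi] := Ha i iN; have [Aaj hj] := Ha j jN.
have Fi := F_lip (x i) (a i); have Fj := F_lip (x j) (a j).
rewrite (F_on_A Aai) in Fi; rewrite (F_on_A Aaj) in Fj.
have Fi' : LF * mdist (x i) (a i) <= LF * eta * D by rewrite -mulrA ler_pM2l.
have Fj' : LF * mdist (x j) (a j) <= LF * eta * D by rewrite -mulrA ler_pM2l.
have tri : `|g (a i) - g (a j)| <= `|F (x i) - F (x j)| + `|F (x i) - g (a i)| + `|F (x
  j) - g (a j)|.
  have -> : g (a i) - g (a j) = (F (x i) - F (x j)) - (F (x i) - g (a i)) + (F (x j) - g
    (a j)) by ring.
  by rewrite (le_trans (ler_normD _ _))// lerD2r (le_trans (ler_normB _ _)).
lra.
Qed.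

(** The piece up to the first point at distance [l] from [y 0] stays within [2 * l] of it, which is
    less than its distance to [A]; the piece therefore lies in [B]. *)
Let far_case M (y : nat -> X) (d D : R) : 0 < D ->
  (forall k, (k <= M)%N -> (A `|` B) (y k)) ->
  (forall k, (k < M)%N -> mdist (y k) (y k.+1) <= d) ->
  d <= c * D -> D / 2 <= mdist (y 0%N) (y M) -> eta * D <= setdist A (y 0%N) ->
  exists i j, [/\ (i <= M)%N, (j <= M)%N & c * D <= `|F (y i) - F (y j)|].
Proof.
move=> D0 yAB step dc far dist.
have etaD : 0 < eta * D by exact: mulr_gt0.
pose l := kap * D; have l0 : 0 < l by exact: mulr_gt0.
have cD : c * D <= l.
  by rewrite ler_pM2r//; have := c1; have := cE; have := cukap; have := kap0; lra.
have kD : 32 * l <= eta * D by rewrite /l mulrA ler_pM2r.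
have eD : 8 * (eta * D) <= D.
  by rewrite mulrA ger_pMl//; have := eta1; have := cg2; lra.
have ex : exists k, l <= mdist (y 0%N) (y k) by exists M; lra.
case: (ex_minnP ex) => q lq qmin.
have qM : (q <= M)%N by apply: qmin; lra.
have q0 : (0 < q)%N by case: (q) lq => //; rewrite mdistxx; lra.
have close k : (k <= q)%N -> mdist (y 0%N) (y k) <= 2 * l.
  rewrite leq_eqVlt => /predU1P[->|kq].
    have := metric_triangle (y 0%N) (y q.-1) (y q).
    have := step q.-1; rewrite prednK// => /(_ qM).
    have : mdist (y 0%N) (y q.-1) < l.
      by rewrite ltNge; apply/negP => /qmin; rewrite leqNgt prednK ?leqnn.
    lra.
  by apply: ltW; apply: lt_trans (_ : l < _); [rewrite ltNge; apply/negP => /qmin;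
    rewrite leqNgt kq|lra].
have inB k : (k <= q)%N -> B (y k).
  move=> kq; case: (yAB k (leq_trans kq qM)) => // Ak.
  have := setdist_le (y 0%N) Ak; have := close k kq; lra.
have cul : cu * l <= cu * mdist (y 0%N) (y q) by rewrite ler_pM2l.
have dcq : d <= cu * mdist (y 0%N) (y q).
  have : c * D <= cu * l.
    rewrite /l mulrA ler_pM2r//; have := c1; have := cE; have := mulr_gt0 cu1 kap0; lra.
  lra.
have [i [j [iq jq osc]]] := lightu inB (fun k kq => step k (leq_trans kq qM)) dcq.
pose e := Lu * d.
have ule : 32 * e <= cu * l.
  rewrite /e /l mulrA; apply: (@le_trans _ _ (32 * (Lu * (c * D)))).
    by rewrite -mulrA ler_pM2l// ler_pM2l.
  by rewrite [X in _ <= X]mulrA -cE; rewrite !mulrA.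
have d0 : 0 <= e.
  by rewrite mulr_ge0 ?(ltW Lu0)// (le_trans _ (step 0%N (leq_trans q0 qM)))// mdist_ge0.
have s0 : 0 < s (y 0%N) by rewrite /s mulr_gt0// (lt_le_trans etaD).
have s32 : 32 * (Lu * l) <= s (y 0%N).
  rewrite /s /l; apply: (@le_trans _ _ (eps * (eta * D))); last by rewrite ler_pM2l.
  by rewrite [eps * _]mulrA -kapE !mulrA.
(* The amplitude is frozen at [s (y 0)]; [sl] below pays for its actual variation. *)
have [|||i' [j' [i'q j'q osc']]] := @fold_osc _ (fun k =>
  u (y k)) (s (y 0%N)) e (cu * l) q i j s0 d0 iq jq.
- move=> k kq; apply: le_trans (lipu _ _) _; rewrite ler_pM2l//.
  by apply: step; exact: leq_trans kq qM.
- move=> k k' kq k'q; apply: le_trans (lipu _ _) _.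
  have : Lu * mdist (y k) (y k') <= Lu * (4 * l).
    rewrite ler_pM2l//; have := close k kq; have := close k' k'q.
    have := metric_triangle (y k) (y 0%N) (y k');
      rewrite [mdist (y k) (y 0%N)]metric_sym; lra.
  have -> : Lu * (4 * l) = 4 * (Lu * l) by ring.
  lra.
- exact: le_trans cul osc.
exists i', j'; split; [exact: leq_trans qM|exact: leq_trans qM|].
have sl k : (k <= q)%N -> `|fold (u (y k)) (s (y k)) - fold (u (y k)) (s (y 0%N))| <= cu
  * l / 32.
  move=> kq; apply: le_trans (fold_lipr _ _ _) _.
  have := s_lip (y k) (y 0%N).
  have : eps * mdist (y k) (y 0%N) <= eps * (2 * l) by rewrite ler_pM2l// metric_sym
    close.
  have -> : eps * (2 * l) = cu * l / 64 by rewrite /eps; field.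
  lra.
set P := fun k => fold (u (y k)) (s (y k)).
have oscP : cu * l / 8 <= `|P i' - P j'|.
  have h1 := sl i' i'q; have h2 := sl j' j'q.
  have tri : `|fold (u (y i')) (s (y 0%N)) - fold (u (y j')) (s (y 0%N))| <=
     `|P i' - P j'| + `|P i' - fold (u (y i')) (s (y 0%N))| + `|P j' - fold (u (y j'))
       (s (y 0%N))|.
    set a := fold (u (y i')) _; set b := fold (u (y j')) _.
    have -> : a - b = (P i' - P j') - (P i' - a) + (P j' - b) by ring.
    by rewrite (le_trans (ler_normD _ _))// lerD2r (le_trans (ler_normB _ _)).
  move: h1 h2 tri osc'; rewrite -/(P i') -/(P j'); lra.
have gl : `|g (y i') - g (y j')| <= 4 * Lg * l.
  apply: le_trans (lipg _ _) _; rewrite [4 * Lg]mulrC -mulrA ler_pM2l//.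
  have := close i' i'q; have := close j' j'q.
  have := metric_triangle (y i') (y 0%N) (y j');
    rewrite [mdist (y i') (y 0%N)]metric_sym; lra.
have KP : (4 * Lg + 1) * l <= K * `|P i' - P j'|.
  apply: (@le_trans _ _ (K * (cu * l / 8))); last by rewrite ler_pM2l.
  rewrite /K le_eqVlt; apply/orP; left; apply/eqP; field.
  by have := cu1; lra.
have tri : K * `|P i' - P j'| <= `|F (y i') - F (y j')| + `|g (y i') - g (y j')|.
  have -> : K * `|P i' - P j'| = `|(F (y i') - F (y j')) - (g (y i') - g (y j'))|.
    rewrite -[X in X * _](gtr0_norm K0) -normrM; congr `|_|.
    by rewrite /F /P; ring.
  exact: ler_normB.
move: KP; rewrite mulrDl mul1r; lra.
Qed.

Lemma chain_light_union : exists F' L' c', [/\ 0 < L', 0 < c', lipschitz_with F' L' &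
  chain_light F' (A `|` B) c'].
Proof.
exists F, LF, c; split=> // N x d xAB step dc.
set D := mdist (x 0%N) (x N) in dc *.
have [D0|D0] := leP D 0.
  exists 0%N, 0%N; split=> //; rewrite subrr normr0.
  by rewrite mulr_ge0_le0// ltW.
have [near|] := pselect (forall i, (i <= N)%N -> exists2 a,
  A a & mdist (x i) a <= eta * D).
  exact: (near_case step dc near).
move=> /existsNP[i /not_implyP[iN nnear]].
have dist : eta * D <= setdist A (x i).
  apply: setdist_ge => // a Aa; rewrite leNgt; apply/negP => lt.
  by apply: nnear; exists a => //; exact: ltW.
(* The far point [x i] is at least [D / 2] from one end of the chain; the chain is followed from
   [x i] to that end, backwards if it is the first. *)
have [right|left] := leP (D / 2) (mdist (x i) (x N)).
  have [|||||k [k' [kM k'M osc]]] := @far_case (N - i)%N (fun k => x (i + k)%N) d D D0.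
  - by move=> k kN; apply: xAB; rewrite -leq_subRL.
  - by move=> k kN; rewrite addnS; apply: step; rewrite -ltn_subRL.
  - by [].
  - by rewrite addn0 subnKC.
  - by rewrite addn0.
  by exists (i + k)%N, (i + k')%N; split; rewrite -?leq_subRL.
have [|||||k [k' [kM k'M osc]]] := @far_case i (fun k => x (i - k)%N) d D D0.
- by move=> k ki; apply: xAB; exact: leq_trans (leq_subr _ _) iN.
- move=> k ki; rewrite -(subnSK ki) metric_sym; apply: step.
  by rewrite subnSK// (leq_trans (leq_subr _ _)).
- by [].
- rewrite subn0 subnn; have := metric_triangle (x 0%N) (x i) (x N).
  by rewrite [mdist (x 0%N) (x i)]metric_sym -/D; lra.
- by rewrite subn0.
by exists (i - k)%N, (i - k')%N; split; rewrite ?(leq_trans (leq_subr _ _)).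
Qed.

End union.
End chain_light.

(** * Lipschitz dimension *)

Section delta_chains.
Variables (R : realType) (X : metricType R).
Implicit Types (U : set X) (d : R).

(** A chain with prescribed ends, whereas [delta_connected] only asks for a chain that contains both
    points. *)
Definition linked U d x y := exists p : seq X,
  [/\ path (fun a b => mdist a b <= d) x p, last x p = y & forall z, z \in x :: p -> U z].

Lemma linked_trans U d x y z : linked U d x y -> linked U d y z -> linked U d x z.
Proof.
move=> [p [pp lp Up]] [q [pq lq Uq]]; exists (p ++ q); split.
- by rewrite cat_path pp lp.
- by rewrite last_cat lp.
- move=> w; rewrite -cat_cons mem_cat => /orP[/Up//|wq].
  by apply: Uq; rewrite inE wq orbT.
Qed.

Lemma linked_sym U d x y : linked U d x y -> linked U d y x.
Proof.
move=> [p [pp lp Up]]; exists (rev (belast x p)); split.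
- rewrite -lp rev_path; move: pp; apply: sub_path => a b /=; by rewrite metric_sym.
- by case: p pp lp Up => [_ <- //|a p _ _ _]; rewrite /= rev_cons last_rcons.
- move=> z; rewrite inE mem_rev => /predU1P[->|/mem_belast/Up//].
  by apply: Up; rewrite -lp mem_last.
Qed.

Lemma linked_prefix U d x p y : path (fun a b => mdist a b <= d) x p ->
  (forall z, z \in x :: p -> U z) -> y \in x :: p -> linked U d x y.
Proof.
elim: p x => [|a p IH] x /=.
  move=> _ Ux; rewrite inE => /eqP ->; exists [::]; split=> // z zx; exact: Ux.
move=> /andP[xa pa] Ux; rewrite inE => /predU1P[->|yp].
  by exists [::]; split=> // z; rewrite inE => /eqP ->; apply: Ux; rewrite mem_head.
have Ua z : z \in a :: p -> U z by move=> h; apply: Ux; rewrite inE h orbT.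
have [q [pq lq Uq]] := IH a pa Ua yp.
exists (a :: q); split=> //=; first by rewrite xa.
by move=> z; rewrite inE => /predU1P[->|/Uq//]; apply: Ux; rewrite mem_head.
Qed.

Lemma delta_connected_linked U d x y : delta_connected d U -> U x -> U y ->
  linked U d x y.
Proof.
move=> Uc Ux Uy; have [[|a s] [ss sU xs ys]] := Uc x y Ux Uy; first by [].
apply: (@linked_trans _ _ _ a); last exact: linked_prefix ys.
apply: linked_sym; exact: linked_prefix xs.
Qed.

Lemma delta_component_linked d x : delta_component d [set: X] [set y | linked [set:
  X] d x y].
Proof.
split=> // [y z xy xz|V UV _ Vc].
  have [p [pp lp _]] := linked_trans (linked_sym xy) xz.
  exists (y :: p); split=> //; last by rewrite -lp mem_last.
    move=> w /= wp; apply: linked_trans xy _.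
    by apply: linked_prefix wp.
  by rewrite mem_head.
have Vx : V x by apply: UV; exists [::].
apply/seteqP; split=> [y Vy|//].
have [p [pp lp _]] := delta_connected_linked Vc Vx Vy.
by exists p.
Qed.

End delta_chains.

Section mcshane.
Variables (R : realType) (X : metricType R) (A : set X) (f : restricted A -> R) (L : R).
Hypothesis L0 : 0 <= L.
Hypothesis lipf : forall x y, `|f x - f y| <= L * mdist x y.

(** The McShane extension, an infimum of cones of slope [L]. *)
Lemma mcshane : exists F : X -> R, lipschitz_with F L /\ forall a : restricted A,
  F (sval a) = f a.
Proof.
have [[a0 _]|noA] := pselect (exists a : restricted A, True); last first.
  exists (fun=> 0); split=> [x y|a]; first by rewrite subrr normr0 mulr_ge0 ?mdist_ge0.
  by exfalso; apply: noA; exists a.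
pose F x := inf [set f a + L * mdist x (sval a) | a in [set: restricted A]].
have lb x : has_lbound [set f a + L * mdist x (sval a) | a in [set: restricted A]].
  exists (f a0 - L * mdist x (sval a0)) => _ [a _ <-].
  have h1 := lipf a0 a; have h2 := ler_norm (f a0 - f a).
  have h3 : mdist a0 a <= mdist x (sval a0) + mdist x (sval a).
    have := metric_triangle (sval a0) x (sval a); rewrite [mdist (sval a0) x]metric_sym.
    by [].
  have : L * mdist a0 a <= L * (mdist x (sval a0) + mdist x (sval a)) by rewrite
    ler_wpM2l.
  rewrite mulrDr; lra.
exists F; split=> [x y|a].
  have key z w : F z <= F w + L * mdist z w.
    apply: inf_image_le => //; first by exists a0.
    move=> a _; rewrite -addrA lerD2l -mulrDr ler_wpM2l// addrC.
    exact: metric_triangle.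
  have := key x y; have := key y x; rewrite [mdist y x]metric_sym ler_norml.
  by move=> *; apply/andP; split; lra.
apply/eqP; rewrite eq_le; apply/andP; split.
  by apply: ge_inf => //; exists a; rewrite // mdistxx mulr0 addr0.
apply: lb_le_inf; first by exists (f a0 + L * mdist (sval a) (sval a0)), a0.
move=> _ [b _ <-]; have h2 := ler_norm (f a - f b).
have h1 : `|f a - f b| <= L * mdist (sval a) (sval b) := lipf a b.
lra.
Qed.
End mcshane.

Section trees.
Variables (R : realType) (X : metricType R).

(** The arc between the ends of a chain is covered by the arcs between consecutive points, of
    diameter at most [arc_turning C * d]. The points of the arc where [f] oscillates are therefore
    close to points of the chain. *)
Lemma tree_chain_light (A : set X) : quasiconformal_tree (restricted A) ->
  exists F L c, [/\ 0 < L, 0 < c, lipschitz_with F L & chain_light F A c].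
Proof.
move=> [[cT _ _ arcs] [C C1 bt] _].
have C0 : 0 <= C by exact: le_trans ler01 C1.
have [[p _]|noA] := pselect (exists p : restricted A, True); last first.
  exists (fun=> 0), 1, 1; split=> //.
    by move=> x y; rewrite subrr normr0 mulr_ge0 ?mdist_ge0.
  move=> N x d xA; exfalso; apply: noA.
  by exists (exist _ (x 0%N) (mem_set (xA 0%N (leq0n _)))).
have [f [L [c [L0 c0 lipf light]]]] := tree_light arcs cT C0 bt p.
have [F [lipF FE]] := mcshane (ltW L0) lipf.
have K0 := arc_turning_gt0 C0.
have k0 : 0 < 4 * (L * arc_turning C) + 2 by rewrite ltr_wpDl// mulr_ge0// mulr_ge0// ltW.
(* Moving the two points to the chain costs at most 2 [L * arc_turning C * d]; the term 4 in the
   denominator keeps this below half of the oscillation. *)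
pose c' := c / (4 * (L * arc_turning C) + 2).
have c'0 : 0 < c' by rewrite divr_gt0.
have c'E : 4 * (L * arc_turning C * c') + 2 * c' = c.
  by rewrite /c'; field; rewrite gt_eqF.
exists F, L, c'; split=> // N x d xA step dc.
set D := mdist (x 0%N) (x N) in dc *.
have [D0|D0] := leP D 0.
  exists 0%N, 0%N; split=> //; rewrite subrr normr0.
  by rewrite mulr_ge0_le0// ltW.
have N0 : (0 < N)%N by case: (N) @D D0 {dc} => //=; rewrite mdistxx ltxx.
have d0 : 0 <= d by exact: le_trans (mdist_ge0 _ _) (step 0%N N0).
have /choice[y yE] : forall k, exists y : restricted A, (k <= N)%N -> sval y = x k.
  move=> k; have [kN|Nk] := leqP k N; last by exists p.
  by exists (exist _ (x k) (mem_set (xA k kN))).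
have dE k k' : (k <= N)%N -> (k' <= N)%N -> mdist (y k) (y k') = mdist (x k) (x k').
  by move=> kN k'N; rewrite -!yE.
have cover n : (n <= N)%N -> forall a, seg (y 0%N) (y n) a ->
    exists2 k, (k <= N)%N & mdist a (y k) <= arc_turning C * d.
  elim: n => [_ a /segxx ->|n IH nN a].
    by exists 0%N => //; rewrite mdistxx mulr_ge0// ltW.
  move=> /(seg_tri arcs (y n))[/(IH (ltnW nN))//|ya].
  exists n; first exact: ltnW.
  apply: le_trans (seg_bounded arcs cT C0 bt ya (seg_l arcs _ _)) _.
  by rewrite ler_pM2l// dE// ?step// ltnW.
have [a [b [sa sb osc]]] := light (y 0%N) (y N).
have [i iN ai] := cover N (leqnn _) a sa.
have [j jN bj] := cover N (leqnn _) b sb.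
exists i, j; split=> //.
rewrite -yE// -[x j]yE// !FE.
have La := lipf a (y i); have Lb := lipf b (y j).
have La' : L * mdist a (y i) <= L * arc_turning C * d by rewrite -mulrA ler_pM2l.
have Lb' : L * mdist b (y j) <= L * arc_turning C * d by rewrite -mulrA ler_pM2l.
have Ld : L * arc_turning C * d <= L * arc_turning C * c' * D.
  by rewrite -[X in _ <= X]mulrA ler_pM2l ?(mulr_gt0 L0 K0).
rewrite dE// -/D -c'E in osc.
have tri : `|f b - f a| <= `|f (y i) - f (y j)| + `|f a - f (y i)| + `|f b - f (y j)|.
  have -> : f b - f a = - (f (y i) - f (y j)) - (f a - f (y i)) + (f b - f (y j)) by ring.
  rewrite (le_trans (ler_normD _ _))// lerD2r (le_trans (ler_normB _ _))//.
  by rewrite normrN.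
have cD : 0 <= c' * D by rewrite mulr_ge0// ltW.
have MD : 0 <= L * arc_turning C * c' * D.
  by apply: mulr_ge0 (ltW D0); apply: mulr_ge0 (ltW c'0); exact: ltW (mulr_gt0 L0 K0).
have E : (4 * (L * arc_turning C * c') + 2 * c') * D = 4 * (L * arc_turning C * c' * D)
  + 2 * (c' * D).
  by ring.
rewrite E in osc; move: osc tri La Lb La' Lb' Ld MD cD.
move: (L * arc_turning C * c' * D) (L * arc_turning C * d) (c' * D) (L * mdist a _) (L *
  mdist b _).
by move: `|f b - f a| `|f (y i) - f (y j)| `|f a - _| `|f b - _| => *; lra.
Qed.

Lemma finite_union_chain_light (I : eqType) (T : I -> set X) (s : seq I) :
  (forall i, quasiconformal_tree (restricted (T i))) ->
  exists F L c, [/\ 0 < L, 0 < c,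
    lipschitz_with F L & chain_light F (\bigcup_(i in [set` s]) T i) c].
Proof.
move=> Tqc; elim: s => [|i s [g [Lg [cg [Lg0 cg0 lipg lightg]]]]].
  exists (fun=> 0), 1, 1; split=> //.
    by move=> x y; rewrite subrr normr0 mulr_ge0 ?mdist_ge0.
  by move=> N x d xA; have [j] := xA 0%N (leq0n _).
have [u [Lu [cu [Lu0 cu0 lipu lightu]]]] := tree_chain_light (Tqc i).
have -> : \bigcup_(j in [set` i :: s]) T j = (\bigcup_(j in [set` s]) T j) `|` T i.
  apply/seteqP; split=> x.
    by move=> [j /=]; rewrite inE => /predU1P[->|js]; [right|left; exists j].
  move=> [[j /= js Tj]|Ti]; first by exists j => //=; rewrite inE js orbT.
  by exists i => //=; rewrite mem_head.
(* The folding amplitude is a distance to the earlier trees, so their union has to be nonempty. *)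
have [A0|A0] := pselect (\bigcup_(j in [set` s]) T j !=set0); last first.
  exists u, Lu, cu; split=> // N x d xA; apply: lightu => k kN.
  by case: (xA k kN) => // Ak; exfalso; apply: A0; exists (x k).
have min1 (c : R) : 0 < c -> 0 < Num.min c 1 <= 1.
  by move=> c0; rewrite lt_min c0 ltr01 ge_min lexx orbT.
have minl (c : R) : Num.min c 1 <= c by rewrite ge_min lexx.
have Lu1 : 1 <= Lu + 1 by rewrite lerDr ltW.
have LuS : Lu <= Lu + 1 by rewrite lerDl.
exact: (chain_light_union A0 Lg0 Lu1 (min1 _ cg0) (min1 _ cu0) lipg
  (lipschitz_with_weaken LuS lipu) (chain_light_weaken (minl _) lightg)
    (chain_light_weaken (minl _) lightu)).
Qed.

(** Two points of an [r]-component further apart than [r / c] would be joined by an [r]-chain in it,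
    on which [F] oscillates by more than [r], the bound on the diameter of [E]. *)
Lemma chain_light_lipschitz_dim (F : X -> R) (L c : R) : 0 < L -> 0 < c ->
  lipschitz_with F L ->
  chain_light F [set: X] c -> lipschitz_dim_le X 1.
Proof.
move=> L0 c0 lipF lightF.
pose f x : euclidean R 1 := (\row_(i < 1) F x : 'rV[R]_1).
have dE x y : mdist (f x) (f y) = `|F x - F y|.
  rewrite -[LHS]/(euclidean_dist (f x) (f y)) /euclidean_dist big_ord1.
  by rewrite sqrtr_sqr /f !mxE.
exists f, L, c^-1; split=> //.
- by rewrite invr_gt0.
- by move=> x y; rewrite dE.
move=> r E r0 Er U [UE Uc _].
apply: ge_ereal_sup => _ [[x y] [/= Ux Uy] <-]; rewrite lee_fin.
rewrite -ler_pdivrMl ?invr_gt0// invrK.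
have [rle|lt] := leP (c * mdist x y) r; first by [].
have [p [pp lp Up]] := delta_connected_linked Uc Ux Uy.
have xN : nth y (x :: p) (size p) = y by have := nth_last y (x :: p); rewrite /= lp.
have [|||i [j [iN jN osc]]] := lightF (size p) (fun k => nth y (x :: p) k) r.
- by [].
- by move=> k kp; have /pathP/(_ k kp) := pp => /(_ y).
- by rewrite xN ltW.
have Uk k : (k <= size p)%N -> U (nth y (x :: p) k) by move=> kp; apply/Up/mem_nth.
have := mdist_le_diam Er (UE _ (Uk i iN)) (UE _ (Uk j jN)).
rewrite dE => dr; suff : c * mdist x y <= r by rewrite leNgt lt.
apply: le_trans dr; apply: le_trans osc.
by rewrite xN.
Qed.

(** For a map to a point, lightness bounds the [r]-components of all of [X] by [Q * r].
    Connectedness puts [x] and [y] into one component for every [r], and the chosen [r] makes the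
    bound half their distance. *)
Lemma lipschitz_dim_neq0 (A : set X) (x y : X) : compact [set: restricted A] ->
  connected [set: restricted A] -> A x -> A y -> x <> y -> ~ lipschitz_dim_le X 0.
Proof.
move=> cA kA Ax Ay /eqP xy [f [L [Q [L0 Q0 _ light]]]].
have d0 : 0 < mdist x y by rewrite mdist_gt0.
pose r := mdist x y / (2 * Q).
have r0 : 0 < r by rewrite divr_gt0// mulr_gt0.
have r2 : 0 < r / 2 by rewrite divr_gt0.
have diamT : (diam [set: euclidean R 0] <= r%:E)%E.
  apply: ge_ereal_sup => _ [[z w] _ <-] /=; rewrite lee_fin.
  rewrite -[mdist z w]/(euclidean_dist z w) /euclidean_dist big_ord0 sqrtr0.
  exact: ltW.
have comp : delta_component r (f @^-1` [set: euclidean R 0]) [set z | linked [set: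
  X] r x z].
  exact: delta_component_linked.
have dU := light r _ r0 diamT _ comp.
have [s net] := compact_net cA r2.
pose a : restricted A := exist _ x (mem_set Ax).
pose b : restricted A := exist _ y (mem_set Ay).
have [q [pq lq _ _]] := connected_chain kA net (I : [set: restricted A] a)
  (I : [set: restricted A] b).
have Uy : linked [set: X] r x y.
  exists (map sval q); split=> //.
    rewrite -[x]/(sval a) path_map; move: pq; apply: sub_path => z w /=.
    by have -> : 2 * (r / 2) = r by field.
  by rewrite -[x]/(sval a) last_map lq.
have Ux : linked [set: X] r x x by exists [::].
have := mdist_le_diam dU Ux Uy; rewrite /r.
have -> : Q * (mdist x y / (2 * Q)) = mdist x y / 2 by field; rewrite gt_eqF.
lra.
Qed.
End trees.

(** A finite metric space has Lipschitz dimension 0, so the value 1 requires some tree to have two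
    distinct points; [T_nondegenerate] states this. *)
Theorem theorem4 (R : realType) (X : metricType R) (I : finType)
    (T : I -> set X)
    (T_qc : forall i : I, quasiconformal_tree (restricted (T i)))
    (T_cover : \bigcup_(i in [set: I]) T i = [set: X])
    (T_nondegenerate : exists (i : I) (x y : X), [/\ T i x, T i y & x <> y]) :
  lipschitz_dim X = 1%E.
Proof.
have [F [L [c [L0 c0 lipF light]]]] := finite_union_chain_light (enum I) T_qc.
have eT : \bigcup_(i in [set` enum I]) T i = [set: X].
  by rewrite -T_cover; apply: eq_bigcupl; split=> i // _; rewrite /= mem_enum.
rewrite eT in light.
have dim1 := chain_light_lipschitz_dim L0 c0 lipF light.
apply/eqP; rewrite eq_le; apply/andP; split.
  by apply: ereal_inf_lbound; exists 1%N.
apply: le_ereal_inf_tmp => _ [[|n] /= dimn <-]; last by rewrite lee_fin ler1n.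
have [i [x [y [Tx Ty xy]]]] := T_nondegenerate.
have [[cT kT _ _] _ _] := T_qc i.
by have := lipschitz_dim_neq0 cT kT Tx Ty xy.
Qed.
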